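(* Let $S$ be a complex manifold of dimension $n$, $p\in S$, and let $D=D_1\cup D_2\subseteq S$ be a divisor defined at $p$ by $gh=0$, with $(D_1,p)=\{g=0\}$ and $(D_2,p)=\{h=0\}$, where $g,h\in\mathcal{O}_{S,p}$ are reduced non-units (not necessarily irreducible) with no common factor. Then $D=D_1\cup D_2$ is splayed at $p$ if and only if $$(gh)+J_{gh}=(g,h)\cap\big((g)+J_g\big)\cap\big((h)+J_h\big)$$ as ideals of $\mathcal{O}_{S,p}$.
   Context: Work in the complex analytic category. $\mathcal{O}_{S,p}\cong\mathbb{C}\{x_1,\dots,x_n\}$ is the local ring of germs of holomorphic functions at $p$, with $(x_1,\dots,x_n)$ complex coordinates of $S$ at $p$. A divisor is a hypersurface; its local defining equations are always taken reduced (square-free). For $f\in\mathcal{O}_{S,p}$, the Jacobian ideal is $J_f=(\partial_{x_1}f,\dots,\partial_{x_n}f)\subseteq\mathcal{O}_{S,p}$. Splayed: $(D,p)=(D_1,p)\cup(D_2,p)$ is splayed at $p$ (with splayed components $D_1,D_2$) if there exist complex coordinates $(x_1,\dots,x_n)$ at $p$ and an integer $1\le k\le n-1$ such that $D$ is defined by $h_1(x_1,\dots,x_k)\,h_2(x_{k+1},\dots,x_n)$, where $h_i$ is a reduced defining equation of $D_i$ at $p$ ($i=1,2$; the $h_i$ need not be irreducible). *)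

(* Defs.v *)
From HB Require Import structures.
From mathcomp Require Import all_boot all_order all_algebra.
From mathcomp Require Import complex.
From mathcomp Require Import all_classical all_reals all_analysis.

Set Implicit Arguments.
Unset Strict Implicit.
Unset Printing Implicit Defensive.

Import Order.TTheory GRing.Theory Num.Theory.
Import numFieldNormedType.Exports.

Local Open Scope classical_set_scope.
Local Open Scope ring_scope.

(* Typing R[i] through a numFieldType structure gives it, and the spaces
   'rV[Cx R]_m, the topology that MathComp-Analysis puts on every
   numFieldType. *)
Definition Cx (R : realType) : numClosedFieldType := R[i].

Section PowerSeries.
Variables (R : realType) (m : nat).
Local Notation C := (Cx R).

(* The sum of a_alpha z^alpha over the multi-indices alpha whose entries are
   all smaller than N. *)
Definition power_psum (a : {ffun 'I_m -> nat} -> C) (z : 'rV[C]_m) (N : nat) : C :=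
  \sum_(alpha : {ffun 'I_m -> 'I_N})
    a [ffun i => val (alpha i)] * \prod_(i < m) z 0 i ^+ alpha i.

(* Holomorphy at w, and thereby on a neighbourhood of w, in the sense of
   convergent power series: the expansion converges absolutely on some
   polydisc centred at w (bounded partial sums of moduli) and its sum is f
   near w. *)
Definition analytic_at (f : 'rV[C]_m -> C) (w : 'rV[C]_m) : Prop :=
  exists a : {ffun 'I_m -> nat} -> C,
    (exists r M : C, 0 < r /\
       forall N, power_psum (fun alpha => `|a alpha|) (const_mx r) N <= M) /\
    (\forall z \near w, power_psum a (z - w) @ \oo --> f z).

End PowerSeries.

(* The map chart_inv is total; only its values on the image of chart_dom
   matter. *)
Record chart (R : realType) (n : nat) (S : Type) := Chart {
  chart_dom : set S;
  chart_map :> S -> 'rV[Cx R]_n;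
  chart_inv : 'rV[Cx R]_n -> S }.

Definition is_chart (R : realType) (n : nat) (S : topologicalType)
    (c : chart R n S) : Prop :=
  [/\ open (chart_dom c) /\ open (c @` chart_dom c),
      forall q, chart_dom c q -> chart_inv c (c q) = q,
      {within chart_dom c, continuous c} &
      {within c @` chart_dom c, continuous (chart_inv c)}].

Definition holomorphic_transition (R : realType) (n : nat) (S : Type)
    (c d : chart R n S) : Prop :=
  forall q, chart_dom c q -> chart_dom d q ->
  forall i, analytic_at (fun z => d (chart_inv c z) 0 i) (c q).

Record complexManifold (R : realType) (n : nat) := ComplexManifold {
  manifold_space :> topologicalType;
  atlas : set (chart R n manifold_space);
  manifold_hausdorff : hausdorff_space manifold_space;
  manifold_second_countable : @second_countable manifold_space;
  atlas_chart : forall c, atlas c -> is_chart c;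
  atlas_cover : forall q, exists2 c, atlas c & chart_dom c q;
  atlas_transition : forall c d, atlas c -> atlas d ->
    holomorphic_transition c d }.

Section Germs.
Variables (R : realType) (n : nat) (S : complexManifold R n) (p : S).
Local Notation C := (Cx R).

(* Complex coordinates at p: a chart, compatible with the atlas, that maps
   p to the origin. *)
Definition coordinates_at (x : chart R n S) : Prop :=
  [/\ is_chart x, chart_dom x p, x p = 0 &
      forall c, atlas c ->
        holomorphic_transition c x /\ holomorphic_transition x c].

(* An element of O_{S,p} is represented by a function S -> C that is
   holomorphic at p, two functions representing the same germ when germ_eq
   holds. The ideals below are the corresponding sets of representatives; they
   are stable under germ_eq on functions holomorphic at p, so that
   equality of ideals is equality of these sets. *)
Definition holomorphic_at (f : S -> C) : Prop :=
  forall c, atlas c -> chart_dom c p -> analytic_at (f \o chart_inv c) (c p).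

Definition germ_eq (f g : S -> C) : Prop := \forall q \near p, f q = g q.

Definition germ_dvd (a f : S -> C) : Prop :=
  exists2 b, holomorphic_at b & germ_eq f (a \* b).

Definition germ_unit (f : S -> C) : Prop :=
  holomorphic_at f /\ germ_dvd f (fun=> 1).

Definition germ_reduced (f : S -> C) : Prop :=
  holomorphic_at f /\
  forall a, holomorphic_at a -> germ_dvd (a \* a) f -> germ_unit a.

Definition germ_no_common_factor (f g : S -> C) : Prop :=
  forall a, holomorphic_at a -> germ_dvd a f -> germ_dvd a g -> germ_unit a.

Definition germ_ideal (s : seq (S -> C)) : set (S -> C) :=
  [set f | holomorphic_at f /\
    exists2 c : nat -> S -> C, (forall i, holomorphic_at (c i)) &
      germ_eq f (fun q => \sum_(i < size s) c i q * nth (fun=> 0) s i q)].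

Definition ideal_add (I J : set (S -> C)) : set (S -> C) :=
  [set f | holomorphic_at f /\
    exists a b, [/\ I a, J b & germ_eq f (a \+ b)]].

Definition partial (x : chart R n S) (i : 'I_n) (f : S -> C) : S -> C :=
  fun q => 'D_(delta_mx 0 i) (f \o chart_inv x : _ -> C^o) (x q).

Definition jacobian_ideal (x : chart R n S) (f : S -> C) : set (S -> C) :=
  germ_ideal [seq partial x i f | i <- enum 'I_n].

Definition zero_locus_at (D : set S) (f : S -> C) : Prop :=
  \forall q \near p, D q <-> f q = 0.

(* As f is square-free, it is in particular not the zero germ; it is a unit
   when p is not in D. *)
Definition defining_equation (D : set S) (f : S -> C) : Prop :=
  germ_reduced f /\ zero_locus_at D f.

End Germs.

Definition divisor (R : realType) (n : nat) (S : complexManifold R n)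
    (D : set S) : Prop :=
  forall q : S, exists f, defining_equation q D f.

Definition first_coords (T : Type) (n : nat) (k : 'I_n) (v : 'rV[T]_n) :
    'rV[T]_k :=
  colsub (widen_ord (ltnW (ltn_ord k))) v.

Definition last_coords (T : Type) (n : nat) (k : 'I_n) (v : 'rV[T]_n) :
    'rV[T]_(n - k) :=
  colsub (fun j : 'I_(n - k) =>
            cast_ord (subnKC (ltnW (ltn_ord k))) (rshift k j)) v.

(* The integer k with 1 <= k <= n - 1 is a nonzero element of 'I_n. *)
Definition splayed (R : realType) (n : nat) (S : complexManifold R n) (p : S)
    (D D1 D2 : set S) : Prop :=
  exists (y : chart R n S) (k : 'I_n)
         (h1 : 'rV[Cx R]_k -> Cx R) (h2 : 'rV[Cx R]_(n - k) -> Cx R),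
  let H1 := fun q : S => h1 (first_coords k (y q)) in
  let H2 := fun q : S => h2 (last_coords k (y q)) in
  [/\ coordinates_at p y /\ (0 < k)%N,
      analytic_at h1 0 /\ analytic_at h2 0,
      defining_equation p D1 H1 /\ defining_equation p D2 H2 &
      defining_equation p D (H1 \* H2)].

(* Main.v *)
From HB Require Import structures.
Require Import Defs.
From mathcomp Require Import all_boot all_order all_algebra.
From mathcomp Require Import complex.
From mathcomp Require Import all_classical all_reals all_analysis.
From mathcomp Require Import ring lra separable.

(** The inclusion from left to right always holds, by the Leibniz rule.

    Conversely, let the ideals agree. The germ [g * d_i h] lies in the right-hand
    side, hence in the left-hand one; since [g] and [h] are coprime, comparing
    coefficients splits each [d_i] into a vector field logarithmic along [g]
    and one logarithmic along [h]. Write a unit times [g] as a function of a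
    submersion onto the least possible number [k] of variables, and
    likewise for [h]. A logarithmic field transverse to the fibres of this
    submersion could be straightened (linear Cauchy-Kovalevskaya) to save a
    variable, so logarithmic fields are tangent to the fibres at the origin.
    As the two kinds of fields together span the tangent space, the
    two submersions have independent differentials, and completing them to
    a coordinate system separates the variables of [g] and [h].

    If [D] is splayed, the Nullstellensatz gives [g] and [h], up to units, as
    functions [f1] and [f2] of separate sets of variables. If
    [a * f1 + b * f2] lies in [(f1) + J_f1], then so does [b * f2]; but [f1] and
    its derivatives do not vary along a direction in which [f2] is not
    identically zero, so that Weierstrass division by [f2] in this
    direction shows that [b] lies in [(f1) + J_f1]. By symmetry
    [a] lies in [(f2) + J_f2]. As [f1] and [f2] involve separate variables, the
    two representations combine into one in [(f1 * f2) + J_(f1 * f2)]. *)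

Set Implicit Arguments.
Unset Strict Implicit.
Unset Printing Implicit Defensive.

Import Order.TTheory GRing.Theory Num.Theory.
Import numFieldNormedType.Exports.

Local Open Scope classical_set_scope.
Local Open Scope ring_scope.

(** The divisibility theory of germs rests on one analytic fact, [bounded_dvd]: a germ [a] with
    [|a| <= M |q|] near 0 is a multiple of [q]. It gives analytic coefficients to the monic gcd over
    the field of fractions, and that gcd yields both Euclid's lemma and the Nullstellensatz.

    All estimates are made on one norm, the weighted sum of the moduli of the coefficients of a
    series ([ser]). Sums, products, substitutions and division by a coordinate have exact bounds for
    it, and derivatives have one at the cost of a smaller radius. Weierstrass division and the
    Cauchy-Kovalevskaya solution are then sums of explicitly dominated families, with no compactness
    or contour integral.

    The converse needs [g * h] to be square-free, since a splayed divisor is described by reduced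
    equations. This comes from a reduced equation of the divisor [D] at [p]: the two factors and
    then their product divide it. *)

Section Modulus.
Variable R : realType.
Implicit Types z w : Cx R.

(** The norm of [Cx R] takes its values in [Cx R]; [nm] is the same modulus as a real number, so
    that bounds can be summed in the extended reals and compared by [lra]. *)
Definition nm (z : Cx R) : R := complex.Re `|z|.
Definition toC (x : R) : Cx R := (real_complex R x).

Lemma nmE z : `|z| = toC (nm z).
Proof. by rewrite /nm /toC RRe_real // normr_real. Qed.

Lemma toC_inj : injective toC.
Proof. exact: complexI. Qed.

Lemma toC_le x y : (toC x <= toC y) = (x <= y).
Proof. exact: lecR. Qed.

Lemma toC_lt x y : (toC x < toC y) = (x < y).
Proof. exact: ltcR. Qed.

Lemma toCD x y : toC (x + y) = toC x + toC y.
Proof. exact: (rmorphD (real_complex R)). Qed.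
Lemma toCM x y : toC (x * y) = toC x * toC y.
Proof. exact: (rmorphM (real_complex R)). Qed.
Lemma toC0 : toC 0 = 0. Proof. by []. Qed.
Lemma toCX x n : toC (x ^+ n) = toC x ^+ n.
Proof. exact: (rmorphXn (real_complex R)). Qed.
Lemma toC_sum (I : Type) (s : seq I) (P : pred I) (F : I -> R) :
  toC (\sum_(i <- s | P i) F i) = \sum_(i <- s | P i) toC (F i).
Proof. exact: (rmorph_sum (real_complex R)). Qed.
Lemma toC_prod (I : Type) (s : seq I) (P : pred I) (F : I -> R) :
  toC (\prod_(i <- s | P i) F i) = \prod_(i <- s | P i) toC (F i).
Proof. exact: (rmorph_prod (real_complex R)). Qed.

Lemma ge0_toC z : 0 <= z -> z = toC (complex.Re z).
Proof. by move=> z0; rewrite /toC RRe_real // ger0_real. Qed.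

Lemma nm_ge0 z : 0 <= nm z.
Proof. by rewrite -toC_le -nmE toC0 normr_ge0. Qed.

Lemma nmM z w : nm (z * w) = nm z * nm w.
Proof. by apply: toC_inj; rewrite toCM -!nmE normrM. Qed.

Lemma nmX z n : nm (z ^+ n) = nm z ^+ n.
Proof. by apply: toC_inj; rewrite toCX -!nmE normrX. Qed.

Lemma nm_prod (I : Type) (s : seq I) (P : pred I) (F : I -> Cx R) :
  nm (\prod_(i <- s | P i) F i) = \prod_(i <- s | P i) nm (F i).
Proof.
by apply: toC_inj; rewrite toC_prod -!nmE normr_prod; apply: eq_bigr => i _; rewrite nmE.
Qed.

Lemma ler_nmD z w : nm (z + w) <= nm z + nm w.
Proof. by rewrite -toC_le toCD -!nmE ler_normD. Qed.

Lemma ler_nm_sum (I : Type) (s : seq I) (P : pred I) (F : I -> Cx R) :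
  nm (\sum_(i <- s | P i) F i) <= \sum_(i <- s | P i) nm (F i).
Proof.
rewrite -toC_le toC_sum -nmE; apply: le_trans (ler_norm_sum _ _ _) _.
by apply: ler_sum => i _; rewrite nmE.
Qed.

Lemma nmN z : nm (- z) = nm z.
Proof. by rewrite /nm normrN. Qed.

Lemma nm_distC z w : nm (z - w) = nm (w - z).
Proof. by rewrite -nmN opprB. Qed.

Lemma nm0 : nm 0 = 0. Proof. by apply: toC_inj; rewrite -nmE normr0. Qed.
Lemma nm1 : nm 1 = 1. Proof. by apply: toC_inj; rewrite -nmE normr1. Qed.
Lemma nm_eq0 z : (nm z == 0) = (z == 0).
Proof. by rewrite -(inj_eq toC_inj) -nmE toC0 normr_eq0. Qed.
Lemma nm_gt0 z : (0 < nm z) = (z != 0).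
Proof. by rewrite lt_def nm_ge0 andbT nm_eq0. Qed.
Lemma nmV z : nm z^-1 = (nm z)^-1.
Proof.
have [->|z0] := eqVneq z 0; first by rewrite invr0 nm0 invr0.
apply: (mulfI (x := nm z)); first by rewrite nm_eq0.
by rewrite -nmM !divff ?nm1 ?nm_eq0.
Qed.
Lemma nm_toC x : 0 <= x -> nm (toC x) = x.
Proof. by move=> x0; apply: toC_inj; rewrite -nmE ger0_norm // -toC0 toC_le. Qed.
Lemma nm_nat n : nm n%:R = n%:R.
Proof. by apply: toC_inj; rewrite -nmE normr_nat; exact: esym (rmorph_nat (real_complex R) n). Qed.

Lemma abs_Re_le z : `|complex.Re z| <= nm z.
Proof. by rewrite -toC_le -nmE; apply: normc_ge_Re. Qed.

Lemma abs_Im_le z : `|complex.Im z| <= nm z.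
Proof.
have := abs_Re_le (z * 'i%C); rewrite nmM.
have -> : nm 'i%C = 1.
  apply: toC_inj; rewrite -nmE normc_def /= expr0n /= expr1n add0r sqrtr1 //.
by rewrite mulr1 ReiNIm normrN.
Qed.

End Modulus.

(** * Unordered sums *)

Section RealSum.
Variables (R : realType).
Local Open Scope ereal_scope.

Definition psum (I : choiceType) (u : I -> R) : \bar R := \esum_(i in [set: I]) (u i)%:E.

Lemma psum_ge0 (I : choiceType) (u : I -> R) : (forall i, 0 <= u i)%R -> 0 <= psum u.
Proof. by move=> u0; apply: esum_ge0 => i _; rewrite lee_fin. Qed.

Lemma le_psum (I : choiceType) (u v : I -> R) :
  (forall i, 0 <= u i <= v i)%R -> psum u <= psum v.
Proof. move=> uv; apply: le_esum => i _; rewrite ?lee_fin; by case/andP: (uv i). Qed.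

Lemma psum_fin (I : choiceType) (u : I -> R) : (forall i, 0 <= u i)%R -> psum u < +oo ->
  psum u = (fine (psum u))%:E.
Proof. by move=> u0 fu; rewrite fineK // ge0_fin_numE // psum_ge0. Qed.

Lemma psumD (I : choiceType) (u v : I -> R) :
  (forall i, 0 <= u i)%R -> (forall i, 0 <= v i)%R ->
  psum (fun i => u i + v i)%R = psum u + psum v.
Proof.
move=> u0 v0; rewrite /psum -esumD; first by apply: eq_esum => i _; rewrite EFinD.
- by move=> i _; rewrite lee_fin.
- by move=> i _; rewrite lee_fin.
Qed.

Lemma psum_ub (I : choiceType) (u : I -> R) (s : seq I) : (forall i, 0 <= u i)%R -> uniq s ->
  (\sum_(i <- s) u i)%:E <= psum u.
Proof.
move=> u0 us; apply: esum_ge; exists [set` s]; first by split => //; exact: finite_seq.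
by rewrite -fsbig_seq // sumEFin.
Qed.

Lemma psum_le (I : choiceType) (u : I -> R) (M : \bar R) :
  (forall s : seq I, uniq s -> (\sum_(i <- s) u i)%:E <= M) -> psum u <= M.
Proof.
move=> h; apply: ge_ereal_sup => _ [A [fA _] <-].
have [s [us sA]] : exists s : seq I, uniq s /\ A = [set` s].
  move/finite_seqP: fA => [t AE]; exists (undup t); split; first exact: undup_uniq.
  by rewrite AE; apply/seteqP; split=> i /=; rewrite mem_undup.
by rewrite sA -fsbig_seq // sumEFin h.
Qed.

Lemma psum_psum (I J : choiceType) (u : I -> J -> R) : (forall i j, 0 <= u i j)%R ->
  psum (fun p : I * J => u p.1 p.2) = \esum_(i in [set: I]) psum (u i).
Proof.
move=> u0; rewrite /psum esum_esum; last by move=> i j; rewrite lee_fin.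
by congr esum; apply/seteqP; split=> [[i j] _|[i j] _].
Qed.

Lemma psum_single (I : choiceType) (u : I -> R) i0 : (0 <= u i0)%R ->
  (forall i, i != i0 -> u i = 0%R) -> psum u = (u i0)%:E.
Proof.
move=> u0 u1; rewrite /psum (esumID [set i0]); last first.
  by move=> i _; have [->|/u1 ->//] := eqVneq i i0; rewrite lee_fin.
rewrite !setTI esum_set1 ?lee_fin // esum1 ?adde0 //.
by move=> i /= /eqP/u1 ->.
Qed.

Lemma psum_reindex (I J : choiceType) (e : J -> I) (u : I -> R) :
  bijective e -> (forall i, 0 <= u i)%R -> psum (u \o e) = psum u.
Proof.
move=> be u0; rewrite /psum (reindex_esum [set: J] [set: I] e) //.
by rewrite setTT_bijective.
Qed.

(** Total: an infinite sum of positive or negative parts counts as 0 through [fine], so the value is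
    meaningful for summable families. *)
Definition rsum (I : choiceType) (f : I -> R) : R :=
  (fine (psum (fun i => Num.max (f i) 0%R)) - fine (psum (fun i => Num.max (- f i)%R 0%R)))%R.

(** With [P] and [N] the positive and negative parts of [f], [P + v = N + u] holds pointwise, and
    the sums are finite. The freedom in [u] and [v] reduces additivity, scaling and Fubini to
    non-negative families. *)
Lemma rsum_dec (I : choiceType) (f u v : I -> R) :
  (forall i, 0 <= u i)%R -> (forall i, 0 <= v i)%R -> psum u < +oo -> psum v < +oo ->
  (forall i, f i = u i - v i)%R -> rsum f = (fine (psum u) - fine (psum v))%R.
Proof.
move=> u0 v0 fu fv fE; rewrite /rsum.
set P := fun i => Num.max (f i) 0%R; set N := fun i => Num.max (- f i)%R 0%R.
have P0 i : (0 <= P i)%R by rewrite le_max lexx orbT.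
have N0 i : (0 <= N i)%R by rewrite le_max lexx orbT.
have fP : psum P < +oo.
  apply: le_lt_trans fu; apply: le_psum => i; rewrite P0 /= ge_max u0 andbT fE.
  by rewrite gerBl.
have fN : psum N < +oo.
  apply: le_lt_trans fv; apply: le_psum => i; rewrite N0 /= ge_max v0 andbT fE opprB.
  by rewrite gerBl.
have e : psum P + psum v = psum N + psum u.
  rewrite -!psumD //; congr psum; apply/funext => i; rewrite /P /N.
  have := fE i; have [h|h] := leP (f i) 0%R.
    rewrite max_l ?oppr_ge0 // => ->; lra.
  by rewrite max_r ?oppr_le0 ?ltW // => ->; lra.
move: e; rewrite (psum_fin P0 fP) (psum_fin N0 fN) (psum_fin u0 fu) (psum_fin v0 fv) -!EFinD => -[e].
rewrite /=; lra.
Qed.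

Definition rsummable (I : choiceType) (f : I -> R) := psum (fun i => `|f i|)%R < +oo.

Lemma rsummable_dom (I : choiceType) (f : I -> R) (u : I -> R) :
  (forall i, `|f i| <= u i)%R -> psum u < +oo -> rsummable f.
Proof. by move=> h; apply: le_lt_trans; apply: le_psum => i; rewrite normr_ge0 h. Qed.

Lemma rsum_pn (I : choiceType) (f : I -> R) : rsummable f ->
  exists u v : I -> R, [/\ (forall i, 0 <= u i)%R, (forall i, 0 <= v i)%R, psum u < +oo, psum v < +oo &
   (forall i, f i = u i - v i)%R].
Proof.
move=> fs; exists (fun i => Num.max (f i) 0%R)%R, (fun i => Num.max (- f i)%R 0%R)%R; split.
- by move=> i; rewrite le_max lexx orbT.
- by move=> i; rewrite le_max lexx orbT.
- apply: le_lt_trans fs; apply: le_psum => i; rewrite le_max lexx orbT /=.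
  by rewrite ge_max normr_ge0 ler_norm.
- apply: le_lt_trans fs; apply: le_psum => i; rewrite le_max lexx orbT /=.
  by rewrite ge_max normr_ge0 ler_normr lexx orbT.
- move=> i; have [h|h] := leP (f i) 0%R.
    rewrite max_l ?oppr_ge0 //; lra.
  rewrite max_r ?oppr_le0 ?ltW //; lra.
Qed.

Lemma rsumD (I : choiceType) (f g : I -> R) : rsummable f -> rsummable g ->
  (rsum (fun i => f i + g i) = rsum f + rsum g)%R.
Proof.
move=> /rsum_pn [u [v [u0 v0 fu fv e]]] /rsum_pn [u' [v' [u0' v0' fu' fv' e']]].
rewrite (rsum_dec u0 v0 fu fv e) (rsum_dec u0' v0' fu' fv' e').
rewrite (@rsum_dec _ _ (fun i => u i + u' i) (fun i => v i + v' i))%R.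
- by rewrite !psumD // !fineD ?ge0_fin_numE ?psum_ge0 //; lra.
- by move=> i; rewrite addr_ge0.
- by move=> i; rewrite addr_ge0.
- by rewrite psumD // lte_add_pinfty.
- by rewrite psumD // lte_add_pinfty.
- by move=> i; rewrite e e'; lra.
Qed.

Lemma psumZ (I : choiceType) (u : I -> R) (a : R) : (0 <= a)%R -> (forall i, 0 <= u i)%R ->
  psum (fun i => a * u i)%R = a%:E * psum u.
Proof.
move=> a0 u0; apply/eqP; rewrite eq_le; apply/andP; split.
  apply: psum_le => s us; rewrite -mulr_sumr EFinM lee_wpmul2l ?lee_fin //.
  exact: psum_ub.
have [->|an0] := eqVneq a 0%R.
  by rewrite mul0e psum_ge0 // => i; rewrite mul0r.
have ap : (0 < a)%R by rewrite lt_def an0.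
rewrite muleC -lee_pdivlMr //.
apply: psum_le => s us; rewrite lee_pdivlMr // -EFinM mulr_suml.
apply: le_trans (_ : (\sum_(i <- s) (a * u i))%:E <= _).
  by rewrite lee_fin; under eq_bigr do rewrite mulrC.
by apply: psum_ub => // i; rewrite mulr_ge0.
Qed.

Lemma rsumN (I : choiceType) (f : I -> R) : rsum (fun i => - f i)%R = (- rsum f)%R.
Proof.
rewrite /rsum opprB; congr (_ - fine (psum _))%R; apply/funext => i; by rewrite opprK.
Qed.

Lemma rsumZ (I : choiceType) (f : I -> R) a : rsummable f -> rsum (fun i => a * f i)%R = (a * rsum f)%R.
Proof.
wlog a0 : a / (0 <= a)%R => [hw fs|].
  have [a0|a0] := leP 0%R a; first exact: hw.
  have := hw (- a)%R; rewrite oppr_ge0 ltW // => /(_ isT fs) e.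
  apply: oppr_inj; rewrite -rsumN -mulNr -e; congr rsum; apply/funext => i.
  by rewrite mulNr.
move=> /rsum_pn [u [v [u0 v0 fu fv e]]].
rewrite (rsum_dec u0 v0 fu fv e) (@rsum_dec _ _ (fun i => a * u i) (fun i => a * v i))%R.
- by rewrite !psumZ // (psum_fin u0 fu) (psum_fin v0 fv) /= mulrBr.
- by move=> i; rewrite mulr_ge0.
- by move=> i; rewrite mulr_ge0.
- by rewrite psumZ // (psum_fin u0 fu) -EFinM ltry.
- by rewrite psumZ // (psum_fin v0 fv) -EFinM ltry.
- by move=> i; rewrite e mulrBr.
Qed.

Lemma rsum_le (I : choiceType) (f : I -> R) (u : I -> R) : (forall i, `|f i| <= u i)%R -> psum u < +oo ->
  (`|rsum f|%R)%:E <= psum u.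
Proof.
move=> fu us.
have u0 i : (0 <= u i)%R by apply: le_trans (fu i).
have fs := rsummable_dom fu us.
have le1 g : (forall i, `|g i| <= u i)%R -> (rsum g <= fine (psum u))%R.
  move=> gu; rewrite /rsum.
  apply: le_trans (_ : fine (psum (fun i => Num.max (g i) 0%R))%R <= _)%R.
    rewrite gerBl fine_ge0 // psum_ge0 // => i; by rewrite le_max lexx orbT.
  have m0 i : (0 <= Num.max (g i) 0%R)%R by rewrite le_max lexx orbT.
  have mle : psum (fun i => Num.max (g i) 0%R) <= psum u.
    apply: le_psum => i; rewrite m0 /= ge_max u0 andbT.
    exact: le_trans (ler_norm _) (gu i).
  by apply: fine_le => //; rewrite ge0_fin_numE ?psum_ge0 //; exact: le_lt_trans mle us.
rewrite (psum_fin u0 us) lee_fin ler_norml lerNl -rsumN !le1 // => i; by rewrite normrN.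
Qed.

Lemma rsum_fubini (I J : choiceType) (f : I -> J -> R) :
  rsummable (fun p : I * J => f p.1 p.2) ->
  rsum (fun p : I * J => f p.1 p.2) = rsum (fun i => rsum (f i)).
Proof.
move=> /rsum_pn [u [v [u0 v0 fu fv e]]].
have key (w : I * J -> R) : (forall i, 0 <= w i)%R -> psum w < +oo ->
   [/\ forall i, psum (fun j => w (i, j)) < +oo,
      (forall i, 0 <= fine (psum (fun j => w (i, j))))%R &
      psum (fun i => fine (psum (fun j => w (i, j)))) = psum w].
  move=> w0 ws.
  have wE : psum w = \esum_(i in [set: I]) psum (fun j => w (i, j)).
    rewrite -psum_psum //; congr psum; apply/funext => -[] //.
  have h i : psum (fun j => w (i, j)) < +oo.
    apply: le_lt_trans ws; rewrite wE; apply: esum_ge; exists [set i].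
      by split => //; exact: finite_set1.
    by rewrite fsbig_set1.
  split=> // [i|]; first by rewrite fine_ge0 // psum_ge0.
  by rewrite wE /psum; apply: eq_esum => i _; rewrite -psum_fin.
have [u1 u2 u3] := key u u0 fu; have [v1 v2 v3] := key v v0 fv.
rewrite (rsum_dec u0 v0 fu fv e) -u3 -v3; apply/esym/rsum_dec => //.
- by rewrite u3.
- by rewrite v3.
by move=> i; apply: rsum_dec => // j; rewrite -e.
Qed.

Lemma rsum_reindex (I J : choiceType) (e : J -> I) (f : I -> R) :
  bijective e -> rsum (f \o e) = rsum f.
Proof.
move=> be; rewrite /rsum; congr (fine _ - fine _)%R.
  by apply: (psum_reindex (u := fun i => Num.max (f i) 0%R) be) => i; rewrite le_max lexx orbT.
by apply: (psum_reindex (u := fun i => Num.max (- f i)%R 0%R) be) => i; rewrite le_max lexx orbT.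
Qed.

Lemma rsum_single (I : choiceType) (f : I -> R) i0 :
  (forall i, i != i0 -> f i = 0%R) -> rsum f = f i0.
Proof.
move=> f0; rewrite /rsum.
rewrite (@psum_single _ (fun i => Num.max (f i) 0%R) i0); first last.
- by move=> i /f0 ->; rewrite maxxx.
- by rewrite le_max lexx orbT.
rewrite (@psum_single _ (fun i => Num.max (- f i)%R 0%R) i0); first last.
- by move=> i /f0 ->; rewrite oppr0 maxxx.
- by rewrite le_max lexx orbT.
rewrite /=.
have [h|h] := leP (f i0) 0%R.
  rewrite max_l ?oppr_ge0 //; lra.
rewrite max_r ?oppr_le0 ?ltW //; lra.
Qed.

End RealSum.

Lemma psum_swap (R : realType) (I J : choiceType) (u : I -> J -> R) : (forall i j, 0 <= u i j) ->
  psum (fun p : J * I => u p.2 p.1) = psum (fun p : I * J => u p.1 p.2).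
Proof.
move=> u0; have bs : bijective (fun p : J * I => (p.2, p.1) : I * J).
  by exists (fun p : I * J => (p.2, p.1) : J * I) => -[].
by rewrite -(psum_reindex bs).
Qed.

(** Both sides are iterated sums, in the two orders, of the matrix [u i n] with entry [g n] where
    [n = e i] and 0 elsewhere. *)
Lemma psum_inj (R : realType) (I N : choiceType) (e : I -> N) (g : N -> R) :
  injective e -> (forall n, 0 <= g n) -> (forall n, ~ (exists i, e i = n) -> g n = 0) ->
  psum (g \o e) = psum g.
Proof.
move=> ei g0 gz.
pose u i n := if n == e i then g n else 0.
have u0 i n : 0 <= u i n by rewrite /u; case: ifP.
have e1 i : psum (u i) = (g (e i))%:E.
  rewrite (@psum_single _ _ _ (e i)) // /u ?eqxx // => n nn; by rewrite (negbTE nn).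
have e2 n : psum (u^~ n) = (g n)%:E.
  have [[i ein]|h] := pselect (exists i, e i = n).
    rewrite (@psum_single _ _ _ i) // /u ?ein ?eqxx // => j ji.
    rewrite -ein; case: eqP => // /ei ij; by rewrite ij eqxx in ji.
  rewrite gz // /psum esum1 // => i _; rewrite /u; case: eqP => // nE.
  by case: h; exists i.
have := psum_swap u0; rewrite (psum_psum u0) (psum_psum (u := fun n i => u i n)) //.
rewrite -/(psum _) => h.
rewrite /psum; under eq_esum => i _ do rewrite -e1.
by rewrite -h; apply: eq_esum => n _; rewrite -e2.
Qed.

(** * Unordered sums of complex families *)

Section ComplexSum.
Variable R : realType.
Local Notation C := (Cx R).

Definition csum (I : choiceType) (f : I -> C) : C :=
  Complex (rsum (fun i => complex.Re (f i))) (rsum (fun i => complex.Im (f i))).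

Definition csummable (I : choiceType) (f : I -> C) := (psum (fun i => nm (f i)) < +oo)%E.

Lemma csummable_dom (I : choiceType) (f : I -> C) (u : I -> R) (M : R) :
  (forall i, nm (f i) <= u i) -> (psum u <= M%:E)%E -> csummable f.
Proof.
move=> fu uM; apply: le_lt_trans (ltry M); apply: le_trans uM; apply: le_psum => i.
by rewrite nm_ge0 fu.
Qed.

Lemma csummable_Re (I : choiceType) (f : I -> C) : csummable f -> rsummable (fun i => complex.Re (f i)).
Proof. by apply: rsummable_dom => i; exact: abs_Re_le. Qed.

Lemma csummable_Im (I : choiceType) (f : I -> C) : csummable f -> rsummable (fun i => complex.Im (f i)).
Proof. by apply: rsummable_dom => i; exact: abs_Im_le. Qed.

Lemma complex_ext (z w : C) : complex.Re z = complex.Re w -> complex.Im z = complex.Im w -> z = w.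
Proof. by case: z w => [a b] [c d] /= -> ->. Qed.

Lemma ReD (z w : C) : complex.Re (z + w) = complex.Re z + complex.Re w.
Proof. by case: z; case: w. Qed.
Lemma ImD (z w : C) : complex.Im (z + w) = complex.Im z + complex.Im w.
Proof. by case: z; case: w. Qed.
Lemma ReM (z w : C) : complex.Re (z * w) =
  complex.Re z * complex.Re w - complex.Im z * complex.Im w.
Proof. by case: z; case: w. Qed.
Lemma ImM (z w : C) : complex.Im (z * w) =
  complex.Re z * complex.Im w + complex.Im z * complex.Re w.
Proof. by case: z; case: w. Qed.

Lemma csumD (I : choiceType) (f g : I -> C) : csummable f -> csummable g ->
  csum (fun i => f i + g i) = csum f + csum g.
Proof.
move=> fs gs; apply: complex_ext; rewrite ?ReD ?ImD /=.
  rewrite -rsumD; [|exact: csummable_Re|exact: csummable_Re].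
  by congr rsum; apply/funext => i; rewrite ReD.
rewrite -rsumD; [|exact: csummable_Im|exact: csummable_Im].
by congr rsum; apply/funext => i; rewrite ImD.
Qed.

Lemma rsummableZ (I : choiceType) (f : I -> R) a : rsummable f -> rsummable (fun i => a * f i).
Proof.
move=> fs; apply: (rsummable_dom (u := fun i => `|a| * `|f i|)) => [i|]; first by rewrite normrM.
rewrite psumZ // (psum_fin (u := fun i => `|f i|)) // -EFinM; exact: ltry.
Qed.

Lemma csumZ (I : choiceType) (f : I -> C) (a : C) : csummable f -> csum (fun i => a * f i) = a * csum f.
Proof.
move=> fs; have fr := csummable_Re fs; have fi := csummable_Im fs.
apply: complex_ext; rewrite ?ReM ?ImM /=.
  rewrite -!rsumZ // -mulN1r -rsumZ; last exact: rsummableZ.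
  rewrite -rsumD; [|exact: rsummableZ|by do 2 apply: rsummableZ].
  by congr rsum; apply/funext => i; rewrite ReM mulN1r.
rewrite -!rsumZ // -rsumD; [|exact: rsummableZ|exact: rsummableZ].
by congr rsum; apply/funext => i; rewrite ImM.
Qed.

Lemma csum_fubini (I J : choiceType) (f : I -> J -> C) : csummable (fun p : I * J => f p.1 p.2) ->
  csum (fun p : I * J => f p.1 p.2) = csum (fun i => csum (f i)).
Proof.
move=> fs; rewrite /csum /=; congr Complex.
  by rewrite -(rsum_fubini (f := fun i j => complex.Re (f i j))) //; exact: csummable_Re fs.
by rewrite -(rsum_fubini (f := fun i j => complex.Im (f i j))) //; exact: csummable_Im fs.
Qed.

Lemma csum_reindex (I J : choiceType) (e : J -> I) (f : I -> C) :
  bijective e -> csum (f \o e) = csum f.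
Proof.
move=> be; rewrite /csum /= -(rsum_reindex (fun i => complex.Re (f i)) be).
by rewrite -(rsum_reindex (fun i => complex.Im (f i)) be).
Qed.

Lemma csum_swap (I J : choiceType) (f : I -> J -> C) : csummable (fun p : I * J => f p.1 p.2) ->
  csum (fun i => csum (f i)) = csum (fun j => csum (f^~ j)).
Proof.
move=> fs; rewrite -csum_fubini // -(csum_fubini (f := fun j i => f i j)); last first.
  by rewrite /csummable (psum_swap (u := fun i j => nm (f i j))) // => i j; exact: nm_ge0.
have bs : bijective (fun p : J * I => (p.2, p.1) : I * J).
  by exists (fun p : I * J => (p.2, p.1) : J * I) => -[].
by rewrite -(csum_reindex _ bs).
Qed.

Lemma csum_single (I : choiceType) (f : I -> C) i0 :
  (forall i, i != i0 -> f i = 0) -> csum f = f i0.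
Proof.
move=> f0; rewrite /csum !(@rsum_single _ _ _ i0); first by case: (f i0).
- by move=> i /f0 ->.
- by move=> i /f0 ->.
Qed.

Lemma csum0 (I : choiceType) (f : I -> C) : (forall i, f i = 0) -> csum f = 0.
Proof.
move=> f0; have r0 (g : I -> R) : (forall i, g i = 0) -> rsum g = 0.
  move=> g0; rewrite /rsum !/psum !esum1 ?subrr // => i _; by rewrite g0 ?oppr0 maxxx.
by rewrite /csum !r0 // => i; rewrite f0.
Qed.

Lemma csum_inj (I N : choiceType) (e : I -> N) (g : N -> C) :
  injective e -> csummable g -> (forall n, ~ (exists i, e i = n) -> g n = 0) ->
  csum (g \o e) = csum g.
Proof.
move=> ei gs gz.
pose u i n := if n == e i then g n else 0.
have e1 i : csum (u i) = g (e i).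
  rewrite (@csum_single _ _ (e i)) // /u ?eqxx // => n nn; by rewrite (negbTE nn).
have e2 n : csum (u^~ n) = g n.
  have [[i ein]|h] := pselect (exists i, e i = n).
    rewrite (@csum_single _ _ i) // /u ?ein ?eqxx // => j ji.
    rewrite -ein; case: eqP => // /ei ij; by rewrite ij eqxx in ji.
  rewrite gz // csum0 // => i; rewrite /u; case: eqP => // nE.
  by case: h; exists i.
have -> : g \o e = fun i => csum (u i) by apply/funext => i; rewrite e1.
rewrite csum_swap; first by congr csum; apply/funext => n; rewrite e2.
rewrite /csummable (psum_psum (u := fun i n => nm (u i n))); last by move=> *; exact: nm_ge0.
suff -> : (\esum_(i in [set: I]) psum (fun n => nm (u i n)) = psum (fun n => nm (g n)))%E by [].
rewrite -(psum_inj (e := e)) //.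
- apply: eq_esum => i _; rewrite (@psum_single _ _ _ (e i)) ?nm_ge0 /u ?eqxx // => n nn.
  by rewrite (negbTE nn) nm0.
- by move=> n; exact: nm_ge0.
- by move=> n /gz ->; rewrite nm0.
Qed.

Lemma csum_le (I : choiceType) (f : I -> C) (u : I -> R) (M : R) :
  (forall i, nm (f i) <= u i) -> (psum u <= M%:E)%E -> nm (csum f) <= M.
Proof.
move=> fu uM; have fs := csummable_dom fu uM.
have M0 : 0 <= M.
  rewrite -lee_fin; apply: le_trans uM; apply: psum_ge0 => i; exact: le_trans (nm_ge0 _) (fu i).
have [->|s0] := eqVneq (csum f) 0; first by rewrite nm0.
set s := csum f in s0 *.
(* Rotation by the unimodular [w] makes the sum real and non-negative, so that only real parts have
   to be compared with [u]. *)
pose w : C := (toC (nm s)) / s.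
have w1 : nm w = 1 by rewrite /w nmM nmV nm_toC ?nm_ge0 // divff // nm_eq0.
have ws : w * s = toC (nm s) by rewrite /w mulfVK.
have : complex.Re (w * s) <= M.
  have us : (psum u < +oo)%E := le_lt_trans uM (ltry M).
  rewrite -csumZ //= -lee_fin; apply: le_trans uM.
  have h i : `|complex.Re (w * f i)| <= u i.
    by apply: le_trans (abs_Re_le _) _; rewrite nmM w1 mul1r.
  apply: le_trans (rsum_le h us); by rewrite lee_fin ler_norm.
by rewrite ws.
Qed.

Lemma csum_seq (I : choiceType) (s : seq I) (f : I -> C) : uniq s ->
  (forall i, i \notin s -> f i = 0) -> csum f = \sum_(i <- s) f i.
Proof.
elim: s f => [|j s IH] f /=; first by move=> _ h; rewrite big_nil csum0 // => i; exact: h.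
move=> /andP[js us] f0; rewrite big_cons.
pose f1 i := if i == j then f j else 0.
pose f2 i := if i == j then 0 else f i.
have f12 : f = (fun i => f1 i + f2 i).
  by apply/funext => i; rewrite /f1 /f2; case: eqP => [->|]; rewrite ?addr0 ?add0r.
have fin2 (g : I -> C) (t : seq I) : (forall i, i \notin t -> g i = 0) -> csummable g.
  move=> g0; apply: le_lt_trans (ltry (\sum_(i <- undup t) nm (g i))).
  apply: psum_le => u uu; rewrite lee_fin.
  rewrite (bigID (mem t)) /= [X in _ + X]big1 ?addr0; last by move=> i /g0 ->; rewrite nm0.
  rewrite [leRHS](bigID (mem u)) /= -[leLHS]addr0 lerD //; last first.
    by apply: sumr_ge0 => i _; exact: nm_ge0.
  rewrite -big_filter -[leRHS]big_filter; rewrite le_eqVlt; apply/orP; left; apply/eqP; apply: perm_big.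
  apply: uniq_perm; rewrite ?filter_uniq ?undup_uniq // => i.
  by rewrite !mem_filter /= mem_undup andbC.
rewrite {1}f12 csumD; first last.
- by apply: (fin2 _ (j :: s)) => i; rewrite /f2; case: eqP => // _ /f0.
- by apply: (fin2 _ [:: j]) => i; rewrite inE /f1; case: eqP.
rewrite (@csum_single _ f1 j) /f1 ?eqxx => [|i /negbTE -> //]; congr (_ + _).
rewrite IH //; last first.
  by move=> i iS; rewrite /f2; case: eqP => // /eqP ij; apply: f0; rewrite inE negb_or ij.
rewrite !big_seq; apply: eq_bigr => i iS; rewrite /f2; case: eqP => // ij.
by rewrite -ij iS in js.
Qed.

(** The finite set [s] carries the whole sum of moduli up to [e]; what lies outside a larger [t] has
    total modulus at most [e]. *)
Lemma csum_approx (I : choiceType) (f : I -> C) (e : R) : csummable f -> 0 < e ->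
  exists s : seq I, forall t : seq I, uniq t -> {subset s <= t} ->
    nm (csum f - \sum_(i <- t) f i) <= e.
Proof.
move=> fs e0.
have nf0 i : 0 <= nm (f i) by exact: nm_ge0.
have [s us hs] : exists2 s : seq I, uniq s &
   (psum (fun i => nm (f i)) <= (\sum_(i <- s) nm (f i) + e)%:E)%E.
  apply: contrapT => h; have := psum_fin nf0 fs; set S := fine _ => SE.
  have : (psum (fun i => nm (f i)) <= (S - e)%:E)%E.
    apply: psum_le => s us; have [//|h2] := leP (\sum_(i <- s) nm (f i))%:E (S - e)%:E.
    case: h; exists s => //; rewrite SE lee_fin; move: h2; rewrite lte_fin => h2; lra.
  rewrite SE lee_fin; lra.
exists s => t ut st.
pose f1 i := if i \in t then f i else 0.
pose f2 i := if i \in t then 0 else f i.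
have s1 : csummable f1.
  apply: le_lt_trans fs; apply: le_psum => i; rewrite nm_ge0 /f1; case: ifP; by rewrite ?nm0 ?lexx ?nm_ge0.
have s2 : csummable f2.
  apply: le_lt_trans fs; apply: le_psum => i; rewrite nm_ge0 /f2; case: ifP; by rewrite ?nm0 ?lexx ?nm_ge0.
have -> : csum f = csum f1 + csum f2.
  rewrite -csumD //; congr csum; apply/funext => i; rewrite /f1 /f2.
  by case: ifP; rewrite ?addr0 ?add0r.
rewrite (@csum_seq _ t f1) //; last by move=> i /negbTE it; rewrite /f1 it.
have -> : \sum_(i <- t) f1 i = \sum_(i <- t) f i.
  by rewrite !big_seq; apply: eq_bigr => i it; rewrite /f1 it.
rewrite addrAC subrr add0r; apply: (csum_le (u := fun i => nm (f2 i))) => //.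
have e12 : (psum (fun i => nm (f i)) = psum (fun i => nm (f1 i)) + psum (fun i => nm (f2 i)))%E.
  rewrite -psumD; [|by move=> i; exact: nm_ge0|by move=> i; exact: nm_ge0].
  congr psum; apply/funext => i; rewrite /f1 /f2; case: ifP; by rewrite nm0 ?addr0 ?add0r.
have l1 : ((\sum_(i <- s) nm (f i))%:E <= psum (fun i => nm (f1 i)))%E.
  apply: le_trans (psum_ub (s := s) _ us); last by move=> i; exact: nm_ge0.
  rewrite lee_fin !big_seq; apply: ler_sum => i iS; by rewrite /f1 st.
have := hs; rewrite e12.
rewrite (psum_fin (u := fun i => nm (f1 i))) //; last by move=> i; exact: nm_ge0.
rewrite (psum_fin (u := fun i => nm (f2 i))) //; last by move=> i; exact: nm_ge0.
move: l1; rewrite (psum_fin (u := fun i => nm (f1 i))) //; last by move=> i; exact: nm_ge0.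
rewrite -EFinD !lee_fin /=; lra.
Qed.

Lemma csum_prod (I J : choiceType) (f : I -> C) (g : J -> C) (A B : R) :
  (psum (fun i => nm (f i)) <= A%:E)%E -> (psum (fun j => nm (g j)) <= B%:E)%E ->
  csum (fun p : I * J => f p.1 * g p.2) = csum f * csum g.
Proof.
move=> fA gB.
have gs : csummable g by apply: le_lt_trans gB (ltry _).
have fs : csummable f by apply: le_lt_trans fA (ltry _).
rewrite (csum_fubini (f := fun i j => f i * g j)); last first.
  rewrite /csummable (psum_psum (u := fun i j => nm (f i * g j))); last by move=> *; exact: nm_ge0.
  have B0 : 0 <= B by rewrite -lee_fin; apply: le_trans gB; apply: psum_ge0 => i; exact: nm_ge0.
  apply: le_lt_trans (ltry (B * A)).
  apply: (@le_trans _ _ (psum (fun i => B * nm (f i)))).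
    apply: le_esum => i _; under [X in psum X]eq_fun do rewrite nmM.
    rewrite psumZ ?nm_ge0 //; last by move=> *; exact: nm_ge0.
    by rewrite mulrC EFinM lee_wpmul2l // lee_fin nm_ge0.
  rewrite psumZ //; last by move=> *; exact: nm_ge0.
  by rewrite EFinM lee_wpmul2l // lee_fin.
under [X in csum X]eq_fun do rewrite csumZ //.
under [X in csum X]eq_fun do rewrite mulrC.
by rewrite csumZ // mulrC.
Qed.

End ComplexSum.

Notation psle u M := (psum u%R <= (M%R)%:E)%E.

(** * Power series with coefficient bounds *)

Section GenSeries.
Variable R : realType.
Local Notation C := (Cx R).

Definition mono m (z : 'rV[C]_m) (a : 'I_m -> nat) : C := \prod_(j < m) z 0 j ^+ a j.
Definition rmono m (r : 'I_m -> R) (a : 'I_m -> nat) : R := \prod_(j < m) r j ^+ a j.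
Definition polydisc m (r : 'I_m -> R) (z : 'rV[C]_m) : Prop := forall j, nm (z 0 j) <= r j.

(* The f i z ^ alpha i need not be distinct monomials: products and
   compositions of series are then plain reindexings. *)
Definition ser m (r : 'I_m -> R) (M : R) (f : 'rV[C]_m -> C) : Prop :=
  (forall j, 0 <= r j) /\
  exists (c : nat -> C) (a : nat -> 'I_m -> nat),
    (psle (fun i => nm (c i) * rmono r (a i)) M) /\
    forall z, polydisc r z -> f z = csum (fun i => c i * mono z (a i)).

Lemma rmono_ge0 m (r : 'I_m -> R) a : (forall j, 0 <= r j) -> 0 <= rmono r a.
Proof. by move=> r0; apply: prodr_ge0 => j _; rewrite exprn_ge0. Qed.

Lemma nm_mono_le m (r : 'I_m -> R) z a : polydisc r z -> nm (mono z a) <= rmono r a.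
Proof.
move=> zr; rewrite /mono nm_prod; apply: ler_prod => j _; rewrite nmX exprn_ge0 ?nm_ge0 //=.
by apply: lerXn2r; rewrite ?nnegrE ?nm_ge0 //; apply: le_trans (zr j); exact: nm_ge0.
Qed.

Lemma nm_term_le m (r : 'I_m -> R) z a c : polydisc r z -> nm (c * mono z a) <= nm c * rmono r a.
Proof. by move=> zr; rewrite nmM ler_wpM2l ?nm_ge0 // nm_mono_le. Qed.

(** A countable index type embeds in [nat] by [pickle], with zero coefficients elsewhere. Series can
    thus be indexed by pairs or multi-indices. *)
Lemma ser_intro (I : countType) m (r : 'I_m -> R) M f (c : I -> C) (a : I -> 'I_m -> nat) :
  (forall j, 0 <= r j) -> (psle (fun i => nm (c i) * rmono r (a i)) M) ->
  (forall z, polydisc r z -> f z = csum (fun i => c i * mono z (a i))) -> ser r M f.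
Proof.
move=> r0 cM fE; split => //.
pose c' n := if pickle_inv n is Some i then c i else 0.
pose a' n := if pickle_inv n is Some i then a i else (fun=> 0%N).
have pinj : injective (@pickle I) by apply: (pcan_inj pickleK).
have out n : ~ (exists i : I, pickle i = n) -> c' n = 0.
  move=> h; rewrite /c'; case e: (pickle_inv n) => [i|//]; case: h; exists i.
  by have := @pickle_invK I n; rewrite e.
have pE : psum (fun n => nm (c' n) * rmono r (a' n)) = psum (fun i => nm (c i) * rmono r (a i)).
  rewrite -(psum_inj pinj).
  - by congr psum; apply/funext => i; rewrite /= /c' /a' pickleK_inv.
  - by move=> n; rewrite mulr_ge0 ?nm_ge0 ?rmono_ge0.
  - by move=> n /out ->; rewrite nm0 mul0r.
exists c', a'; split; first by rewrite pE.
move=> z zr; rewrite fE // -(csum_inj (g := fun n => c' n * mono z (a' n)) pinj).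
- by congr csum; apply/funext => i; rewrite /= /c' /a' pickleK_inv.
- apply: (csummable_dom (u := fun n => nm (c' n) * rmono r (a' n)) (M := M)).
    by move=> i; exact: nm_term_le.
  by rewrite pE.
- by move=> n /out ->; rewrite mul0r.
Qed.

Lemma ser_bound m (r : 'I_m -> R) M f z : ser r M f -> polydisc r z -> nm (f z) <= M.
Proof.
move=> [r0 [c [a [cM fE]]]] zr; rewrite fE //.
by apply: (csum_le _ cM) => i; exact: nm_term_le.
Qed.

Lemma ser_r0 m (r : 'I_m -> R) M f : ser r M f -> forall j, 0 <= r j.
Proof. by case. Qed.

Lemma ser_M0 m (r : 'I_m -> R) M f : ser r M f -> 0 <= M.
Proof.
move=> [r0 [c [a [cM fE]]]]; rewrite -lee_fin; apply: le_trans cM; apply: psum_ge0 => i.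
by rewrite mulr_ge0 ?nm_ge0 ?rmono_ge0.
Qed.

Lemma ser_weak m (r r' : 'I_m -> R) M M' f : ser r M f -> (forall j, 0 <= r' j <= r j) -> M <= M' ->
  ser r' M' f.
Proof.
move=> [r0 [c [a [cM fE]]]] rr MM; split; first by move=> j; case/andP: (rr j).
have r'0 j : 0 <= r' j by case/andP: (rr j).
exists c, a; split.
  apply: le_trans (_ : M%:E <= _)%E; last by rewrite lee_fin.
  apply: le_trans cM; apply: le_psum => i; rewrite mulr_ge0 ?nm_ge0 ?rmono_ge0 //=.
  rewrite ler_wpM2l ?nm_ge0 //; apply: ler_prod => j _; rewrite exprn_ge0 //=.
  by apply: lerXn2r; rewrite ?nnegrE //; case/andP: (rr j).
by move=> z zr; apply: fE => j; apply: le_trans (zr j) _; case/andP: (rr j).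
Qed.

Lemma ser_eq m (r : 'I_m -> R) M f g : ser r M f -> (forall z, polydisc r z -> f z = g z) -> ser r M g.
Proof.
move=> [r0 [c [a [cM fE]]]] fg; split => //; exists c, a; split => // z zr.
by rewrite -fg // fE.
Qed.

Lemma ser_monom m (r : 'I_m -> R) (c : C) a : (forall j, 0 <= r j) ->
  ser r (nm c * rmono r a) (fun z => c * mono z a).
Proof.
move=> r0; apply: (ser_intro (I := unit) (c := fun=> c) (a := fun=> a)) => //.
  by rewrite (@psum_single _ _ _ tt) // ?mulr_ge0 ?nm_ge0 ?rmono_ge0 //; case.
by move=> z zr; rewrite (@csum_single _ _ _ tt) //; case.
Qed.

Lemma ser_cst m (r : 'I_m -> R) (c : C) : (forall j, 0 <= r j) -> ser r (nm c) (fun=> c).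
Proof.
move=> r0; have := ser_monom c (fun=> 0%N) r0.
have -> : rmono r (fun=> 0%N) = 1 by rewrite /rmono big1 // => j _; rewrite expr0.
rewrite mulr1 => /ser_eq; apply => z _.
by rewrite /mono big1 ?mulr1 // => j _; rewrite expr0.
Qed.

Lemma ser_coord m (r : 'I_m -> R) (j : 'I_m) : (forall j, 0 <= r j) -> ser r (r j) (fun z => z 0 j).
Proof.
move=> r0; have := ser_monom 1 (fun k => (k == j) : nat) r0.
have -> : rmono r (fun k => (k == j) : nat) = r j.
  rewrite /rmono (bigD1 j) //= eqxx expr1 big1 ?mulr1 // => k /negbTE ->; by rewrite expr0.
rewrite nm1 mul1r => /ser_eq; apply => z _.
rewrite /mono mul1r (bigD1 j) //= eqxx expr1 big1 ?mulr1 // => k /negbTE ->; by rewrite expr0.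
Qed.

Lemma monoD m (z : 'rV[C]_m) a b : mono z (fun j => (a j + b j)%N) = mono z a * mono z b.
Proof. by rewrite /mono -big_split; apply: eq_bigr => j _; rewrite exprD. Qed.

Lemma rmonoD m (r : 'I_m -> R) a b : rmono r (fun j => (a j + b j)%N) = rmono r a * rmono r b.
Proof. by rewrite /rmono -big_split; apply: eq_bigr => j _; rewrite exprD. Qed.

Lemma psum_prod_le (I J : choiceType) (u : I -> R) (v : J -> R) (A B : R) :
  (forall i, 0 <= u i) -> (forall i, 0 <= v i) -> (psum u <= A%:E)%E -> (psum v <= B%:E)%E ->
  (psle (fun p : I * J => u p.1 * v p.2) (A * B)).
Proof.
move=> u0 v0 uA vB; rewrite (psum_psum (u := fun i j => u i * v j)); last by move=> *; rewrite mulr_ge0.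
have B0 : 0 <= B by rewrite -lee_fin; apply: le_trans vB; apply: psum_ge0.
apply: (@le_trans _ _ (psum (fun i => B * u i))).
  by apply: le_esum => i _; rewrite psumZ // mulrC EFinM lee_wpmul2l // lee_fin.
by rewrite psumZ // mulrC EFinM lee_wpmul2l // lee_fin.
Qed.

Lemma ser_mul m (r : 'I_m -> R) M N f g : ser r M f -> ser r N g -> ser r (M * N) (fun z => f z * g z).
Proof.
move=> [r0 [c [a [cM fE]]]] [_ [d [b [dN gE]]]].
apply: (ser_intro (I := (nat * nat)%type) (c := fun p => c p.1 * d p.2)
  (a := fun p j => (a p.1 j + b p.2 j)%N)) => //.
  have := psum_prod_le _ _ cM dN; set l := psum _; set l' := psum _.
  have -> : l = l' by congr psum; apply/funext => p; rewrite rmonoD nmM; ring.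
  by apply => i; rewrite mulr_ge0 ?nm_ge0 ?rmono_ge0.
move=> z zr; rewrite fE // gE //.
rewrite -(csum_prod (f := fun i => c i * mono z (a i)) (g := fun i => d i * mono z (b i)) (A := M) (B := N)).
- by congr csum; apply/funext => p; rewrite monoD; ring.
- by apply: le_trans cM; apply: le_psum => i; rewrite nm_ge0 nm_term_le.
- by apply: le_trans dN; apply: le_psum => i; rewrite nm_ge0 nm_term_le.
Qed.

(** The double family of all terms is absolutely summable, and Fubini regroups it. Composition,
    geometric series, Weierstrass division and the Cauchy-Kovalevskaya solution are all
    instances. *)
Lemma ser_csum (I : countType) m (r : 'I_m -> R) M (N : I -> R) (f : I -> 'rV[C]_m -> C) :
  (forall j, 0 <= r j) ->
  (forall i, ser r (N i) (f i)) -> (psum N <= M%:E)%E -> ser r M (fun z => csum (fun i => f i z)).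
Proof.
move=> r0 fs NM.
have /choice [c /choice [a ca]] : forall i, exists c : nat -> C, exists a : nat -> 'I_m -> nat,
   (psle (fun i => nm (c i) * rmono r (a i)) (N i)) /\
    forall z, polydisc r z -> f i z = csum (fun i => c i * mono z (a i)).
  by move=> i; case: (fs i).
have pM : (psle (fun p : I * nat => nm (c p.1 p.2) * rmono r (a p.1 p.2)) M).
  rewrite (psum_psum (u := fun i n => nm (c i n) * rmono r (a i n))); last first.
    by move=> *; rewrite mulr_ge0 ?nm_ge0 ?rmono_ge0.
  by apply: le_trans NM; apply: le_esum => i _; case: (ca i).
apply: (ser_intro (I := (I * nat)%type) (c := fun p => c p.1 p.2) (a := fun p => a p.1 p.2)) => //.
move=> z zr; rewrite (csum_fubini (f := fun i n => c i n * mono z (a i n))).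
  by congr csum; apply/funext => i; rewrite (proj2 (ca i)).
apply: (csummable_dom (u := fun p => nm (c p.1 p.2) * rmono r (a p.1 p.2)) (M := M)) => //.
by move=> p; exact: nm_term_le.
Qed.

Lemma psum_bool (x y : R) : 0 <= x -> 0 <= y -> psum (fun b : bool => if b then x else y) = (x + y)%:E.
Proof.
move=> x0 y0; have -> : (fun b : bool => if b then x else y) =
  (fun b => (if b then x else 0) + (if b then 0 else y)).
  by apply/funext => -[]; rewrite ?addr0 ?add0r.
rewrite psumD; [|by case|by case].
rewrite (@psum_single _ _ _ true) //; last by case.
by rewrite (@psum_single _ _ _ false) //; case.
Qed.

Lemma ser_add m (r : 'I_m -> R) M N f g : ser r M f -> ser r N g -> ser r (M + N) (fun z => f z + g z).
Proof.
move=> fs gs; have M0 := ser_M0 fs; have N0 := ser_M0 gs.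
have hb (b : bool) : ser r (if b then M else N) (if b then f else g) by case: b.
have /ser_eq : ser r (M + N) (fun z => csum (fun b : bool => (if b then f else g) z)).
  by apply: (ser_csum (ser_r0 fs) hb); rewrite psum_bool.
apply => z _.
rewrite (@csum_seq _ _ [:: true; false]) //; last by case.
by rewrite !big_cons big_nil addr0.
Qed.

Lemma ser_scale m (r : 'I_m -> R) M c f : ser r M f -> ser r (nm c * M) (fun z => c * f z).
Proof. by move=> fs; exact: (ser_mul (ser_cst c (ser_r0 fs)) fs). Qed.

Lemma ser_opp m (r : 'I_m -> R) M f : ser r M f -> ser r M (fun z => - f z).
Proof.
move=> /(ser_scale (-1)); rewrite nmN nm1 mul1r => /ser_eq; apply => z _.
by rewrite mulN1r.
Qed.

Lemma ser_sub m (r : 'I_m -> R) M N f g : ser r M f -> ser r N g -> ser r (M + N) (fun z => f z - g z).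
Proof. by move=> fs gs; apply: ser_add fs (ser_opp gs). Qed.

Lemma ser_sum (I : Type) (s : seq I) m (r : 'I_m -> R) (M : I -> R) (f : I -> 'rV[C]_m -> C) :
  (forall j, 0 <= r j) -> (forall i, ser r (M i) (f i)) ->
  ser r (\sum_(i <- s) M i) (fun z => \sum_(i <- s) f i z).
Proof.
move=> r0 fs; elim: s => [|i s IH].
  have := @ser_cst m r 0 r0; rewrite nm0 big_nil => /ser_eq; apply => z _; by rewrite big_nil.
rewrite big_cons; have /ser_eq := ser_add (fs i) IH; apply => z _; by rewrite big_cons.
Qed.

Lemma ser_prod (I : Type) (s : seq I) m (r : 'I_m -> R) (M : I -> R) (f : I -> 'rV[C]_m -> C) :
  (forall j, 0 <= r j) -> (forall i, ser r (M i) (f i)) ->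
  ser r (\prod_(i <- s) M i) (fun z => \prod_(i <- s) f i z).
Proof.
move=> r0 fs; elim: s => [|i s IH].
  have := @ser_cst m r 1 r0; rewrite nm1 big_nil => /ser_eq; apply => z _; by rewrite big_nil.
rewrite big_cons; have /ser_eq := ser_mul (fs i) IH; apply => z _; by rewrite big_cons.
Qed.

Lemma ser_exp m (r : 'I_m -> R) M f n : ser r M f -> ser r (M ^+ n) (fun z => f z ^+ n).
Proof.
move=> fs; elim: n => [|n IH].
  by have := @ser_cst m r 1 (ser_r0 fs); rewrite nm1.
by rewrite exprS; have /ser_eq := ser_mul fs IH; apply => z _; rewrite exprS.
Qed.

(** The radius [s j] is used as the bound of the [j]-th component of [F]: substitution turns the
    [i]-th term of [f] into a series whose bound is the weight of that term, so the total [M] is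
    kept. *)
Lemma ser_comp m p (r : 'I_m -> R) (s : 'I_p -> R) M (f : 'rV[C]_p -> C) (F : 'rV[C]_m -> 'rV[C]_p) :
  (forall j, 0 <= r j) -> ser s M f -> (forall j, ser r (s j) (fun z => F z 0 j)) ->
  ser r M (f \o F).
Proof.
move=> r0 [s0 [c [a [cM fE]]]] Fs.
have Fpd z : polydisc r z -> polydisc s (F z) by move=> zr j; exact: ser_bound (Fs j) zr.
have : ser r M (fun z => csum (fun i => c i * mono (F z) (a i))).
  apply: (ser_csum (N := fun i => nm (c i) * rmono s (a i))) => // i.
  apply: ser_scale; apply: ser_prod => // j; exact: ser_exp.
by move=> /ser_eq; apply => z zr; rewrite /= fE //; exact: Fpd.
Qed.

Definition setc m (l : 'I_m) (z : 'rV[C]_m) (t : C) : 'rV[C]_m :=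
  \row_j (if j == l then t else z 0 j).

Lemma setcE m (l : 'I_m) (z : 'rV[C]_m) t j : setc l z t 0 j = if j == l then t else z 0 j.
Proof. by rewrite mxE. Qed.

Lemma ser_div m (r : 'I_m -> R) M f (l : 'I_m) : ser r M f -> 0 < r l ->
  exists2 G, ser r (M / r l) G &
    forall z, polydisc r z -> f z = f (setc l z 0) + z 0 l * G z.
Proof.
move=> [r0 [c [a [cM fE]]]] rl.
pose c' i := if a i l == 0%N then 0 else c i.
pose a' i j := if j == l then (a i j).-1 else a i j.
have rle i : nm (c' i) * rmono r (a' i) <= (r l)^-1 * (nm (c i) * rmono r (a i)).
  rewrite /c'; case: eqP => [_|/eqP ai].
    by rewrite nm0 mul0r mulr_ge0 ?invr_ge0 ?mulr_ge0 ?nm_ge0 ?rmono_ge0 // ltW.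
  rewrite mulrCA ler_wpM2l ?nm_ge0 //.
  rewrite /rmono (bigD1 l) //= [X in _ <= _ * X](bigD1 l) //= /a' eqxx.
  rewrite -[in leRHS](prednK (n := a i l)) ?lt0n // exprS -mulrA mulKf ?gt_eqF //.
  rewrite le_eqVlt; apply/orP; left; apply/eqP; congr (_ * _).
  by apply: eq_bigr => j /negbTE ->.
have cM' : (psle (fun i => nm (c' i) * rmono r (a' i)) (M / r l)).
  apply: (@le_trans _ _ (psum (fun i => (r l)^-1 * (nm (c i) * rmono r (a i))))).
    by apply: le_psum => i; rewrite rle andbT mulr_ge0 ?nm_ge0 ?rmono_ge0.
  rewrite psumZ ?invr_ge0 //; last by move=> i; rewrite mulr_ge0 ?nm_ge0 ?rmono_ge0.
  by rewrite mulrC EFinM lee_wpmul2l // lee_fin invr_ge0.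
exists (fun z => csum (fun i => c' i * mono z (a' i))).
  by split => //; exists c', a'.
move=> z zr; have zr0 : polydisc r (setc l z 0).
  by move=> j; rewrite setcE; case: eqP => // _; rewrite nm0.
have s1 : csummable (fun i => c i * mono (setc l z 0) (a i)).
  by apply: (csummable_dom _ cM) => i; exact: nm_term_le.
have s2 : csummable (fun i => c' i * mono z (a' i)).
  by apply: (csummable_dom _ cM') => i; exact: nm_term_le.
have s3 : csummable (fun i => z 0 l * (c' i * mono z (a' i))).
  apply: (csummable_dom (u := fun i => nm (z 0 l) * (nm (c' i) * rmono r (a' i)))
    (M := nm (z 0 l) * (M / r l))).
    by move=> i; rewrite nmM ler_wpM2l ?nm_ge0 // nm_term_le.
  rewrite psumZ ?nm_ge0 //; last by move=> i; rewrite mulr_ge0 ?nm_ge0 ?rmono_ge0.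
  by rewrite EFinM lee_wpmul2l // lee_fin nm_ge0.
rewrite fE // fE // -csumZ // -csumD //; congr csum; apply/funext => i.
pose P := \prod_(j < m | j != l) z 0 j ^+ a i j.
have e1 : mono (setc l z 0) (a i) = 0 ^+ a i l * P.
  rewrite /mono (bigD1 l) //= setcE eqxx; congr (_ * _); apply: eq_bigr => j /negbTE jl.
  by rewrite setcE jl.
have e2 : mono z (a i) = z 0 l ^+ a i l * P by rewrite /mono (bigD1 l).
have e3 : mono z (a' i) = z 0 l ^+ (a i l).-1 * P.
  by rewrite /mono (bigD1 l) //= /a' eqxx; congr (_ * _); apply: eq_bigr => j /negbTE ->.
rewrite e1 e2 e3 /c'; case: eqP => [->|/eqP ai].
  by rewrite !expr0 !mul0r mulr0 addr0.
have -> : z 0 l ^+ a i l = z 0 l * z 0 l ^+ (a i l).-1 by rewrite -exprS prednK // lt0n.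
by rewrite expr0n (negbTE ai) /=; ring.
Qed.

End GenSeries.

(** * Comparison with the power series definition of holomorphy *)

Section Analytic.
Variable R : realType.
Local Notation C := (Cx R).

Lemma near_poly m (w : 'rV[C]_m) (P : 'rV[C]_m -> Prop) :
  (\forall z \near w, P z) <->
  exists e : R, 0 < e /\ forall u, polydisc (fun=> e) u -> P (w + u).
Proof.
split.
  move=> /nbhs_ballP [e /= e0 eP].
  have eE := ge0_toC (ltW e0); set e' := complex.Re e in eE.
  have e'0 : 0 < e' by rewrite -toC_lt -eE.
  exists (e' / 2); split; first by rewrite divr_gt0.
  move=> u ue; apply: eP; split=> [|i j]; first exact: e0.
  rewrite ord1 mxE -ball_normE /ball_ /= opprD addrA subrr add0r normrN.
  by rewrite nmE eE toC_lt; apply: le_lt_trans (ue j) _; lra.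
move=> [e [e0 eP]]; apply/nbhs_ballP; exists (toC e) => /=; first by rewrite -toC0 toC_lt.
move=> z [_ zw]; rewrite -[z](subrK w) addrC; apply: eP => j.
have := zw 0 j; rewrite -ball_normE /ball_ /= nmE toC_lt => h.
by rewrite !mxE nm_distC ltW.
Qed.

(* Equivalent to [analytic_at] by [an_of_analytic] and [analytic_of_an]. *)
Definition an m (f : 'rV[C]_m -> C) (w : 'rV[C]_m) : Prop :=
  exists r M : R, 0 < r /\ ser (fun=> r) M (fun u => f (w + u)).

Section Box.
Variable m : nat.
Local Notation I := {ffun 'I_m -> nat}.

Definition box (N : nat) : seq I :=
  [seq [ffun i => val (b i)] | b : {ffun 'I_m -> 'I_N}].

Lemma box_uniq N : uniq (box N).
Proof.
rewrite map_inj_uniq ?enum_uniq // => b b' /ffunP e; apply/ffunP => i; apply: val_inj.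
by have := e i; rewrite !ffunE.
Qed.

Lemma mem_box N (a : I) : (forall i, (a i < N)%N) -> a \in box N.
Proof.
move=> aN; apply/mapP; exists [ffun i => Ordinal (aN i)]; first by rewrite mem_enum.
by apply/ffunP => i; rewrite !ffunE.
Qed.

Lemma power_psumE (a : I -> C) z N : power_psum a z N = \sum_(b <- box N) a b * mono z b.
Proof.
rewrite /power_psum /box big_map big_enum /=; apply: eq_bigr => b _; congr (_ * _).
by apply: eq_bigr => i _; rewrite ffunE.
Qed.

Lemma box_cover (s : seq I) : exists N, {subset s <= box N}.
Proof.
elim: s => [|a s [N hN]]; first by exists 0%N.
exists (maxn N (\max_i a i).+1) => b; rewrite inE => /orP[/eqP->|/hN].
  apply: mem_box => i; apply: leq_trans (leq_maxr _ _); rewrite ltnS; exact: leq_bigmax.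
move=> /mapP [c _ ->]; apply: mem_box => i; rewrite ffunE; apply: leq_trans (leq_maxl _ _).
exact: ltn_ord.
Qed.

Lemma box_mono N N' : (N <= N')%N -> {subset box N <= box N'}.
Proof.
move=> NN b /mapP [c _ ->]; apply: mem_box => i; rewrite ffunE; apply: leq_trans NN.
exact: ltn_ord.
Qed.

Lemma box_lim (g : I -> C) : csummable g -> (fun N => \sum_(b <- box N) g b) @ \oo --> csum g.
Proof.
move=> gs; apply/cvgrPdist_le => e e0.
have eE := ge0_toC (ltW e0); set e' := complex.Re e in eE.
have e'0 : 0 < e' by rewrite -toC_lt -eE.
have [s hs] := csum_approx gs e'0; have [N hN] := box_cover s.
exists N => // n /= Nn; rewrite eE nmE toC_le; apply: hs; first exact: box_uniq.
by move=> i /hN; exact: box_mono.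
Qed.

End Box.

Lemma toC_rmono m (r : R) (b : 'I_m -> nat) : mono (const_mx (toC r)) b = toC (rmono (fun=> r) b).
Proof.
by rewrite /mono /rmono toC_prod; apply: eq_bigr => i _; rewrite mxE toCX.
Qed.

(** Every finite set of multi-indices lies in a box, so bounded box sums bound the full sum of
    moduli. The box sums then tend to the unordered sum, which is the value of [f] by uniqueness of
    limits. *)
Lemma an_of_analytic m (f : 'rV[C]_m -> C) w : analytic_at f w -> an f w.
Proof.
move=> [a [[r [M [r0 aM]]] fE]].
have rE := ge0_toC (ltW r0); set r' := complex.Re r in rE.
have r'0 : 0 < r' by rewrite -toC_lt -rE.
have bE N : power_psum (fun alpha => `|a alpha|) (const_mx r) N =
   toC (\sum_(b <- box m N) nm (a b) * rmono (fun=> r') b).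
  rewrite power_psumE toC_sum; apply: eq_bigr => b _.
  by rewrite rE toC_rmono toCM nmE.
have t0 b : 0 <= nm (a b) * rmono (fun=> r') b.
  by rewrite mulr_ge0 ?nm_ge0 ?rmono_ge0 // => j; exact: ltW.
have ME : M = toC (complex.Re M).
  apply: ge0_toC; apply: le_trans (aM 0%N); rewrite bE -toC0 toC_le.
  by apply: sumr_ge0 => i _; exact: t0.
have pM : psle (fun b => nm (a b) * rmono (fun=> r') b) (complex.Re M).
  apply: psum_le => s us; have [N hN] := box_cover s.
  rewrite lee_fin; apply: (@le_trans _ _ (\sum_(b <- box m N) nm (a b) * rmono (fun=> r') b)).
    rewrite [leRHS](bigID (mem s)) /= -[leLHS]addr0 lerD //; last by apply: sumr_ge0 => i _; exact: t0.
    rewrite -[leRHS]big_filter le_eqVlt; apply/orP; left; apply/eqP; apply: perm_big.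
    apply: uniq_perm; rewrite ?filter_uniq ?box_uniq // => i.
    by rewrite mem_filter /=; case: (boolP (i \in s)) => //= /hN ->.
  by rewrite -toC_le -bE -ME.
move/near_poly: fE => [e [e0 fE]].
exists (Num.min r' e), (complex.Re M); split; first by rewrite lt_min r'0 e0.
have rr j : 0 <= (fun=> Num.min r' e : R) j <= (fun _ : 'I_m => r') j.
  by rewrite le_min (ltW r'0) (ltW e0) ge_min lexx.
apply: (ser_intro (I := {ffun 'I_m -> nat}) (c := a) (a := fun b => b)).
- by move=> j; case/andP: (rr j).
- apply: le_trans pM; apply: le_psum => b; apply/andP; split.
    rewrite mulr_ge0 ?nm_ge0 ?rmono_ge0 // => j; by case/andP: (rr j).
  rewrite ler_wpM2l ?nm_ge0 //; apply: ler_prod => j _; case/andP: (rr j) => h1 h2.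
  by rewrite exprn_ge0 //= lerXn2r ?nnegrE // ltW.
move=> u ur.
have ue : polydisc (fun=> e) u by move=> j; apply: le_trans (ur j) _; rewrite ge_min lexx orbT.
have ur' : polydisc (fun=> r') u by move=> j; apply: le_trans (ur j) _; rewrite ge_min lexx.
have := fE u ue; rewrite addrC addKr => h1.
have gs : csummable (fun b : {ffun 'I_m -> nat} => a b * mono u b).
  by apply: (csummable_dom _ pM) => b; exact: nm_term_le.
have := box_lim gs; under eq_fun do rewrite -power_psumE.
by move=> h2; exact: (cvg_unique (@norm_hausdorff _ _) h1 h2).
Qed.

(** Monomials may repeat in a [ser], whereas [analytic_at] has one coefficient for each multi-index:
    [A b] collects the coefficients of all terms with exponent [b]. *)
Lemma analytic_of_an m (f : 'rV[C]_m -> C) w : an f w -> analytic_at f w.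
Proof.
move=> [r [M [r0 [_ [c [a [cM fE]]]]]]].
pose I := {ffun 'I_m -> nat}.
pose fa i : I := [ffun j => a i j].
have faE (z : 'rV[C]_m) i : mono z (fa i) = mono z (a i) by apply: eq_bigr => j _; rewrite ffunE.
have rfaE (s : 'I_m -> R) i : rmono s (fa i) = rmono s (a i) by apply: eq_bigr => j _; rewrite ffunE.
pose A (b : I) : C := csum (fun i => if fa i == b then c i else 0).
have r0' (b : I) : 0 <= rmono (fun=> r) b by apply: rmono_ge0 => j; exact: ltW.
pose u (b : I) i := if fa i == b then nm (c i) * rmono (fun=> r) b else 0.
have u0 b i : 0 <= u b i by rewrite /u; case: eqP => // _; rewrite mulr_ge0 ?nm_ge0.
have uM : psle (fun p : I * nat => u p.1 p.2) M.
  rewrite -(psum_swap u0) (psum_psum (u := fun i b => u b i)) //.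
  apply: le_trans cM; apply: le_esum => i _; rewrite (@psum_single _ _ _ (fa i)) //.
    by rewrite lee_fin /u eqxx rfaE.
  by move=> b; rewrite eq_sym /u => /negbTE ->.
have rp (b : I) : 0 < rmono (fun=> r) b by apply: prodr_gt0 => j _; rewrite exprn_gt0.
have nc0 (b : I) i : 0 <= (if fa i == b then nm (c i) else 0) by case: ifP => // _; exact: nm_ge0.
have cE (b : I) : psum (fun i => if fa i == b then nm (c i) else 0)%R = ((rmono (fun=> r) b)^-1%:E * psum (u b))%E.
  rewrite -psumZ ?invr_ge0 //; congr psum; apply/funext => i; rewrite /u; case: ifP => _.
    by rewrite mulrCA mulVf ?mulr1 // gt_eqF.
  by rewrite mulr0.
have ub (b : I) : psle (u b) M.
  apply: le_trans uM; rewrite (psum_psum u0); apply: esum_ge; exists [set b].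
    by split => //; exact: finite_set1.
  by rewrite fsbig_set1.
have cfin (b : I) : (psum (fun i => if fa i == b then nm (c i) else 0)%R < +oo)%E.
  rewrite cE; apply: le_lt_trans (ltry ((rmono (fun=> r) b)^-1 * M)).
  by rewrite EFinM lee_wpmul2l // lee_fin invr_ge0.
have AM : psle (fun b => nm (A b) * rmono (fun=> r) b) M.
  apply: le_trans uM; rewrite (psum_psum u0); apply: le_esum => b _.
  have uE : u b = fun i => rmono (fun=> r) b * (if fa i == b then nm (c i) else 0).
    by apply/funext => i; rewrite /u; case: ifP => _; rewrite ?mulr0 // mulrC.
  rewrite uE psumZ // mulrC EFinM; apply: lee_wpmul2l; first by rewrite lee_fin.
  rewrite (psum_fin (nc0 b) (cfin b)) lee_fin.
  apply: (csum_le (u := fun i => if fa i == b then nm (c i) else 0)).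
    by move=> i; case: ifP; rewrite ?nm0.
  by rewrite -psum_fin.
exists A; split.
  exists (toC r), (toC M); split; first by rewrite -toC0 toC_lt.
  move=> N; rewrite power_psumE.
  have -> : \sum_(b <- box m N) `|A b| * mono (const_mx (toC r)) b =
     toC (\sum_(b <- box m N) nm (A b) * rmono (fun=> r) b).
    by rewrite toC_sum; apply: eq_bigr => b _; rewrite toC_rmono toCM nmE.
  rewrite toC_le -lee_fin; apply: le_trans AM; apply: psum_ub; last exact: box_uniq.
  by move=> b; rewrite mulr_ge0 ?nm_ge0.
apply/near_poly; exists r; split => // v vr.
have -> : w + v - w = v by rewrite addrC addKr.
have -> : power_psum A v = fun N => \sum_(b <- box m N) A b * mono v b.
  by apply/funext => N; rewrite power_psumE.
rewrite fE //.
have -> : csum (fun i => c i * mono v (a i)) = csum (fun b => A b * mono v b).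
  pose F i b := if fa i == b then c i * mono v b else 0.
  have -> : csum (fun i => c i * mono v (a i)) = csum (fun i => csum (F i)).
    congr csum; apply/funext => i; rewrite (@csum_single _ _ _ (fa i)) /F ?eqxx ?faE // => b.
    by rewrite eq_sym => /negbTE ->.
  rewrite csum_swap; last first.
    apply: (csummable_dom (u := fun p => u p.2 p.1) (M := M)).
      move=> [i b] /=; rewrite /F /u; case: eqP; rewrite ?nm0 // => _; exact: nm_term_le.
    rewrite (psum_swap (I := I) (J := nat) u0) //.
  congr csum; apply/funext => b; rewrite mulrC -csumZ.
    by congr csum; apply/funext => i; rewrite /F; case: eqP; rewrite ?mulr0 // mulrC.
  apply: le_lt_trans (cfin b); apply: le_psum => i; rewrite nm_ge0 /=.
  by case: ifP; rewrite ?nm0.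
apply: box_lim; apply: (csummable_dom _ AM) => b; exact: nm_term_le.
Qed.

End Analytic.

(** * Analytic functions *)

Section LocalCalculus.
Variable R : realType.
Local Notation C := (Cx R).

Lemma psum_geo (x : R) : 0 <= x -> psle (fun k : nat => x * 2^-1 ^+ k) (2 * x).
Proof.
move=> x0; apply: psum_le => s us; rewrite lee_fin.
have t0 k : 0 <= x * 2^-1 ^+ k by rewrite mulr_ge0 // exprn_ge0 // invr_ge0.
have [N sN] : exists N, {subset s <= iota 0 N}.
  exists (\max_(k <- s) k).+1 => k ks; rewrite mem_iota add0n ltnS.
  exact: (leq_bigmax_seq (F := id)).
apply: (@le_trans _ _ (\sum_(k <- iota 0 N) x * 2^-1 ^+ k)).
  rewrite [leRHS](bigID (mem s)) /= -[leLHS]addr0 lerD //; last by apply: sumr_ge0 => i _; exact: t0.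
  rewrite -[leRHS]big_filter le_eqVlt; apply/orP; left; apply/eqP; apply: perm_big.
  apply: uniq_perm; rewrite ?filter_uniq ?iota_uniq // => i.
  by rewrite mem_filter /=; case: (boolP (i \in s)) => //= /sN ->.
suff -> : \sum_(k <- iota 0 N) x * 2^-1 ^+ k = 2 * x - 2 * x * 2^-1 ^+ N.
  by rewrite gerBl mulr_ge0 ?mulr_ge0 // exprn_ge0 // invr_ge0.
elim: {sN} N => [|N IH]; first by rewrite big_nil expr0; ring.
by rewrite -addn1 iotaD big_cat /= IH add0n big_seq1 addn1 exprS; field.
Qed.

Lemma csum_nat_recl (f : nat -> C) : csummable f -> csum f = f 0%N + csum (fun k => f k.+1).
Proof.
move=> fs; pose f0 k := if k is 0%N then f 0%N else 0; pose f1 k := if k is 0%N then 0 else f k.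
have s0 : csummable f0.
  by apply: le_lt_trans fs; apply: le_psum => -[|k]; rewrite nm_ge0 /= ?nm0 ?nm_ge0.
have s1 : csummable f1.
  by apply: le_lt_trans fs; apply: le_psum => -[|k]; rewrite nm_ge0 /= ?nm0 ?nm_ge0.
have -> : csum f = csum f0 + csum f1.
  by rewrite -csumD //; congr csum; apply/funext => -[|k]; rewrite /= ?addr0 ?add0r.
rewrite (@csum_single _ _ f0 0%N); last by case.
congr (_ + _); rewrite -(csum_inj (e := S)) //; first exact: succn_inj.
by case=> [//|k []]; exists k.
Qed.

Lemma csum_nat_split (f : nat -> C) n : csummable f ->
  csummable (fun k => f (n + k)%N) /\ csum f = \sum_(k < n) f k + csum (fun k => f (n + k)%N).
Proof.
move=> fs; have sn k : csummable (fun i => f (k + i)%N).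
  apply: le_lt_trans fs.
  pose g i := if (k <= i)%N then nm (f i) else 0.
  apply: (@le_trans _ _ (psum g)); last first.
    by apply: le_psum => i; rewrite /g; case: ifP => _; rewrite ?lexx ?nm_ge0.
  rewrite -(psum_inj (e := fun i => (k + i)%N) (g := g)).
  - apply: le_psum => i; by rewrite nm_ge0 /g /= leq_addr lexx.
  - exact: addnI.
  - by move=> i; rewrite /g; case: ifP => // _; exact: nm_ge0.
  - move=> i h; rewrite /g; case: leqP => // ki; case: h; exists (i - k)%N.
    by rewrite subnKC.
split => //; elim: n => [|n IH]; first by rewrite big_ord0 add0r.
rewrite IH big_ord_recr /= -addrA; congr (_ + _).
rewrite csum_nat_recl // addn0; congr (_ + csum _).
by apply/funext => k; rewrite addnS.
Qed.

Lemma polydisc0 m (r : 'I_m -> R) : (forall j, 0 <= r j) -> polydisc r 0.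
Proof. by move=> r0 j; rewrite mxE nm0. Qed.

(** The coordinates are set to zero one after another by [ser_div], and the differences telescope
    from [f z] to [f 0]. *)
Lemma ser_hadamard m (r : 'I_m -> R) M f : ser r M f -> (forall j, 0 < r j) ->
  exists G : 'I_m -> 'rV[C]_m -> C, (forall l, ser r (M / r l) (G l)) /\
    forall z, polydisc r z -> f z = f 0 + \sum_l z 0 l * G l z.
Proof.
move=> fs rp; have r0 j := ltW (rp j).
pose zs (s : seq 'I_m) (z : 'rV[C]_m) : 'rV[C]_m := \row_j (if j \in s then 0 else z 0 j).
have H (s : seq 'I_m) : uniq s -> exists G : 'I_m -> 'rV[C]_m -> C, (forall l, ser r (M / r l) (G l)) /\
    forall z, polydisc r z -> f z = f (zs s z) + \sum_(l <- s) z 0 l * G l z.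
  elim: s => [_|l s IH /= /andP[ls us]].
    exists (fun _ _ => 0); split.
      move=> l; apply: ser_weak (ser_cst 0 r0) _ _; first by move=> j; rewrite r0 lexx.
      by rewrite nm0 divr_ge0 // (ser_M0 fs).
    by move=> z zr; rewrite big_nil addr0; congr f; apply/rowP => j; rewrite mxE.
  have [G [Gs GE]] := IH us.
  have s1 : ser r M (f \o zs s).
    apply: (ser_comp r0 fs) => j.
    case: (boolP (j \in s)) => js.
      apply: (ser_eq (f := fun=> 0)) => [|z _]; last by rewrite mxE js.
      apply: ser_weak (ser_cst 0 r0) _ _; first by move=> k; rewrite r0 lexx.
      by rewrite nm0.
    by apply: (ser_eq (ser_coord j r0)) => z _; rewrite mxE (negbTE js).
  have [g gs gE] := ser_div s1 (rp l).
  exists (fun k => if k == l then g else G k); split.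
    by move=> k; case: eqP => [->|].
  move=> z zr; rewrite big_cons eqxx GE //.
  have /= -> := gE z zr.
  have -> : zs s (setc l z 0) = zs (l :: s) z.
    by apply/rowP => j; rewrite !mxE inE; case: (j \in s); case: (j == l).
  rewrite -addrA; congr (_ + (_ + _)); rewrite !big_seq; apply: eq_bigr => k ks.
  by case: eqP => // kl; rewrite -kl ks in ls.
have [G [Gs GE]] := H _ (enum_uniq 'I_m); exists G; split => // z zr.
rewrite GE //; congr (f _ + _); last by rewrite big_enum.
by apply/rowP => j; rewrite !mxE mem_enum.
Qed.

(** By Hadamard's expansion the bound on radius [s'] is at most [s' * m * (M / r)], which tends to 0
    with [s']. The [+ 1] in the chosen radius avoids a zero denominator. *)
Lemma ser_small m (r M : R) (f : 'rV[C]_m -> C) (e : R) : 0 < r -> ser (fun=> r) M f -> f 0 = 0 -> 0 < e ->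
  exists s, [/\ 0 < s, s <= r & forall s', 0 <= s' <= s -> ser (fun=> s') e f].
Proof.
move=> r0 fs f0 e0; have [G [Gs GE]] := ser_hadamard fs (fun=> r0).
have M0 := ser_M0 fs.
have K0 : 0 <= m%:R * (M / r) by rewrite mulr_ge0 // divr_ge0 // ltW.
exists (Num.min r (e / (m%:R * (M / r) + 1))).
have sr : Num.min r (e / (m%:R * (M / r) + 1)) <= r by rewrite ge_min lexx.
split => //; first by rewrite lt_min r0 divr_gt0 // ltr_wpDl.
move=> s' /andP[s'0 s's]; have s'r := le_trans s's sr.
have : ser (fun _ : 'I_m => s') (\sum_(l <- enum 'I_m) s' * (M / r)) (fun z => \sum_(l <- enum 'I_m) z 0 l * G l z).
  apply: ser_sum => // l; apply: ser_mul; first exact: ser_coord.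
  by apply: ser_weak (Gs l) _ _ => // j; rewrite s'0.
move=> h; apply: (ser_eq (f := fun z => \sum_(l <- enum 'I_m) z 0 l * G l z)).
  apply: ser_weak h _ _ => [j|]; first by rewrite s'0 lexx.
  rewrite big_enum sumr_const card_ord /= -mulr_natl mulrCA.
  have := le_trans s's (_ : Num.min r (e / (m%:R * (M / r) + 1)) <= e / (m%:R * (M / r) + 1)).
  rewrite ge_min lexx orbT => /(_ isT).
  rewrite ler_pdivlMr ?ltr_wpDl // => h1; apply: le_trans h1; rewrite ler_wpM2l // lerDl.
  exact: ler01.
move=> z zs; rewrite GE ?f0 ?add0r; first by rewrite big_enum.
by move=> j; apply: le_trans (zs j) s'r.
Qed.

Lemma an_ext m (f g : 'rV[C]_m -> C) w : an f w -> (\forall z \near w, f z = g z) -> an g w.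
Proof.
move=> [r [M [r0 fs]]] /near_poly [e [e0 fg]].
exists (Num.min r e), M; split; first by rewrite lt_min r0.
apply: (ser_eq (f := fun u => f (w + u))).
  apply: ser_weak fs _ _ => // j.
  by rewrite le_min (ltW r0) (ltW e0) ge_min lexx.
by move=> z zr; apply: fg => j; apply: le_trans (zr j) _; rewrite ge_min lexx orbT.
Qed.

Lemma an_cst m (c : C) (w : 'rV[C]_m) : an (fun=> c) w.
Proof. by exists 1, (nm c); split => //; apply: ser_cst => j. Qed.

Lemma an2 m (f g : 'rV[C]_m -> C) w : an f w -> an g w -> exists r M N, [/\ 0 < r,
  ser (fun=> r) M (fun u => f (w + u)) & ser (fun=> r) N (fun u => g (w + u))].
Proof.
move=> [r [M [r0 fs]]] [s [N [s0 gs]]].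
exists (Num.min r s), M, N; split; first by rewrite lt_min r0.
  by apply: ser_weak fs _ _ => // j; rewrite le_min (ltW r0) (ltW s0) ge_min lexx.
by apply: ser_weak gs _ _ => // j; rewrite le_min (ltW r0) (ltW s0) ge_min lexx orbT.
Qed.

Lemma an_add m (f g : 'rV[C]_m -> C) w : an f w -> an g w -> an (fun z => f z + g z) w.
Proof. by move=> fa ga; have [r [M [N [r0 fs gs]]]] := an2 fa ga; exists r, (M + N); split => //; exact: ser_add. Qed.

Lemma an_mul m (f g : 'rV[C]_m -> C) w : an f w -> an g w -> an (fun z => f z * g z) w.
Proof. by move=> fa ga; have [r [M [N [r0 fs gs]]]] := an2 fa ga; exists r, (M * N); split => //; exact: ser_mul. Qed.

Lemma an_opp m (f : 'rV[C]_m -> C) w : an f w -> an (fun z => - f z) w.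
Proof. by move=> [r [M [r0 fs]]]; exists r, M; split => //; exact: ser_opp. Qed.

Lemma an_sub m (f g : 'rV[C]_m -> C) w : an f w -> an g w -> an (fun z => f z - g z) w.
Proof. by move=> fa ga; apply: an_add => //; exact: an_opp. Qed.

Lemma an_coord m (j : 'I_m) (w : 'rV[C]_m) : an (fun z => z 0 j) w.
Proof.
exists 1, (nm (w 0 j) + 1); split => //.
apply: (ser_eq (f := fun z => w 0 j + z 0 j)); last by move=> z _; rewrite mxE.
by apply: ser_add; [apply: ser_cst => // k; exact: ler01|apply: (ser_coord j (r := fun=> 1)) => k; exact: ler01].
Qed.

Lemma an_sum m (I : Type) (s : seq I) (P : pred I) (f : I -> 'rV[C]_m -> C) w :
  (forall i, P i -> an (f i) w) -> an (fun z => \sum_(i <- s | P i) f i z) w.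
Proof.
move=> fa; elim: s => [|i s IH].
  by under eq_fun do rewrite big_nil; exact: an_cst.
under eq_fun do rewrite big_cons; case Pi: (P i) => //.
by apply: an_add => //; exact: fa.
Qed.

Lemma an_exp m (f : 'rV[C]_m -> C) w n : an f w -> an (fun z => f z ^+ n) w.
Proof.
move=> fa; elim: n => [|n IH]; first exact: an_cst.
by under eq_fun do rewrite exprS; exact: an_mul.
Qed.

Definition anv m p (F : 'rV[C]_m -> 'rV[C]_p) w := forall j, an (fun z => F z 0 j) w.

Lemma common_radius (I : finType) (P : I -> R -> Prop) :
  (forall i, exists s, 0 < s /\ forall s', 0 < s' <= s -> P i s') ->
  exists s, 0 < s /\ forall s', 0 < s' <= s -> forall i, P i s'.
Proof.
move=> /choice [s sP].
exists (\big[Num.min/1]_i s i); split.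
  by apply: (big_ind (fun x => 0 < x)) => // [x y x0 y0|i _]; [rewrite lt_min x0|case: (sP i)].
move=> s' /andP[s'0 s's] i; apply: (proj2 (sP i)); rewrite s'0 /=; apply: le_trans s's _.
by rewrite (bigD1 i) //= ge_min lexx.
Qed.

(** After subtraction of [F w] the inner map vanishes at the centre, and [ser_small] shrinks it into
    the polydisc of convergence of [f]. *)
Lemma an_comp m p (f : 'rV[C]_p -> C) (F : 'rV[C]_m -> 'rV[C]_p) w :
  an f (F w) -> anv F w -> an (f \o F) w.
Proof.
move=> [r [M [r0 fs]]] Fa.
have : forall j, exists s, 0 < s /\ forall s', 0 < s' <= s -> ser (fun _ : 'I_m => s') r (fun u => F (w + u) 0 j - F w 0 j).
  move=> j; have [s [N [s0 Fs]]] := Fa j.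
  have h : ser (fun _ : 'I_m => s) (N + nm (F w 0 j)) (fun u => F (w + u) 0 j - F w 0 j).
    apply: ser_sub Fs _; apply: ser_cst => _; exact: ltW.
  have [|t [t0 ts tP]] := ser_small s0 h _ r0; first by rewrite addr0 subrr.
  by exists t; split => // s' /andP[s'0 s't]; apply: tP; rewrite (ltW s'0).
move/common_radius => [s [s0 sP]].
exists s, M; split => //.
have h := @ser_comp _ m p (fun=> s) (fun=> r) M _ (fun u => F (w + u) - F w) (fun=> ltW s0) fs.
apply: (ser_eq (h _)); last by move=> z _ /=; rewrite addrC subrK.
move=> j; have := sP s; rewrite s0 lexx => /(_ isT j) /ser_eq; apply => z _.
by rewrite !mxE.
Qed.

Lemma ser_translate m (r s M : R) (f : 'rV[C]_m -> C) (v : 'rV[C]_m) : 0 <= s ->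
  ser (fun=> r) M f -> (forall j, nm (v 0 j) + s <= r) -> ser (fun=> s) M (fun u => f (v + u)).
Proof.
move=> s0 fs vr.
apply: (@ser_comp _ m m (fun=> s) (fun=> r) M f (fun u => v + u) (fun=> s0) fs) => j.
apply: ser_weak (_ : ser (fun=> s) (nm (v 0 j) + s) _) _ (vr j); last by move=> k; rewrite s0 lexx.
apply: (ser_eq (f := fun z => v 0 j + z 0 j)); last by move=> z _; rewrite mxE.
by apply: ser_add; [apply: ser_cst|apply: (ser_coord j (r := fun=> s))].
Qed.

Lemma an_near m (f : 'rV[C]_m -> C) w : an f w -> \forall z \near w, an f z.
Proof.
move=> [r [M [r0 fs]]]; apply/near_poly; exists (r / 2); split; first by rewrite divr_gt0.
move=> v vr; exists (r / 2), M; split; first by rewrite divr_gt0.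
apply: (ser_eq (ser_translate _ fs (v := v) _)).
- by rewrite divr_ge0 // ltW.
- by move=> j; have := vr j; lra.
- by move=> z _; rewrite addrA.
Qed.

Lemma an_cont_nm m (f : 'rV[C]_m -> C) w e : an f w -> 0 < e -> \forall z \near w, nm (f z - f w) <= e.
Proof.
move=> [r [M [r0 fs]]] e0.
have h : ser (fun _ : 'I_m => r) (M + nm (f w)) (fun u => f (w + u) - f w).
  apply: ser_sub fs _; apply: ser_cst => _; exact: ltW.
have [|t [t0 ts tP]] := ser_small r0 h _ e0; first by rewrite addr0 subrr.
apply/near_poly; exists t; split => // u ut.
apply: ser_bound (tP t _) ut; by rewrite (ltW t0) lexx.
Qed.

Lemma anv_near_comp m p (F : 'rV[C]_m -> 'rV[C]_p) w (P : 'rV[C]_p -> Prop) : anv F w ->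
  (\forall z \near F w, P z) -> \forall z \near w, P (F z).
Proof.
move=> Fa /near_poly [e [e0 eP]].
have : \forall z \near w, forall j, nm (F z 0 j - F w 0 j) <= e.
  by apply: (@filter_forall _ _ _ (nbhs w)) => j; exact: (an_cont_nm (Fa j)).
apply: filterS => z zP; rewrite -[F z](subrK (F w)) addrC; apply: eP => j.
by rewrite !mxE.
Qed.

Lemma anv_near m p (F : 'rV[C]_m -> 'rV[C]_p) w : anv F w -> \forall z \near w, anv F z.
Proof. by move=> Fa; apply: (@filter_forall _ _ _ (nbhs w)) => j; exact: an_near. Qed.

Lemma an_neq0 m (f : 'rV[C]_m -> C) w : an f w -> f w != 0 -> \forall z \near w, f z != 0.
Proof.
move=> fa f0; have e0 : 0 < nm (f w) / 2 by rewrite divr_gt0 // nm_gt0.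
apply: filterS (an_cont_nm fa e0) => z; apply: contraTneq => ->.
rewrite sub0r nmN -ltNge; have : 0 < nm (f w) by rewrite nm_gt0.
lra.
Qed.

Lemma ser_geo m (r : 'I_m -> R) (g : 'rV[C]_m -> C) : ser r (2^-1) g ->
  ser r 2 (fun z => (1 - g z)^-1).
Proof.
move=> gs; have r0 := ser_r0 gs.
have geo1 := psum_geo (x := 1) ler01; rewrite mulr1 in geo1.
have h : ser r 2 (fun z => csum (fun k : nat => g z ^+ k)).
  apply: (ser_csum r0 (N := fun k => 1 * 2^-1 ^+ k)); last by [].
  by move=> k; rewrite mul1r; exact: ser_exp.
apply: (ser_eq h) => z zr; have gz := ser_bound gs zr.
have sg : csummable (fun k : nat => g z ^+ k).
  apply: (csummable_dom (u := fun k => 1 * 2^-1 ^+ k) _ geo1) => k.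
  by rewrite mul1r nmX lerXn2r ?nnegrE ?nm_ge0 // invr_ge0.
have e : csum (fun k : nat => g z ^+ k) = 1 + g z * csum (fun k : nat => g z ^+ k).
  by rewrite {1}csum_nat_recl // expr0 -csumZ //; congr (_ + csum _); apply/funext => k; rewrite exprS.
have n0 : 1 - g z != 0.
  rewrite subr_eq0; apply: contraTneq gz => <-; rewrite nm1 -ltNge; lra.
apply: (mulfI n0); rewrite mulfV // mulrBl mul1r {1}e; ring.
Qed.

Lemma an_inv m (f : 'rV[C]_m -> C) w : an f w -> f w != 0 -> an (fun z => (f z)^-1) w.
Proof.
move=> fa f0.
have [r [M [r0 gs]]] : an (fun z => 1 - (f w)^-1 * f z) w.
  by apply: an_sub; [exact: an_cst|apply: an_mul => //; exact: an_cst].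
have h2 : 0 < (2^-1 : R) by rewrite invr_gt0.
have [|s [s0 sr sP]] := ser_small r0 gs _ h2; first by rewrite addr0 mulVf // subrr.
have h := ser_geo (sP s _); rewrite (ltW s0) lexx in h.
exists s, (nm (f w)^-1 * 2); split => //; apply: (ser_eq (ser_scale _ (h isT))) => z _.
by rewrite subKr invfM invrK mulrA mulVf // mul1r.
Qed.

End LocalCalculus.

(** * Partial derivatives *)

Section Derivative.
Variable R : realType.
Local Notation C := (Cx R).

Lemma near_all m (I : finType) (w : 'rV[C]_m) (P : I -> 'rV[C]_m -> Prop) :
  (forall i, \forall z \near w, P i z) -> \forall z \near w, forall i, P i z.
Proof. by move=> h; apply: (@filter_forall _ _ _ (nbhs w)). Qed.

Lemma near_true m (w : 'rV[C]_m) (P : 'rV[C]_m -> Prop) : (forall z, P z) -> \forall z \near w, P z.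
Proof. by move=> h; apply/near_poly; exists 1; split. Qed.

Lemma near_and m (w : 'rV[C]_m) (P Q : 'rV[C]_m -> Prop) : (\forall z \near w, P z) ->
  (\forall z \near w, Q z) -> \forall z \near w, P z /\ Q z.
Proof. exact: filterI. Qed.

Lemma near_pt m (w : 'rV[C]_m) (P : 'rV[C]_m -> Prop) : (\forall z \near w, P z) -> P w.
Proof. exact: nbhs_singleton. Qed.

Lemma near_near m (w : 'rV[C]_m) (P : 'rV[C]_m -> Prop) :
  (\forall z \near w, P z) -> \forall z \near w, \forall y \near z, P y.
Proof.
move=> /near_poly [e [e0 eP]]; apply/near_poly; exists (e / 2); split; first by rewrite divr_gt0.
move=> u ue; apply/near_poly; exists (e / 2); split; first by rewrite divr_gt0.
move=> v ve; rewrite -addrA; apply: eP => j; rewrite mxE.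
apply: le_trans (ler_nmD _ _) _; have := ue j; have := ve j; lra.
Qed.

Lemma near0_poly m (P : 'rV[C]_m -> Prop) : (\forall z \near (0 : 'rV[C]_m), P z) <->
  exists e : R, 0 < e /\ forall u, polydisc (fun=> e) u -> P u.
Proof.
split=> [/near_poly [e [e0 h]]|[e [e0 h]]].
  by exists e; split => // u /h; rewrite add0r.
by apply/near_poly; exists e; split => // u /h; rewrite add0r.
Qed.

Lemma near_shift m (w : 'rV[C]_m) (P : 'rV[C]_m -> Prop) :
  (\forall z \near w, P z) <-> (\forall u \near (0 : 'rV[C]_m), P (w + u)).
Proof. by rewrite near_poly near0_poly. Qed.

Lemma nearC0 (P : C -> Prop) (e : R) : 0 < e -> (forall t, nm t <= e -> P t) -> \forall t \near (0 : C), P t.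
Proof.
move=> e0 eP; apply/nbhs_ballP; exists (toC e) => /=; first by rewrite -toC0 toC_lt.
move=> t; rewrite -ball_normE /ball_ /= sub0r normrN nmE toC_lt => /ltW; exact: eP.
Qed.

(* Locked, since unification and [ring] would unfold derivatives down to filters. *)
Definition pderiv m : 'I_m -> ('rV[C]_m -> C) -> 'rV[C]_m -> C :=
  locked (fun l f z => 'D_(delta_mx 0 l) (f : _ -> C^o) z).

Lemma pderiv_def m (l : 'I_m) (f : 'rV[C]_m -> C) z : pderiv l f z = 'D_(delta_mx 0 l) (f : _ -> C^o) z.
Proof. by rewrite /pderiv -lock. Qed.

Definition evec m (l : 'I_m) (t : C) : 'rV[C]_m := t *: delta_mx 0 l.

Lemma evecE m (l : 'I_m) t j : evec l t 0 j = if j == l then t else 0.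
Proof. by rewrite !mxE eqxx /=; case: eqP => _; rewrite ?mulr1 ?mulr0. Qed.

Lemma evec_poly m (l : 'I_m) t (e : R) : nm t <= e -> polydisc (fun=> e) (evec l t).
Proof. by move=> te j; rewrite evecE; case: eqP => // _; rewrite nm0 (le_trans (nm_ge0 _) te). Qed.

Lemma pderiv_lim m (l : 'I_m) (f : 'rV[C]_m -> C) z (g : 'rV[C]_1 -> C) (e : R) :
  an g 0 -> 0 < e -> (forall t : C, nm t <= e -> f (z + evec l t) = f z + t * g (const_mx t)) ->
  pderiv l f z = g 0.
Proof.
move=> ga e0 fE; rewrite pderiv_def /derive; apply: cvg_lim; first exact: norm_hausdorff.
apply/cvgrPdist_le => d d0.
have dE := ge0_toC (ltW d0); have d'0 : 0 < complex.Re d by rewrite -toC_lt -dE.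
have /near0_poly [e' [e'0 h]] := an_cont_nm ga d'0.
apply: (nearC0 (e := Num.min e e')); first by rewrite lt_min e0.
move=> t; rewrite le_min => /andP[te te'] t0.
have -> : t^-1 *: (((f : _ -> C^o) \o shift z) (t *: delta_mx 0 l) - f z) = g (const_mx t).
  have -> : ((f : _ -> C^o) \o shift z) (t *: delta_mx 0 l) = f z + t * g (const_mx t).
    by rewrite -fE //= addrC.
  rewrite addrC addKr; exact: (mulKf t0).
rewrite nmE dE toC_le nm_distC; apply: h => j; by rewrite mxE.
Qed.

(** The coefficient functions of a Hadamard expansion, which are not unique, all take the value of
    the partial derivative at the centre. The sum, product and chain rules are proved by exhibiting
    such an expansion. *)
Lemma pderivE m (l : 'I_m) (f : 'rV[C]_m -> C) w (H : 'I_m -> 'rV[C]_m -> C) :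
  an (H l) 0 -> (\forall u \near (0 : 'rV[C]_m), f (w + u) = f w + \sum_k u 0 k * H k u) ->
  pderiv l f w = H l 0.
Proof.
move=> Ha /near0_poly [e [e0 fE]].
have -> : H l 0 = (fun t : 'rV[C]_1 => H l (evec l (t 0 0))) 0.
  by congr (H l _); apply/rowP => j; rewrite evecE !mxE if_same.
apply: (@pderiv_lim _ l f w (fun t : 'rV[C]_1 => H l (evec l (t 0 0))) e) => //.
  apply: (an_comp (f := H l) (F := fun t : 'rV[C]_1 => evec l (t 0 0))).
    by rewrite mxE /evec scale0r.
  move=> j; under eq_fun do rewrite evecE; case: eqP => _; [exact: an_coord|exact: an_cst].
move=> t te; rewrite fE; last exact: evec_poly.
rewrite (bigD1 l) //= big1 ?addr0; last by move=> k /negbTE kl; rewrite evecE kl mul0r.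
by rewrite evecE eqxx mxE.
Qed.

(** A Cauchy estimate without integrals. As a series in the [m + 1] variables [(z, t)], of radii
    [r'] and [r - r'], the function [f (z + t e_l)] still has bound [M]. Division by [t] costs the
    factor [r - r'], and the quotient at [t = 0] is the derivative. *)
Lemma ser_pderiv m (l : 'I_m) (r r' M : R) (f : 'rV[C]_m -> C) : ser (fun=> r) M f -> 0 < r' -> r' < r ->
  ser (fun=> r') (M / (r - r')) (pderiv l f).
Proof.
move=> fs r'0 r'r; have d0 : 0 < r - r' by rewrite subr_gt0.
pose s (i : 'I_(m + 1)) := match fintype.split i with inl _ => r' | inr _ => r - r' end.
have sl j : s (lshift 1 j) = r' by rewrite /s; case: split_ordP => i // /eqP; rewrite eq_lrshift.
have sr j : s (rshift m j) = r - r' by rewrite /s; case: split_ordP => i // /eqP; rewrite eq_rlshift.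
have s0 i : 0 <= s i by rewrite /s; case: (fintype.split _) => _; exact: ltW.
pose F (y : 'rV[C]_(m + 1)) := lsubmx y + evec l (rsubmx y 0 0).
have Fs : ser s M (f \o F).
  apply: (ser_comp s0 fs) => j.
  apply: (@ser_weak _ _ s _ (r' + (r - r'))); [|by move=> k; rewrite s0 lexx|lra].
  apply: (ser_eq (f := fun y => y 0 (lshift 1 j) + (if j == l then y 0 (rshift m 0) else 0))).
    apply: ser_add; first by rewrite -[r' in ser _ r']( sl j); exact: ser_coord.
    case: eqP => _; first by rewrite -(sr 0); exact: ser_coord.
    apply: ser_weak (ser_cst 0 s0) _ _; first by move=> k; rewrite s0 lexx.
    by rewrite nm0 ltW.
  by move=> y _; rewrite /F mxE evecE !mxE.
have sr0 : 0 < s (rshift m 0) by rewrite sr.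
have [G Gs GE] := ser_div Fs sr0; rewrite sr in Gs.
have zs z t : polydisc (fun=> r') z -> nm t <= r - r' -> polydisc s (row_mx z (const_mx t)).
  move=> zr tr j; rewrite mxE /s; case: (fintype.split j) => k; first exact: zr.
  by rewrite mxE.
have Gz : ser (fun=> r') (M / (r - r')) (fun z : 'rV[C]_m => G (row_mx z (const_mx 0))).
  apply: (ser_comp (F := fun z => row_mx z (const_mx 0)) (fun=> ltW r'0) Gs) => j.
  rewrite /s; case: split_ordP => k ->.
    apply: (ser_eq (f := fun z => z 0 k)); first by apply: (ser_coord k (r := fun=> r')) => _; exact: ltW.
    by move=> z _; rewrite row_mxEl.
  apply: (ser_eq (f := fun=> 0)).
    apply: (@ser_weak _ _ (fun=> r') _ (nm 0)); first by apply: ser_cst => _; exact: ltW.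
      by move=> i; rewrite (ltW r'0) lexx.
    by rewrite nm0 ltW.
  by move=> z _; rewrite row_mxEr mxE.
apply: (ser_eq Gz) => z zr; apply/esym.
rewrite (@pderiv_lim _ l f z (fun t => G (row_mx z t)) (r - r')) //.
  exists (r - r'), (M / (r - r')); split => //.
  apply: (ser_comp (F := fun t => row_mx z (0 + t)) (fun=> ltW d0) Gs) => j.
  rewrite /s; case: split_ordP => k ->.
    apply: (ser_eq (f := fun=> z 0 k)); last by move=> t _; rewrite row_mxEl.
    apply: (@ser_weak _ _ (fun=> r - r') _ (nm (z 0 k))); [|by move=> i; rewrite (ltW d0) lexx|exact: zr].
    by apply: ser_cst => _; exact: ltW.
  apply: (ser_eq (f := fun t => t 0 k)); first by apply: (ser_coord k (r := fun=> r - r')) => _; exact: ltW.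
  by move=> t _; rewrite row_mxEr add0r.
move=> t td; have := GE _ (zs z t zr td).
rewrite row_mxEr mxE /= {1}/F row_mxKl row_mxKr mxE => ->.
congr (f _ + _); rewrite /F; apply/rowP => j.
by rewrite mxE evecE !mxE eqxx if_same addr0 eq_lrshift -(row_mxEl z (const_mx t : 'rV[C]_1)) mxE.
Qed.

Lemma pderiv_shift m (l : 'I_m) (f : 'rV[C]_m -> C) (w u : 'rV[C]_m) :
  pderiv l (fun z => f (w + z)) u = pderiv l f (w + u).
Proof.
rewrite !pderiv_def /derive; apply: (congr1 (fun F : C -> C^o => lim (F h @[h --> 0^']))).
by apply/funext => h; rewrite /= addrCA.
Qed.

Lemma an_pderiv m (l : 'I_m) (f : 'rV[C]_m -> C) w : an f w -> an (pderiv l f) w.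
Proof.
move=> [r [M [r0 fs]]]; have r20 : 0 < r / 2 by rewrite divr_gt0.
have r2r : r / 2 < r by rewrite ltr_pdivrMr // ltr_pMr // ltr1n.
exists (r / 2), (M / (r - r / 2)); split => //.
by apply: (ser_eq (ser_pderiv l fs r20 r2r)) => z _; rewrite pderiv_shift.
Qed.

Lemma an_hadamard m (f : 'rV[C]_m -> C) w : an f w ->
  exists G : 'I_m -> 'rV[C]_m -> C, (forall l, an (G l) 0) /\ (forall l, G l 0 = pderiv l f w) /\
    \forall u \near (0 : 'rV[C]_m), f (w + u) = f w + \sum_l u 0 l * G l u.
Proof.
move=> [r [M [r0 fs]]]; have [G [Gs GE]] := ser_hadamard fs (fun=> r0).
have Ga l : an (G l) 0.
  exists r, (M / r); split => //; apply: (ser_eq (Gs l)) => z _; by rewrite add0r.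
have h : \forall u \near (0 : 'rV[C]_m), f (w + u) = f w + \sum_l u 0 l * G l u.
  apply/near0_poly; exists r; split => // u ur; by rewrite GE // addr0.
by exists G; split => //; split => // l; rewrite (pderivE (H := G) (Ga l) h).
Qed.

Lemma pderiv_ext m (l : 'I_m) (f g : 'rV[C]_m -> C) w : an f w -> (\forall z \near w, f z = g z) ->
  pderiv l f w = pderiv l g w.
Proof.
move=> fa fg; have [G [Ga [G0 GE]]] := an_hadamard fa; rewrite -G0; apply/esym.
apply: (pderivE (H := G)) => //.
move/near_shift: fg => fg; have fgw : f w = g w by have := near_pt fg; rewrite addr0.
by apply: filterS2 GE fg => u e1 e2; rewrite -e2 e1 fgw.
Qed.

Lemma pderiv_near_ext m (f g : 'rV[C]_m -> C) w : an f w -> (\forall z \near w, f z = g z) ->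
  \forall z \near w, forall l, pderiv l f z = pderiv l g z.
Proof.
move=> fa fg; have h := an_near fa.
by apply: filterS2 h (near_near fg) => z za zfg l; exact: pderiv_ext.
Qed.

Lemma pderiv_cst m (l : 'I_m) (c : C) w : pderiv l (fun=> c) w = 0.
Proof.
rewrite (pderivE (H := fun _ _ => 0) (w := w)) //; first exact: an_cst.
by apply/near0_poly; exists 1; split => // u _; rewrite big1 ?addr0 // => i _; rewrite mulr0.
Qed.

Lemma pderiv_coord m (l j : 'I_m) w : pderiv l (fun z => z 0 j) w = (l == j)%:R.
Proof.
rewrite (pderivE (H := fun k _ => (k == j)%:R) (w := w)) //; first exact: an_cst.
apply/near0_poly; exists 1; split => // u _; rewrite (bigD1 j) //= eqxx mulr1 big1 ?addr0 ?mxE //.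
by move=> i /negbTE ->; rewrite mulr0.
Qed.

Lemma pderiv_add m (l : 'I_m) (f g : 'rV[C]_m -> C) w : an f w -> an g w ->
  pderiv l (fun z => f z + g z) w = pderiv l f w + pderiv l g w.
Proof.
move=> /an_hadamard [F [Fa [F0 FE]]] /an_hadamard [G [Ga [G0 GE]]].
rewrite (pderivE (H := fun k u => F k u + G k u) (w := w)) ?F0 ?G0 //; first exact: an_add.
apply: filterS2 FE GE => u -> ->; under [in RHS]eq_bigr do rewrite mulrDr.
by rewrite big_split /=; ring.
Qed.

Lemma pderiv_mul m (l : 'I_m) (f g : 'rV[C]_m -> C) w : an f w -> an g w ->
  pderiv l (fun z => f z * g z) w = pderiv l f w * g w + f w * pderiv l g w.
Proof.
move=> fa ga; have [F [Fa [F0 FE]]] := an_hadamard fa; have [G [Ga [G0 GE]]] := an_hadamard ga.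
have gw : an (fun u => g (w + u)) 0.
  case: ga => r [M [r0 gs]]; exists r, M; split => //; apply: (ser_eq gs) => z _; by rewrite add0r.
rewrite (pderivE (H := fun k u => F k u * g (w + u) + f w * G k u) (w := w)) ?F0 ?G0 ?addr0 //.
  by apply: an_add; apply: an_mul => //; exact: an_cst.
apply: filterS2 FE GE => u -> E2; under [in RHS]eq_bigr do rewrite mulrDr mulrA (mulrCA _ (f w)).
by rewrite big_split /= -mulr_suml -mulr_sumr E2; ring.
Qed.

Lemma pderiv_opp m (l : 'I_m) (f : 'rV[C]_m -> C) w : an f w -> pderiv l (fun z => - f z) w = - pderiv l f w.
Proof.
move=> fa; under [X in pderiv l X]eq_fun do rewrite -mulN1r.
rewrite pderiv_mul ?pderiv_cst ?mul0r ?add0r ?mulN1r //; exact: an_cst.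
Qed.

Lemma pderiv_sub m (l : 'I_m) (f g : 'rV[C]_m -> C) w : an f w -> an g w ->
  pderiv l (fun z => f z - g z) w = pderiv l f w - pderiv l g w.
Proof. by move=> fa ga; rewrite pderiv_add ?pderiv_opp //; exact: an_opp. Qed.

Lemma pderiv_sum m (l : 'I_m) (I : Type) (s : seq I) (f : I -> 'rV[C]_m -> C) w :
  (forall i, an (f i) w) ->
  pderiv l (fun z => \sum_(i <- s) f i z) w = \sum_(i <- s) pderiv l (f i) w.
Proof.
move=> fa; elim: s => [|i s IH].
  by rewrite big_nil; under [X in pderiv l X]eq_fun do rewrite big_nil; exact: pderiv_cst.
rewrite big_cons; under [X in pderiv l X]eq_fun do rewrite big_cons.
by rewrite pderiv_add ?IH //; apply: an_sum.
Qed.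

Lemma pderiv_comp m p (l : 'I_m) (f : 'rV[C]_p -> C) (F : 'rV[C]_m -> 'rV[C]_p) w :
  an f (F w) -> anv F w ->
  pderiv l (f \o F) w = \sum_j pderiv j f (F w) * pderiv l (fun z => F z 0 j) w.
Proof.
move=> fa Fa; have [G [Ga [G0 GE]]] := an_hadamard fa.
have /choice [H HP] := fun j => an_hadamard (Fa j).
have Fw : anv (fun u => F (w + u) - F w) 0.
  move=> j; apply: (an_ext (f := fun u => F (w + u) 0 j - F w 0 j)); last first.
    by apply: near_true => u; rewrite !mxE.
  apply: an_sub; last exact: an_cst.
  case: (Fa j) => r [M [r0 gs]]; exists r, M; split => //; apply: (ser_eq gs) => z _; by rewrite add0r.
have F0 : F (w + 0) - F w = 0 by rewrite addr0 subrr.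
pose K l u := \sum_j H j l u * G j (F (w + u) - F w).
have Ka : an (K l) 0.
  apply: an_sum => j _; apply: an_mul; first by case: (HP j).
  by apply: (an_comp (f := G j) (F := fun u => F (w + u) - F w)) => //; rewrite F0.
rewrite (pderivE (H := K) (w := w)) //.
  rewrite /K F0; apply: eq_bigr => j _; rewrite G0 mulrC; congr (_ * _).
  by case: (HP j) => _ [-> _].
rewrite -F0 in GE; have E1 := anv_near_comp Fw GE.
have E2 : \forall u \near (0 : 'rV[C]_m), forall j, F (w + u) 0 j = F w 0 j + \sum_l u 0 l * H j l u.
  by apply: near_all => j; case: (HP j) => _ [].
apply: filterS2 E1 E2 => u /=; rewrite addrC subrK => -> e2; congr (_ + _).
rewrite /K; under [RHS]eq_bigr do rewrite mulr_sumr.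
rewrite exchange_big /=; apply: eq_bigr => j _; rewrite !mxE e2 addrAC subrr add0r mulr_suml.
by apply: eq_bigr => k _; rewrite mulrA.
Qed.

End Derivative.

(** * The identity theorem and density arguments *)

Section Identity.
Variable R : realType.
Local Notation C := (Cx R).

Lemma le0_geometric (x y M : R) : 0 <= x < 1 -> 0 <= M -> (forall k, y <= M * x ^+ k) -> y <= 0.
Proof.
move=> /andP[x0 x1] M0 h; rewrite leNgt; apply/negP => y0.
have M1 : 0 < M + 1 by rewrite ltr_wpDl.
have e0 : 0 < y / (M + 1) by rewrite divr_gt0.
have [k] : exists k : nat, x ^+ k < y / (M + 1).
  have nx : `|x| < 1 by rewrite ger0_norm.
  have /cvgrPdist_lt /(_ _ e0) [k _ hk] := cvg_expr nx.
  exists k; have := hk k (leqnn k); by rewrite /= sub0r normrN ger0_norm // exprn_ge0.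
rewrite ltr_pdivlMr // => hk; have := h k.
have xk : 0 <= x ^+ k by rewrite exprn_ge0.
nra.
Qed.

(** If division by the variable never stops at a quotient with nonzero constant term, then
    [|f z| <= M (|z| / r) ^ k] for all [k], so [f] vanishes on the open disc. *)
Lemma one_var_order (r M : R) (f : 'rV[C]_1 -> C) : 0 < r -> ser (fun=> r) M f ->
  (forall z : 'rV[C]_1, nm (z 0 0) < r -> f z = 0) \/
  exists d u, [/\ ser (fun=> r) (M / r ^+ d) u, u 0 != 0 &
    forall z, polydisc (fun=> r) z -> f z = z 0 0 ^+ d * u z].
Proof.
move=> r0 fs.
have [|no] := pselect (exists d u, [/\ ser (fun _ : 'I_1 => r) (M / r ^+ d) u, u 0 != 0 &
    forall z, polydisc (fun=> r) z -> f z = z 0 0 ^+ d * u z]); first by right.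
left => z zr.
have H k : exists u, ser (fun _ : 'I_1 => r) (M / r ^+ k) u /\
    forall z, polydisc (fun=> r) z -> f z = z 0 0 ^+ k * u z.
  elim: k => [|k [u [us fE]]].
    by exists f; rewrite expr0 divr1; split => // y _; rewrite expr0 mul1r.
  have u0 : u 0 = 0.
    by apply: contrapT => /eqP u0; apply: no; exists k, u.
  have [G Gs GE] := @ser_div _ _ _ _ _ 0 us r0; exists G; split.
    by rewrite exprSr invfM mulrA.
  move=> y yr; rewrite fE // GE //.
  have -> : setc 0 y 0 = 0 by apply/rowP => j; rewrite setcE !ord1 eqxx mxE.
  by rewrite u0 add0r mulrA exprSr.
have zr' : polydisc (fun=> r) z by move=> j; rewrite ord1 ltW.
apply/eqP; rewrite -nm_eq0 eq_le nm_ge0 andbT.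
apply: (le0_geometric (x := nm (z 0 0) / r) (M := M)); first by rewrite divr_ge0 ?nm_ge0 ?ltW //= ltr_pdivrMr // mul1r.
  exact: ser_M0 fs.
move=> k; have [u [us fE]] := H k; rewrite fE // nmM nmX.
have h := ser_bound us zr'; rewrite expr_div_n [leRHS]mulrCA.
by rewrite ler_wpM2l // exprn_ge0 // nm_ge0.
Qed.

(** Restrict [f] to the complex line from [v], at [t = 0], to [w], at [t = 1]. The parameter disc
    has radius 2, so that [t = 1] is interior; since [1/5 + 2 * (2/5) = 1], the line stays in the
    polydisc of radius [r]. *)
Lemma ser_identity m (r M : R) (f : 'rV[C]_m -> C) v w : 0 < r -> ser (fun=> r) M f ->
  polydisc (fun=> r / 5) v -> polydisc (fun=> r / 5) w -> (\forall z \near v, f z = 0) -> f w = 0.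
Proof.
move=> r0 fs vr wr fv.
pose L (t : 'rV[C]_1) := v + t 0 0 *: (w - v).
have two : 0 < (2 : R) by [].
have Ls : ser (fun=> 2) M (f \o L).
  apply: (ser_comp (fun=> ltW two) fs) => j.
  have e : nm (v 0 j) + nm (w 0 j - v 0 j) * 2 <= r.
    have := vr j; have := wr j; have := ler_nmD (w 0 j) (- v 0 j); rewrite nmN; lra.
  apply: ser_weak (_ : ser (fun=> 2) (nm (v 0 j) + nm (w 0 j - v 0 j) * 2) _) _ e.
    apply: (ser_eq (f := fun t => v 0 j + (w 0 j - v 0 j) * t 0 0)).
      apply: ser_add; first by apply: ser_cst => _; exact: ltW.
      by apply: ser_scale; apply: (ser_coord _ (r := fun=> 2)) => _; exact: ltW.
    by move=> t _; rewrite !mxE mulrC.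
  by move=> k; rewrite lexx ltW.
have L1 : f w = (f \o L) (const_mx 1) by rewrite /= /L mxE scale1r addrC subrK.
have [h|[d [u [us u0 fE]]]] := one_var_order two Ls.
  by rewrite L1 h // mxE nm1; lra.
have ua : an u 0.
  by exists 2, (M / 2 ^+ d); split => //; apply: (ser_eq us) => z _; rewrite add0r.
have La : anv L 0.
  move=> j; apply: (an_ext (f := fun t => v 0 j + (w 0 j - v 0 j) * t 0 0)).
    by apply: an_add; [exact: an_cst|apply: an_mul; [exact: an_cst|exact: an_coord]].
  by apply: near_true => t; rewrite !mxE mulrC.
have L0 : L 0 = v by rewrite /L mxE scale0r addr0.
rewrite -L0 in fv; have N1 := anv_near_comp La fv; have N2 := an_neq0 ua u0.
have /near0_poly [e [e0 eP]] := near_and N1 N2.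
pose t : 'rV[C]_1 := const_mx (toC (Num.min e 1)).
have m0 : 0 < Num.min e 1 by rewrite lt_min e0 ltr01.
have tn : nm (t 0 0) = Num.min e 1 by rewrite mxE nm_toC // ltW.
have te : polydisc (fun=> e) t by move=> j; rewrite ord1 tn ge_min lexx.
have [h1 h2] := eP t te.
have := fE t; rewrite /= h1 => h3.
have : t 0 0 ^+ d * u t = 0.
  by rewrite -h3 // => j; rewrite ord1 tn; apply: le_trans (_ : 1 <= 2); [rewrite ge_min lexx orbT|lra].
move/eqP; rewrite mulf_eq0 (negbTE h2) orbF expf_eq0 => /andP[_].
by rewrite -nm_eq0 tn gt_eqF.
Qed.

Definition zg m (f : 'rV[C]_m -> C) : Prop := \forall z \near (0 : 'rV[C]_m), f z = 0.

Lemma an_ser0 m (f : 'rV[C]_m -> C) : an f 0 -> exists r M, 0 < r /\ ser (fun=> r) M f.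
Proof.
move=> [r [M [r0 fs]]]; exists r, M; split => //; apply: (ser_eq fs) => z _; by rewrite add0r.
Qed.

(** The nonzero set of [f] meets every neighbourhood of every point of a fixed polydisc; otherwise
    the identity theorem would make [f] vanish near 0. *)
Lemma an_dense m (f : 'rV[C]_m -> C) : an f 0 -> ~ zg f -> exists e : R, 0 < e /\
  forall v, polydisc (fun=> e) v -> forall P : 'rV[C]_m -> Prop, (\forall z \near v, P z) ->
    exists2 z, P z & f z != 0.
Proof.
move=> /an_ser0 [r [M [r0 fs]]] nz; exists (r / 5); split; first by rewrite divr_gt0.
move=> v vr P Pv; apply: contrapT => h; apply: nz; apply/near0_poly; exists (r / 5).
split; first by rewrite divr_gt0.
move=> w wr; apply: (ser_identity r0 fs vr wr).
apply: filterS Pv => z Pz; apply: contrapT => /eqP fz; apply: h; by exists z.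
Qed.

Lemma an_idom m (f g : 'rV[C]_m -> C) : an f 0 -> an g 0 -> zg (fun z => f z * g z) -> zg f \/ zg g.
Proof.
move=> fa ga fg; have [|nf] := pselect (zg f); [by left|right].
apply: contrapT => ng; have [e [e0 eP]] := an_dense fa nf; have [e' [e'0 e'P]] := an_dense ga ng.
have N0 : \forall z \near (0 : 'rV[C]_m), polydisc (fun=> Num.min e e') z /\
    an f z /\ (\forall y \near z, f y * g y = 0).
  have := near_and (an_near fa) (near_near fg); apply: near_and.
  by apply/near0_poly; exists (Num.min e e'); split => //; rewrite lt_min e0.
have [|v [vr [va vfg]] fv] := eP 0 _ _ N0.
  by apply: polydisc0 => _; exact: ltW.
have N1 := near_and (an_neq0 va fv) vfg.
have [|z [h1 h2] gz] := e'P v _ _ N1.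
  by move=> j; apply: le_trans (vr j) _; rewrite ge_min lexx orbT.
by move/eqP: h2; rewrite mulf_eq0 (negbTE h1) (negbTE gz).
Qed.

(** A bound valid where [f] is nonzero extends by density and continuity. A defect [d] at some point
    would survive at a nearby point with [f] nonzero, as at most [d / 3] is lost on each side. *)
Lemma zg_dense_le m (f a b : 'rV[C]_m -> C) (M : R) : an f 0 -> ~ zg f -> an a 0 -> an b 0 -> 0 <= M ->
  (\forall z \near (0 : 'rV[C]_m), f z != 0 -> nm (a z) <= M * nm (b z)) ->
  \forall z \near (0 : 'rV[C]_m), nm (a z) <= M * nm (b z).
Proof.
move=> fa nf aa ba M0 h; have [e [e0 eP]] := an_dense fa nf.
have N0 : \forall z \near (0 : 'rV[C]_m), polydisc (fun=> e) z by apply/near0_poly; exists e.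
have := near_and N0 (near_and (near_and (an_near aa) (an_near ba)) (near_near h)).
apply: filterS => v [ve [[va vb] vh]]; rewrite leNgt; apply/negP => lt.
pose d := nm (a v) - M * nm (b v); have d0 : 0 < d by rewrite subr_gt0.
have d1 : 0 < d / (3 * (M + 1)) by rewrite divr_gt0 // mulr_gt0 // ltr_wpDl.
have d2 : 0 < d / 3 by rewrite divr_gt0.
have [z [[z1 z2] z3] fz] := eP v ve _ (near_and (near_and (an_cont_nm va d2) (an_cont_nm vb d1)) vh).
have := z3 fz.
have h1 : nm (a v) <= nm (a z) + d / 3.
  have := ler_nmD (a z) (a v - a z); rewrite addrC subrK (nm_distC (a v)); lra.
have h2 : nm (b z) <= nm (b v) + d / (3 * (M + 1)).
  have := ler_nmD (b v) (b z - b v); rewrite addrC subrK; lra.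
have h3 : M * (d / (3 * (M + 1))) <= d / 3.
  have -> : M * (d / (3 * (M + 1))) = (d / 3) * (M / (M + 1)).
    by field; rewrite gt_eqF // ltr_wpDl.
  apply: ler_piMr; first exact: ltW.
  rewrite ler_pdivrMr ?ltr_wpDl // mul1r; lra.
have h4 : M * nm (b z) <= M * nm (b v) + M * (d / (3 * (M + 1))).
  by rewrite -mulrDr ler_wpM2l.
rewrite /d in h1 h3 h4 *; lra.
Qed.

Lemma zg_dense m (f a : 'rV[C]_m -> C) : an f 0 -> ~ zg f -> an a 0 ->
  (\forall z \near (0 : 'rV[C]_m), f z != 0 -> a z = 0) -> zg a.
Proof.
move=> fa nf aa h; suff /(an_idom fa aa) [] : zg (fun z => f z * a z) by [].
by apply: filterS h => z hz; have [->|/hz ->] := eqVneq (f z) 0; rewrite ?mul0r ?mulr0.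
Qed.

(** A [v] where both [f] and the [l]-th coordinate are nonzero exists because germs form a domain;
    [f] is then not identically zero on the line through [v]. The condition on [v 0 l] lets [v]
    replace the [l]-th basis vector. *)
Lemma direction m (l : 'I_m) (f : 'rV[C]_m -> C) : an f 0 -> ~ zg f -> exists v : 'rV[C]_m, v 0 l != 0 /\
  exists d (u : 'rV[C]_1 -> C), [/\ an u 0, u 0 != 0 &
    \forall t \near (0 : 'rV[C]_1), f ((t : 'rV[C]_1) 0 0 *: v) = t 0 0 ^+ d * u t].
Proof.
move=> fa nf; have la : an (fun z : 'rV[C]_m => z 0 l) 0 by exact: an_coord.
have nl : ~ zg (fun z : 'rV[C]_m => z 0 l).
  move=> /near0_poly [e [e0 h]]; have := h (evec l (toC e)); rewrite evecE eqxx => h'.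
  have : toC e = 0 by apply: h'; apply: evec_poly; rewrite nm_toC // ltW.
  by rewrite -toC0 => /toC_inj e00; rewrite e00 ltxx in e0.
have nfl : ~ zg (fun z => f z * z 0 l) by move=> /(an_idom fa la) [].
have [r [M [r0 fs]]] := an_ser0 fa.
have [v vr vP] : exists2 v : 'rV[C]_m, polydisc (fun=> r / 2) v & f v * v 0 l != 0.
  apply: contrapT => h; apply: nfl; apply/near0_poly; exists (r / 2).
  split; first by rewrite divr_gt0.
  by move=> v vr; apply: contrapT => /eqP h2; apply: h; exists v.
rewrite mulf_eq0 negb_or in vP; case/andP: vP => fv vl; exists v; split => //.
have two : 0 < (2 : R) by [].
have Ls : ser (fun=> 2) M (f \o (fun t : 'rV[C]_1 => t 0 0 *: v)).
  apply: (ser_comp (fun=> ltW two) fs) => j.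
  have e : nm (v 0 j) * 2 <= r by have := vr j; lra.
  apply: ser_weak (_ : ser (fun=> 2) (nm (v 0 j) * 2) _) _ e.
    apply: (ser_eq (f := fun t => v 0 j * t 0 0)); last by move=> t _; rewrite mxE mulrC.
    by apply: ser_scale; apply: (ser_coord _ (r := fun=> 2)) => _; exact: ltW.
  by move=> k; rewrite lexx ltW.
have [h|[d [u [us u0 fE]]]] := one_var_order two Ls.
  have := h (const_mx 1); rewrite mxE nm1 /= mxE scale1r => h1.
  by rewrite h1 ?eqxx // in fv; lra.
exists d, u; split => //.
  by exists 2, (M / 2 ^+ d); split => //; apply: (ser_eq us) => z _; rewrite add0r.
by apply/near0_poly; exists 2; split => // t tr; exact: fE.
Qed.

Lemma an_horner m (p : {poly C}) (f : 'rV[C]_m -> C) w : an f w -> an (fun z => p.[f z]) w.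
Proof.
move=> fa; under eq_fun do rewrite horner_coef.
by apply: an_sum => i _; apply: an_mul; [exact: an_cst|exact: an_exp].
Qed.

(** Every root of [P] is a root of [r]; cancelling one common linear factor at a time keeps the
    bound for the quotients, so multiplicities are respected. *)
Lemma dvdp_bounded (P r : {poly C}) (e M : R) : 0 <= M -> P != 0 ->
  (forall x, root P x -> nm x < e) ->
  (forall t, nm t < e -> nm r.[t] <= M * nm P.[t]) -> (P %| r)%R.
Proof.
move=> M0; have [n] := ubnP (size P); elim: n P r => // n IH P r; rewrite ltnS => sP P0 Pr rP.
have [s1|s1] := boolP (size P == 1%N).
  by rewrite (eqp_dvdl _ (_ : P %= 1)) ?dvd1p // -size_poly_eq1.
have /closed_rootP [x Px] := s1.
have xe := Pr x Px.
have rx : root r x.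
  have := rP x xe; move/eqP: (Px) => ->; rewrite nm0 mulr0 => h.
  by rewrite /root -nm_eq0 eq_le h nm_ge0.
have /factor_theorem [P1 PE] := Px; have /factor_theorem [r1 rE] := rx.
have P10 : P1 != 0 by apply: contraNneq P0 => P10; rewrite PE P10 mul0r.
rewrite PE rE dvdp_mul2r ?polyXsubC_eq0 //; apply: IH => //.
- have : size P = (size P1).+1 by rewrite PE size_Mmonic ?monicXsubC // size_XsubC addn2.
  by move=> sPE; rewrite sPE in sP.
- by move=> y Py; apply: Pr; rewrite PE rootM Py.
move=> t te; have [tx|tx] := eqVneq t x; last first.
  have := rP t te; rewrite PE rE !hornerM !nmM mulrA ler_pM2r //.
  by rewrite hornerXsubC nm_gt0 subr_eq0.
(* At the cancelled root [x] both sides of the given bound are 0; the bound between the quotients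
   reaches [x] by density. *)
rewrite {t te}tx leNgt; apply/negP => lt.
pose F (p : {poly C}) (z : 'rV[C]_1) := p.[x + z 0 0].
have Fa p : an (F p) 0 by apply: an_horner; apply: an_add; [exact: an_cst|exact: an_coord].
have F0 p : F p 0 = p.[x] by rewrite /F mxE addr0.
have near1 : \forall z \near (0 : 'rV[C]_1), (z : 'rV[C]_1) 0 0 != 0 -> nm (F r1 z) <= M * nm (F P1 z).
  have h0 : 0 < e - nm x by rewrite subr_gt0.
  apply/near0_poly; exists ((e - nm x) / 2); split; first by rewrite divr_gt0.
  move=> z zr z0; have te : nm (x + z 0 0) < e.
    by apply: le_lt_trans (ler_nmD _ _) _; have := zr 0; lra.
  have := rP _ te; rewrite PE rE !hornerM !nmM mulrA ler_pM2r //.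
  by rewrite hornerXsubC nm_gt0 addrC addrA addNr add0r.
have nz : ~ zg (fun z : 'rV[C]_1 => z 0 0).
  move=> /near0_poly [e' [e0 h]]; have := h (const_mx (toC e')); rewrite mxE => h'.
  have : toC e' = 0 by apply: h' => j; rewrite mxE nm_toC // ltW.
  by rewrite -toC0 => /toC_inj e00; rewrite e00 ltxx in e0.
have /near_pt := zg_dense_le (an_coord 0 0) nz (Fa r1) (Fa P1) M0 near1.
by rewrite !F0 leNgt lt.
Qed.

End Identity.

(** * Weierstrass division and the inverse function theorem *)

Section Weierstrass.
Variable R : realType.
Local Notation C := (Cx R).

Definition ins m (l : 'I_m.+1) (z : 'rV[C]_m) (t : C) : 'rV[C]_m.+1 :=
  \row_j (if unlift l j is Some k then z 0 k else t).
Definition del m (l : 'I_m.+1) (z : 'rV[C]_m.+1) : 'rV[C]_m := \row_k z 0 (lift l k).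

Lemma ins_l m (l : 'I_m.+1) z t : ins l z t 0 l = t.
Proof. by rewrite mxE unlift_none. Qed.
Lemma ins_lift m (l : 'I_m.+1) z t k : ins l z t 0 (lift l k) = z 0 k.
Proof. by rewrite mxE liftK. Qed.
Lemma delE m (l : 'I_m.+1) z k : del l z 0 k = z 0 (lift l k).
Proof. by rewrite mxE. Qed.
Lemma del_ins m (l : 'I_m.+1) z t : del l (ins l z t) = z.
Proof. by apply/rowP => k; rewrite delE ins_lift. Qed.
Lemma setc_ins m (l : 'I_m.+1) z t : setc l z t = ins l (del l z) t.
Proof.
apply/rowP => j; rewrite setcE mxE; case: unliftP => [k ->|->]; last by rewrite eqxx.
by rewrite eq_sym (negbTE (neq_lift _ _)) delE.
Qed.
Lemma ins00 m (l : 'I_m.+1) : ins l 0 0 = 0.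
Proof. by apply/rowP => j; rewrite mxE; case: unliftP => *; rewrite !mxE. Qed.
Lemma del0 m (l : 'I_m.+1) : del l 0 = 0.
Proof. by apply/rowP => j; rewrite !mxE. Qed.
Lemma evec_ins m (l : 'I_m.+1) t : evec l t = ins l 0 t.
Proof.
apply/rowP => j; rewrite evecE mxE; case: unliftP => [k ->|->]; last by rewrite eqxx.
by rewrite eq_sym (negbTE (neq_lift _ _)) mxE.
Qed.
Lemma del_evec m (l : 'I_m.+1) t : del l (evec l t) = 0.
Proof. by rewrite evec_ins del_ins. Qed.

Lemma anv_del m (l : 'I_m.+1) w : anv (@del m l) w.
Proof. by move=> j; under eq_fun do rewrite delE; exact: an_coord. Qed.
Lemma an_del m (l : 'I_m.+1) (f : 'rV[C]_m -> C) w : an f (del l w) -> an (fun z => f (del l z)) w.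
Proof. by move=> fa; apply: (an_comp (f := f) (F := @del m l)) => //; exact: anv_del. Qed.
Lemma anv_ins m p (l : 'I_m.+1) (F : 'rV[C]_p -> 'rV[C]_m) (g : 'rV[C]_p -> C) w :
  anv F w -> an g w -> anv (fun z => ins l (F z) (g z)) w.
Proof.
move=> Fa ga j; case: (unliftP l j) => [k ->|->].
  by under eq_fun do rewrite ins_lift; exact: Fa.
by under eq_fun do rewrite ins_l.
Qed.
Lemma anv_id m (w : 'rV[C]_m) : anv id w.
Proof. by move=> j; exact: an_coord. Qed.
Lemma anv_cst m p (v : 'rV[C]_p) (w : 'rV[C]_m) : anv (fun=> v) w.
Proof. by move=> j; exact: an_cst. Qed.

Lemma ser_divn m (l : 'I_m.+1) (r : 'I_m.+1 -> R) M f d : ser r M f -> 0 < r l ->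
  exists (a : nat -> 'rV[C]_m -> C) G, [/\ forall j, ser (r \o lift l) (M / r l ^+ j) (a j),
    ser r (M / r l ^+ d) G &
    forall z, polydisc r z -> f z = \sum_(j < d) a j (del l z) * z 0 l ^+ j + z 0 l ^+ d * G z].
Proof.
move=> fs rl; have r0 := ser_r0 fs; have M0 := ser_M0 fs.
elim: d => [|d [a [G [aP Gs fE]]]].
  exists (fun _ _ => 0), f; rewrite expr0 divr1; split => //.
    move=> j; apply: (@ser_weak _ _ (r \o lift l) _ (nm 0)).
    - by apply: ser_cst => k; exact: r0.
    - by move=> k /=; rewrite r0 lexx.
    - by rewrite nm0 divr_ge0 // exprn_ge0 // ltW.
  by move=> z _; rewrite big_ord0 expr0 mul1r add0r.
have [G' Gs' GE] := ser_div Gs rl.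
pose g z := G (ins l z 0).
have gs : ser (r \o lift l) (M / r l ^+ d) g.
  apply: (@ser_comp _ m m.+1 (r \o lift l) r _ G (fun z => ins l z 0)) => //.
    by move=> j; exact: r0.
  move=> j; case: (unliftP l j) => [k ->|->].
    apply: (ser_eq (f := fun z => z 0 k)); last by move=> z _; rewrite ins_lift.
    by apply: (ser_coord k (r := r \o lift l)) => i; exact: r0.
  apply: (ser_eq (f := fun=> 0)); last by move=> z _; rewrite ins_l.
  apply: (@ser_weak _ _ (r \o lift l) _ (nm 0)).
  - by apply: ser_cst => k; exact: r0.
  - by move=> k /=; rewrite r0 lexx.
  - by rewrite nm0.
exists (fun j => if j == d then g else a j), G'; split.
- by move=> j; case: eqP => [->|].
- by rewrite exprSr invfM mulrA.
- move=> z zr; rewrite big_ord_recr /= eqxx fE // GE // setc_ins -/(g _).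
  rewrite mulrDr addrA exprSr -mulrA; congr (_ + _ + _); last exact: mulrC.
  by apply: eq_bigr => j _; rewrite ltn_eqF.
Qed.

Lemma csum_sum (I : choiceType) d (F : 'I_d -> I -> C) : (forall j, csummable (F j)) ->
  csummable (fun i => \sum_j F j i) /\ csum (fun i => \sum_j F j i) = \sum_j csum (F j).
Proof.
elim: d F => [|d IH] F Fs.
  have e : (fun i => \sum_j F j i) = fun=> 0 by apply/funext => i; rewrite big_ord0.
  rewrite e big_ord0 csum0 //; split => //; rewrite /csummable /psum esum1 ?ltry // => i _.
  by rewrite nm0.
have [h1 h2] := IH (fun j => F (widen_ord (leqnSn d) j)) (fun j => Fs _).
have e : (fun i => \sum_j F j i) = fun i => \sum_(j < d) F (widen_ord (leqnSn d) j) i + F ord_max i.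
  by apply/funext => i; rewrite big_ord_recr.
rewrite e; split; last by rewrite csumD // h2 big_ord_recr.
apply: (@le_lt_trans _ _ (psum (fun i => nm (\sum_(j < d) F (widen_ord (leqnSn d) j) i) + nm (F ord_max i)))).
  by apply: le_psum => i; rewrite nm_ge0 ler_nmD.
rewrite psumD; [exact: (lte_add_pinfty h1 (Fs ord_max))|by move=> i; exact: nm_ge0|by move=> i; exact: nm_ge0].
Qed.

(** With [c_0 = c], divide [c_k = R_k + z_l ^ d q_k] and put [c_(k+1) = - S q_k]. The bound on [S]
    halves the norm at each turn, and summing over [k] gives [c = (z_l ^ d + S) Q + R] for [Q] and
    [R] the sums of the [q_k] and [R_k]. *)
Lemma weier_iter m (l : 'I_m.+1) (r : 'I_m.+1 -> R) d S c K :
  0 < r l -> ser r (r l ^+ d / 2) S -> ser r K c ->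
  exists Q (A : nat -> 'rV[C]_m -> C), [/\ ser r (2 * (K / r l ^+ d)) Q,
    forall j, ser (r \o lift l) (2 * (K / r l ^+ j)) (A j) &
    forall z, polydisc r z ->
      c z = (z 0 l ^+ d + S z) * Q z + \sum_(j < d) A j (del l z) * z 0 l ^+ j].
Proof.
move=> rl Ss cs; have r0 := ser_r0 cs; have K0 := ser_M0 cs.
(* The division is chosen as a total function of a germ and its bound, the bound being a premise of
   its specification: the sequence [cn] can be defined before its bounds are proved. *)
have /choice [T TP] : forall p : ('rV[C]_m.+1 -> C) * R, exists GA : ('rV[C]_m.+1 -> C) * (nat -> 'rV[C]_m -> C),
   ser r p.2 p.1 -> [/\ forall j, ser (r \o lift l) (p.2 / r l ^+ j) (GA.2 j),
    ser r (p.2 / r l ^+ d) GA.1 &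
    forall z, polydisc r z -> p.1 z = \sum_(j < d) GA.2 j (del l z) * z 0 l ^+ j + z 0 l ^+ d * GA.1 z].
  move=> [g N]; have [gs|ns] := pselect (ser r N g); last by exists (g, fun _ _ => 0).
  by have [a [G h]] := ser_divn d gs rl; exists (G, a).
pose Kn k := K * 2^-1 ^+ k.
pose cn := fix cn k := if k is k'.+1 then fun z => - (S z * (T (cn k', Kn k')).1 z) else c.
have rd : 0 < r l ^+ d by rewrite exprn_gt0.
have cnP k : ser r (Kn k) (cn k).
  elim: k => [|k IH]; first by rewrite /Kn expr0 mulr1.
  have [_ Gs _] := TP (cn k, Kn k) IH.
  have -> : Kn k.+1 = r l ^+ d / 2 * (Kn k / r l ^+ d) by rewrite /Kn exprS; field; rewrite gt_eqF.
  exact: ser_opp (ser_mul Ss Gs).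
pose q k := (T (cn k, Kn k)).1; pose A k := (T (cn k, Kn k)).2.
have qs k : ser r (Kn k / r l ^+ d) (q k) by case: (TP (cn k, Kn k) (cnP k)).
have As k j : ser (r \o lift l) (Kn k / r l ^+ j) (A k j) by case: (TP (cn k, Kn k) (cnP k)).
have cE k z : polydisc r z -> cn k z = \sum_(j < d) A k j (del l z) * z 0 l ^+ j + z 0 l ^+ d * q k z.
  by case: (TP (cn k, Kn k) (cnP k)) => _ _; apply.
have geo j : psle (fun k => Kn k / r l ^+ j) (2 * (K / r l ^+ j)).
  have -> : (fun k => Kn k / r l ^+ j) = (fun k => K / r l ^+ j * 2^-1 ^+ k).
    by apply/funext => k; rewrite /Kn mulrAC.
  by apply: psum_geo; rewrite divr_ge0 ?exprn_ge0 // ltW.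
exists (fun z => csum (fun k => q k z)), (fun j z => csum (fun k => A k j z)); split.
- by apply: (ser_csum r0 qs).
- move=> j; apply: (ser_csum _ (fun k => As k j)) => // i; exact: r0.
- move=> z zr.
have zr' : polydisc (r \o lift l) (del l z) by move=> j; rewrite delE; exact: zr.
have cnS : csummable (fun k => cn k z).
  apply: (csummable_dom (u := Kn) (M := 2 * K)); first by move=> k; exact: ser_bound (cnP k) zr.
  exact: psum_geo.
have qS : csummable (fun k => q k z).
  by apply: (csummable_dom _ (geo d)) => k; exact: ser_bound (qs k) zr.
have AS j : csummable (fun k => A k j (del l z)).
  by apply: (csummable_dom _ (geo j)) => k; exact: ser_bound (As k j) zr'.
have scS (f : nat -> C) a : csummable f -> csummable (fun k => a * f k).
  move=> fs; rewrite /csummable; under [X in psum X]eq_fun do rewrite nmM.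
  rewrite psumZ ?nm_ge0 //; last by move=> k; exact: nm_ge0.
  rewrite (psum_fin (u := fun i => nm (f i))) //; last by move=> k; exact: nm_ge0.
  by rewrite -EFinM ltry.
have e1 : csum (fun k => cn k z) = c z + csum (fun k => cn k.+1 z) by rewrite csum_nat_recl.
have e2 : csum (fun k => cn k.+1 z) = - S z * csum (fun k => q k z).
  by rewrite -csumZ //; congr csum; apply/funext => k /=; rewrite mulNr.
have AS' (j : 'I_d) : csummable (fun k => A k j (del l z) * z 0 l ^+ j).
  by under eq_fun do rewrite mulrC; exact: scS.
have [s3 e3] := csum_sum AS'.
have e4 : csum (fun k => cn k z) = \sum_(j < d) csum (fun k => A k j (del l z)) * z 0 l ^+ j +
    z 0 l ^+ d * csum (fun k => q k z).
  under [X in csum X]eq_fun do rewrite cE //.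
  rewrite csumD //; last exact: scS.
  rewrite e3 csumZ //; congr (_ + _); apply: eq_bigr => j _; rewrite [RHS]mulrC -csumZ //.
  by congr csum; apply/funext => k; rewrite mulrC.
have -> : c z = csum (fun k => cn k z) - csum (fun k => cn k.+1 z) by rewrite e1 addrK.
rewrite e4 e2; ring.
Qed.

(** Weierstrass regularity: on the [l]-th axis [f] has a zero of order exactly [d]. *)
Definition regular m (l : 'I_m.+1) d (f : 'rV[C]_m.+1 -> C) : Prop :=
  exists u : 'rV[C]_1 -> C, [/\ an u 0, u 0 != 0 &
    \forall t \near (0 : 'rV[C]_1), f (evec l ((t : 'rV[C]_1) 0 0)) = t 0 0 ^+ d * u t].

Lemma nz_coord : ~ zg (fun z : 'rV[C]_1 => z 0 0).
Proof.
move=> /near0_poly [e' [e0 h]]; have := h (const_mx (toC e')); rewrite mxE => h'.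
have : toC e' = 0 by apply: h' => j; rewrite mxE nm_toC // ltW.
by rewrite -toC0 => /toC_inj e00; rewrite e00 ltxx in e0.
Qed.

Lemma an_idom_exp d (k : 'rV[C]_1 -> C) : an k 0 -> zg (fun t : 'rV[C]_1 => t 0 0 ^+ d * k t) -> zg k.
Proof.
move=> ka; elim: d => [|d IH]; first by apply: filterS => t; rewrite expr0 mul1r.
move=> h; apply: IH.
have an1 : an (fun t : 'rV[C]_1 => t 0 0 ^+ d * k t) 0 by apply: an_mul => //; apply: an_exp; exact: an_coord.
suff /(an_idom (an_coord 0 0) an1) [/nz_coord|//] : zg (fun t : 'rV[C]_1 => t 0 0 * (t 0 0 ^+ d * k t)) by [].
by apply: filterS h => t; rewrite exprS mulrA.
Qed.

(** Near 0 the polynomial is bounded by a multiple of [t ^ d], hence divisible by ['X^d], and its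
    degree is below [d]. *)
Lemma poly_order_uniq d (a : nat -> C) (k : 'rV[C]_1 -> C) : an k 0 ->
  (\forall t \near (0 : 'rV[C]_1), \sum_(j < d) a j * (t : 'rV[C]_1) 0 0 ^+ j = t 0 0 ^+ d * k t) ->
  (forall j, (j < d)%N -> a j = 0) /\ k 0 = 0.
Proof.
move=> ka h; pose p := \poly_(j < d) a j.
have pE t : p.[t] = \sum_(j < d) a j * t ^+ j by rewrite horner_poly.
have [e1 [e10 h1]] := iffLR (near0_poly _) (near_and h (an_cont_nm ka (ltr01))).
have p0 : p = 0.
  apply/eqP; apply: contraT => pn0.
  have : ('X^d %| p)%R.
    apply: (@dvdp_bounded _ _ _ e1 (nm (k 0) + 1)).
    - by rewrite addr_ge0 ?nm_ge0.
    - by rewrite monic_neq0 // monicXn.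
    - by move=> x; rewrite /root hornerXn expf_eq0 => /andP[_ /eqP ->]; rewrite nm0.
    - move=> t te; have [|h2 h3] := h1 (const_mx t); first by move=> j; rewrite mxE ltW.
      rewrite mxE in h2; rewrite pE h2 hornerXn nmM mulrC ler_wpM2r ?nm_ge0 //.
      have := ler_nmD (k 0) (k (const_mx t) - k 0); rewrite addrC subrK; lra.
  by rewrite gtNdvdp // size_polyXn ltnS size_poly.
have aj j : (j < d)%N -> a j = 0.
  by move=> jd; have := congr1 (fun q : {poly C} => q`_j) p0; rewrite coef_poly jd coef0.
split => //; have /(an_idom_exp ka) /near_pt // : zg (fun t : 'rV[C]_1 => t 0 0 ^+ d * k t).
apply: filterS h => t <-; rewrite big1 // => j _; by rewrite aj ?mul0r.
Qed.

Lemma an_evec m (l : 'I_m.+1) (f : 'rV[C]_m.+1 -> C) : an f 0 -> an (fun t : 'rV[C]_1 => f (evec l (t 0 0))) 0.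
Proof.
move=> fa; apply: (an_comp (f := f) (F := fun t : 'rV[C]_1 => evec l (t 0 0))).
  by rewrite mxE /evec scale0r.
move=> j; under eq_fun do rewrite evecE; case: eqP => _; [exact: an_coord|exact: an_cst].
Qed.

Lemma near_evec m (l : 'I_m.+1) (P : 'rV[C]_m.+1 -> Prop) : (\forall z \near (0 : 'rV[C]_m.+1), P z) ->
  \forall t \near (0 : 'rV[C]_1), P (evec l ((t : 'rV[C]_1) 0 0)).
Proof.
move=> /near0_poly [e [e0 h]]; apply/near0_poly; exists e; split => // t te; apply: h.
exact: evec_poly.
Qed.

(* Write [f] as [G * z l ^ d] plus a part that is small near 0; iterated
   division by [z l ^ d] then converges geometrically. *)
Lemma weier_div m (l : 'I_m.+1) d f c : an f 0 -> regular l d f -> an c 0 ->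
  exists q (A : nat -> 'rV[C]_m -> C), [/\ an q 0, forall j, an (A j) 0 &
    \forall z \near (0 : 'rV[C]_m.+1), c z = f z * q z + \sum_(j < d) A j (del l z) * z 0 l ^+ j].
Proof.
move=> fa [u [ua u0 uE]] ca.
have [r1 [M [K [r10 fs cs]]]] := an2 fa ca.
have {}fs : ser (fun=> r1) M f by apply: (ser_eq fs) => z _; rewrite add0r.
have {}cs : ser (fun=> r1) K c by apply: (ser_eq cs) => z _; rewrite add0r.
have [a [G [aP Gs fE]]] := ser_divn (l := l) d fs r10.
have Ga : an G 0 by exists r1, (M / r1 ^+ d); split => //; apply: (ser_eq Gs) => z _; rewrite add0r.
(* On the [l]-th axis, uniqueness of the expansion compares the division by [z l ^ d] with the order
   of [f] there. *)
have [a0 G0] : (forall j, (j < d)%N -> a j 0 = 0) /\ G 0 != 0.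
  have [||h1 h2] := @poly_order_uniq d (fun j => a j 0) (fun t => u t - G (evec l (t 0 0))).
  - by apply: an_sub => //; exact: an_evec.
  - have fE' : \forall z \near (0 : 'rV[C]_m.+1), f z = \sum_(j < d) a j (del l z) * z 0 l ^+ j + z 0 l ^+ d * G z.
      by apply/near0_poly; exists r1.
    apply: filterS2 uE (near_evec l fE') => t -> e.
    have {}e : t 0 0 ^+ d * u t = \sum_(j < d) a j 0 * t 0 0 ^+ j + t 0 0 ^+ d * G (evec l (t 0 0)).
      rewrite e evecE eqxx; congr (_ + _); by apply: eq_bigr => j _; rewrite del_evec.
    by rewrite mulrBr e addrK.
  split => //; move/eqP: h2; rewrite subr_eq0 => /eqP h2; rewrite mxE /evec scale0r in h2.
  by rewrite -h2.
have [r2 [N [r20 Is]]] := an_ser0 (an_inv Ga G0).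
pose t := Num.min r1 r2.
have t0 : 0 < t by rewrite lt_min r10.
have N0 := ser_M0 Is.
pose W := \sum_(j < d) t ^+ j.
have W0 : 0 <= W by apply: sumr_ge0 => j _; rewrite exprn_ge0 // ltW.
(* This [e] makes the norm of [S] at most [N * (e * W)], which is [t ^ d / 2] times two factors
   [N / (N + 1)] and [W / (W + 1)], as required by [weier_iter]. *)
pose e := t ^+ d / 2 / ((N + 1) * (W + 1)).
have e0 : 0 < e.
  rewrite divr_gt0 ?mulr_gt0 ?exprn_gt0 //; first by rewrite ltr_wpDl.
  by rewrite ltr_wpDl.
have [s1 [s10 s1P]] : exists s, 0 < s /\ forall s', 0 < s' <= s -> forall j : 'I_d, ser (fun _ : 'I_m => s') e (a j).
  apply: (common_radius (P := fun (j : 'I_d) s' => ser (fun _ : 'I_m => s') e (a j))) => j.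
  have [s [s0 _ sP]] := ser_small (r := r1) r10 (aP j) (a0 j (ltn_ord j)) e0.
  by exists s; split => // s' /andP[s'0 s's]; apply: sP; rewrite (ltW s'0).
pose s := Num.min s1 t.
have s0 : 0 < s by rewrite lt_min s10.
(* The radius stays [t] in the direction [l]; only the other directions shrink, to make the [a j],
   which vanish at 0, smaller than [e]. *)
pose r (i : 'I_m.+1) := if i == l then t else s.
have rl : r l = t by rewrite /r eqxx.
have rlift : r \o lift l = fun=> s by apply/funext => k; rewrite /r /= eq_sym (negbTE (neq_lift _ _)).
have r0 i : 0 <= r i by rewrite /r; case: ifP => _; exact: ltW.
have rt i : r i <= t by rewrite /r; case: ifP => _ //; rewrite ge_min lexx orbT.
have tr1 : t <= r1 by rewrite ge_min lexx.
have tr2 : t <= r2 by rewrite ge_min lexx orbT.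
pose S z := (G z)^-1 * \sum_(j <- enum 'I_d) a j (del l z) * z 0 l ^+ j.
have Ss : ser r (r l ^+ d / 2) S.
  apply: (@ser_weak _ _ r _ (N * \sum_(j <- enum 'I_d) e * t ^+ j)).
  - apply: ser_mul.
      by apply: ser_weak Is _ _ => // i; rewrite r0 /= (le_trans (rt i)).
    apply: ser_sum => // j; apply: ser_mul; last by rewrite -rl; apply: ser_exp; exact: ser_coord.
    apply: (@ser_comp _ m.+1 m r (fun=> s) e (a j) (@del m l)) => //.
      by apply: s1P; rewrite s0 ge_min lexx.
    move=> k; apply: (ser_eq (f := fun z => z 0 (lift l k))); last by move=> z _; rewrite delE.
    by have := ser_coord (lift l k) r0; rewrite {2}/r eq_sym (negbTE (neq_lift _ _)).
  - by move=> i; rewrite r0 lexx.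
  - rewrite big_enum /= -mulr_sumr -/W rl /e.
    have N1 : 0 < N + 1 by rewrite ltr_wpDl.
    have W1 : 0 < W + 1 by rewrite ltr_wpDl.
    have -> : N * (t ^+ d / 2 / ((N + 1) * (W + 1)) * W) = t ^+ d / 2 * (N / (N + 1) * (W / (W + 1))).
      by field; rewrite !gt_eqF.
    have hN : N / (N + 1) <= 1 by rewrite ler_pdivrMr // mul1r lerDl ler01.
    have hW : W / (W + 1) <= 1 by rewrite ler_pdivrMr // mul1r lerDl ler01.
    apply: ler_piMr; first by rewrite divr_ge0 // exprn_ge0 // ltW.
    by apply: mulr_ile1 => //; rewrite divr_ge0 // ltW.
have cs' : ser r K c by apply: ser_weak cs _ _ => // i; rewrite r0 (le_trans (rt i)).
have rl0 : 0 < r l by rewrite rl.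
have [Q [A [Qs As cE]]] := weier_iter rl0 Ss cs'.
have s_t : s <= t by rewrite ge_min lexx orbT.
have near_r (P : 'rV[C]_m.+1 -> Prop) : (forall z, polydisc r z -> P z) -> \forall z \near (0 : 'rV[C]_m.+1), P z.
  move=> h; apply/near0_poly; exists s; split => // z zs; apply: h => j.
  by apply: le_trans (zs j) _; rewrite /r; case: ifP.
have an_r (f1 : 'rV[C]_m.+1 -> C) M1 : ser r M1 f1 -> an f1 0.
  move=> h; exists s, M1; split => //; apply: (ser_eq (f := f1)); last by move=> z _; rewrite add0r.
  by apply: ser_weak h _ _ => // i; rewrite (ltW s0) /= /r; case: ifP.
exists (fun z => (G z)^-1 * Q z), A; split.
- by apply: an_mul; [exact: an_inv|exact: an_r Qs].
- move=> j; rewrite rlift in As; exists s, (2 * (K / r l ^+ j)); split => //.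
  by apply: (ser_eq (As j)) => z _; rewrite add0r.
- have nG := an_neq0 Ga G0; have nE := near_r _ cE; apply: filterS2 nG (near_and nE (near_r _ (fun z h => h))) => z Gz [-> zr].
  congr (_ + _); rewrite fE; last by move=> j; apply: le_trans (zr j) (le_trans (rt j) tr1).
  have -> : \sum_(j < d) a j (del l z) * z 0 l ^+ j = G z * S z.
    by rewrite /S mulrA mulfV // mul1r big_enum.
  by field.
Qed.

(** Divide [z l ^ d] by [f]. On the [l]-th axis, uniqueness forces the remainder to vanish and
    [u * q] to be 1 at 0. *)
Lemma weier_prep m (l : 'I_m.+1) d f : an f 0 -> regular l d f ->
  exists (q : 'rV[C]_m.+1 -> C) (A : nat -> 'rV[C]_m -> C), [/\ an q 0, q 0 != 0, forall j, an (A j) 0,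
    forall j, (j < d)%N -> A j 0 = 0 &
    \forall z \near (0 : 'rV[C]_m.+1), (z : 'rV[C]_m.+1) 0 l ^+ d = f z * q z + \sum_(j < d) A j (del l z) * z 0 l ^+ j].
Proof.
move=> fa fr; have ca : an (fun z : 'rV[C]_m.+1 => z 0 l ^+ d) 0 by apply: an_exp; exact: an_coord.
have [q [A [qa Aa E]]] := weier_div fa fr ca; exists q, A.
have [u [ua u0 uE]] := fr.
have [||h1 h2] := @poly_order_uniq d (fun j => A j 0) (fun t => 1 - u t * q (evec l (t 0 0))).
- by apply: an_sub; [exact: an_cst|apply: an_mul => //; exact: an_evec].
- apply: filterS2 uE (near_evec l E) => t e1 e2; rewrite e1 evecE eqxx del_evec in e2.
  apply: (addrI (t 0 0 ^+ d * u t * q (evec l (t 0 0)))); rewrite -e2; ring.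
split => //; apply: contra_neq (oner_neq0 C) => q0; move: h2.
by rewrite mxE /evec scale0r q0 mulr0 subr0.
Qed.

End Weierstrass.

(** * The implicit and inverse function theorems *)

Section InverseFunction.
Variable R : realType.
Local Notation C := (Cx R).

Lemma anv_setc m (l : 'I_m) p (F : 'rV[C]_p -> 'rV[C]_m) (g : 'rV[C]_p -> C) w :
  anv F w -> an g w -> anv (fun z => setc l (F z) (g z)) w.
Proof.
by move=> Fa ga j; under eq_fun do rewrite setcE; case: eqP => // _; exact: Fa.
Qed.

Lemma anv_comp m p q (F : 'rV[C]_p -> 'rV[C]_q) (G : 'rV[C]_m -> 'rV[C]_p) w :
  anv F (G w) -> anv G w -> anv (F \o G) w.
Proof. by move=> Fa Ga j; exact: (an_comp (f := fun z => F z 0 j) (Fa j) Ga). Qed.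

Lemma anv_mulmx m p q (F : 'rV[C]_m -> 'rV[C]_p) (B : 'M[C]_(p, q)) w :
  anv F w -> anv (fun z => F z *m B) w.
Proof.
move=> Fa j; under eq_fun do rewrite mxE.
by apply: an_sum => i _; apply: an_mul; [exact: Fa|exact: an_cst].
Qed.

(** The value of [f] becomes an additional variable [y0]: the germ [f z - y0] is regular of order 1
    in [z l], and preparation writes [z l] as a multiple of it plus a function of [y0] and the other
    coordinates. That function is the solution [g], whose argument carries the value [y0] in
    position [l]. *)
Lemma implicit_function m (l : 'I_m.+1) (f : 'rV[C]_m.+1 -> C) : an f 0 -> f 0 = 0 -> pderiv l f 0 != 0 ->
  exists g : 'rV[C]_m.+1 -> C, [/\ an g 0, g 0 = 0,
    \forall z \near (0 : 'rV[C]_m.+1), g (setc l z (f z)) = z 0 l &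
    \forall w \near (0 : 'rV[C]_m.+1), f (setc l w (g w)) = w 0 l].
Proof.
move=> fa f0 df.
pose l' := lift ord0 l.
pose F (y : 'rV[C]_m.+2) := f (del ord0 y) - y 0 ord0.
have Fa : an F 0.
  apply: an_sub; last exact: an_coord.
  by apply: an_del; rewrite del0.
have Fr : regular l' 1 F.
  have [G [Ga [G0 GE]]] := an_hadamard fa.
  exists (fun t => G l (evec l (t 0 0))); split; first exact: an_evec.
    by rewrite mxE /evec scale0r G0.
  apply: filterS (near_evec l GE) => t; rewrite add0r f0 add0r (bigD1 l) //= big1 ?addr0; last first.
    by move=> k /negbTE kl; rewrite evecE kl mul0r.
  rewrite evecE eqxx expr1 => <-; rewrite /F evecE (negbTE (neq_lift _ _)) subr0.
  congr f; apply/rowP => j; by rewrite delE !evecE (inj_eq lift_inj).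
have [q [A [qa q0 Aa A0 E]]] := weier_prep Fa Fr.
have {}E : \forall y \near (0 : 'rV[C]_m.+2), (y : 'rV[C]_m.+2) 0 l' = F y * q y + A 0%N (del l' y).
  by apply: filterS E => y; rewrite big_ord1 !expr1 expr0 mulr1.
(* The remainder [A 0] does not see the [l]-th coordinate of the original space, so that slot may be
   overwritten. *)
have del_setc w s c : del l' (ins ord0 (setc l w s) c) = del l' (ins ord0 w c).
  apply/rowP => k; rewrite !delE; case: (unliftP ord0 (lift l' k)) => [j ej|->]; last by rewrite !ins_l.
  rewrite ej !ins_lift setcE; case: eqP => // jl.
  by have := neq_lift l' k; rewrite ej jl eqxx.
pose Y (w : 'rV[C]_m.+1) := ins ord0 w (w 0 l).
have Ya : anv Y 0 by apply: anv_ins; [exact: anv_id|exact: an_coord].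
have Y0 : Y 0 = 0 by rewrite /Y mxE ins00.
pose g w := A 0%N (del l' (Y w)).
have ga : an g 0.
  apply: (an_comp (f := A 0%N) (F := fun w => del l' (Y w))); first by rewrite Y0 del0.
  by apply: (anv_comp (F := @del _ _ l') (G := Y)) => //; exact: anv_del.
have g0 : g 0 = 0 by rewrite /g Y0 del0 A0.
exists g; split => //.
  pose y z := ins ord0 z (f z).
  have ya : anv y 0 by apply: anv_ins; [exact: anv_id|].
  have y0 : y 0 = 0 by rewrite /y f0 ins00.
  rewrite -y0 in E; apply: filterS (anv_near_comp ya E) => z.
  rewrite /y ins_lift /F del_ins ins_l subrr mul0r add0r => ->.
  by rewrite /g /Y setcE eqxx del_setc.
pose y w := ins ord0 (setc l w (g w)) (w 0 l).
have ya : anv y 0.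
  by apply: anv_ins; [apply: anv_setc; [exact: anv_id|]|exact: an_coord].
have y0 : y 0 = 0.
  rewrite /y g0 mxE -[RHS](@ins00 R _ ord0); congr ins.
  by apply/rowP => j; rewrite setcE !mxE if_same.
have E' := near_and E (an_neq0 qa q0).
rewrite -y0 in E'; apply: filterS (anv_near_comp ya E') => w [].
rewrite /y ins_lift setcE eqxx del_setc -/(Y w) -/(g w) -[LHS]add0r => /addIr/esym/eqP h qn.
by move: h; rewrite mulf_eq0 (negbTE qn) orbF /F del_ins ins_l subr_eq0 => /eqP.
Qed.

(** Rows are indexed by variables and columns by components, the transpose of the usual matrix:
    tangent vectors are rows and act by multiplication from the left. *)
Definition jac m p (F : 'rV[C]_m -> 'rV[C]_p) w : 'M[C]_(m, p) :=
  \matrix_(i, j) pderiv i (fun z => F z 0 j) w.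

Lemma jacE m p (F : 'rV[C]_m -> 'rV[C]_p) w i j : jac F w i j = pderiv i (fun z => F z 0 j) w.
Proof. by rewrite mxE. Qed.

#[global] Opaque jac.

Lemma jac_comp m p q (F : 'rV[C]_p -> 'rV[C]_q) (G : 'rV[C]_m -> 'rV[C]_p) w :
  anv F (G w) -> anv G w -> jac (F \o G) w = jac G w *m jac F (G w).
Proof.
move=> Fa Ga; apply/matrixP => i j; rewrite jacE mxE.
rewrite (@pderiv_comp _ m p i (fun z => F z 0 j) G w) //; apply: eq_bigr => k _.
rewrite [X in _ = X * _]jacE [X in _ = _ * X]jacE; exact: mulrC.
Qed.

Lemma jac_id m w : jac (@id 'rV[C]_m) w = 1%:M.
Proof. by apply/matrixP => i j; rewrite jacE pderiv_coord mxE. Qed.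

Lemma jac_mulmx m p q (F : 'rV[C]_m -> 'rV[C]_p) (B : 'M[C]_(p, q)) w :
  anv F w -> jac (fun z => F z *m B) w = jac F w *m B.
Proof.
move=> Fa; apply/matrixP => i j; rewrite jacE [RHS]mxE.
have -> : (fun z => (F z *m B) 0 j) = fun z => \sum_k F z 0 k * B k j by apply/funext => z; rewrite mxE.
rewrite pderiv_sum; last by move=> k; apply: an_mul; [exact: Fa|exact: an_cst].
apply: eq_bigr => k _; rewrite pderiv_mul ?pderiv_cst ?mulr0 ?addr0 ?jacE //.
exact: an_cst.
Qed.

Definition local_inverse m (F G : 'rV[C]_m -> 'rV[C]_m) : Prop :=
  [/\ anv G 0, G 0 = 0, \forall z \near (0 : 'rV[C]_m), G (F z) = z &
   \forall w \near (0 : 'rV[C]_m), F (G w) = w].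

Lemma setc_setc m (l : 'I_m) (z : 'rV[C]_m) s t : setc l (setc l z s) t = setc l z t.
Proof. by apply/rowP => j; rewrite !setcE; case: eqP. Qed.
Lemma setc_id m (l : 'I_m) (z : 'rV[C]_m) : setc l z (z 0 l) = z.
Proof. by apply/rowP => j; rewrite !setcE; case: eqP => [->|]. Qed.

(* One coordinate of [F] is straightened at a time, by the scalar implicit
   function theorem. *)
Lemma inverse_function1 m (F : 'rV[C]_m -> 'rV[C]_m) : anv F 0 -> F 0 = 0 -> jac F 0 = 1%:M ->
  exists G, local_inverse F G.
Proof.
case: m F => [|m] F.
  move=> Fa F0 _; exists id; split=> //; first exact: anv_id.
    by apply: near_true => z; apply/rowP => -[].
  by apply: near_true => z; apply/rowP => -[].
move=> Fa F0 JF.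
(* The induction is on the number [k] of last coordinates in which [F] may still differ from the
   identity. *)
have H k : (k <= m.+1)%N -> forall F : 'rV[C]_m.+1 -> 'rV[C]_m.+1, anv F 0 -> F 0 = 0 -> jac F 0 = 1%:M ->
   (forall j : 'I_m.+1, (j < m.+1 - k)%N -> \forall z \near (0 : 'rV[C]_m.+1), F z 0 j = z 0 j) ->
   exists G, local_inverse F G.
  elim: k => [|k IH] km {Fa F0 JF}F Fa F0 JF FE.
    have FE' : \forall z \near (0 : 'rV[C]_m.+1), F z = z.
      have : \forall z \near (0 : 'rV[C]_m.+1), forall j, F z 0 j = z 0 j.
        by apply: near_all => j; apply: FE; rewrite subn0.
      by apply: filterS => z h; apply/rowP.
    by exists id; split => //; exact: anv_id.
  have ltk : (m.+1 - k.+1 < m.+1)%N by rewrite subSS ltnS leq_subr.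
  pose l := Ordinal ltk.
  have dF i j : pderiv i (fun z => F z 0 j) 0 = (i == j)%:R.
    by have := congr1 (fun M : 'M[C]_m.+1 => M i j) JF; rewrite jacE mxE.
  have [|||g [ga g0 gE1 gE2]] := @implicit_function m l (fun z => F z 0 l).
  - exact: Fa.
  - by rewrite F0 mxE.
  - by rewrite dF eqxx oner_neq0.
  (* [E] replaces the [l]-th coordinate by that of [F] and [E'] is its local inverse. [F \o E']
     agrees with the identity in one more coordinate, and its Jacobian matrix at 0 is still the
     identity. *)
  pose E z := setc l z (F z 0 l); pose E' w := setc l w (g w).
  have E'a : anv E' 0 by apply: anv_setc => //; exact: anv_id.
  have Ea : anv E 0 by apply: anv_setc => //; exact: anv_id.
  have E'0 : E' 0 = 0 by rewrite /E' g0; apply/rowP => j; rewrite setcE !mxE if_same.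
  have E0 : E 0 = 0 by rewrite /E F0; apply/rowP => j; rewrite setcE !mxE if_same.
  have FE'a : anv (F \o E') 0 by apply: anv_comp => //; rewrite E'0.
  have FE'E (j : 'I_m.+1) : (j <= l)%N -> \forall w \near (0 : 'rV[C]_m.+1), (F \o E') w 0 j = w 0 j.
    rewrite leq_eqVlt => /orP[/eqP/val_inj ->|jl]; first by [].
    have := FE j jl; rewrite -{1}E'0 => h; apply: filterS (anv_near_comp E'a h) => w /= ->.
    rewrite setcE; case: eqP => // jl'; by rewrite jl' ltnn in jl.
  have JE' : jac E' 0 = 1%:M.
    apply/matrixP => i j; rewrite jacE mxE; have [->|jl] := eqVneq j l; last first.
      have -> : (fun z => E' z 0 j) = (fun z : 'rV[C]_m.+1 => z 0 j).
        by apply/funext => z; rewrite setcE (negbTE jl).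
      exact: pderiv_coord.
    have h := FE'E l (leqnn _).
    have := pderiv_ext i (FE'a l) h; rewrite pderiv_coord => <-.
    rewrite (@pderiv_comp _ _ _ i (fun z => F z 0 l) E' 0) //; last by rewrite E'0.
    by rewrite E'0 (bigD1 l) //= dF eqxx mul1r big1 ?addr0 // => k' kl; rewrite dF (negbTE kl) mul0r.
  have [||||G [Ga G0 GE1 GE2]] := IH (ltnW km) (F \o E').
  - exact: FE'a.
  - by rewrite /= E'0.
  - by rewrite jac_comp // E'0 // JE' JF mul1mx.
  - move=> j jl; apply: FE'E; rewrite -ltnS.
    have e : (m.+1 - k.+1).+1 = (m.+1 - k)%N := subnSK km.
    by change (j < (m.+1 - k.+1).+1)%N; rewrite e.
  exists (E' \o G); split.
  - by apply: anv_comp => //; rewrite G0.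
  - by rewrite /= G0.
  - have h1 : \forall z \near (0 : 'rV[C]_m.+1), E' (E z) = z.
      by apply: filterS gE1 => z h; rewrite /E' h setc_setc setc_id.
    rewrite -E0 in GE1; apply: filterS2 h1 (anv_near_comp Ea GE1) => z h1 /=.
    by rewrite h1 => ->.
  - exact: GE2.
by apply: (H m.+1) => // j; rewrite subnn.
Qed.

Lemma inverse_function m (F : 'rV[C]_m -> 'rV[C]_m) : anv F 0 -> F 0 = 0 -> jac F 0 \in unitmx ->
  exists G, local_inverse F G.
Proof.
move=> Fa F0 JF; set B := invmx (jac F 0).
have [|||G [Ga G0 GE1 GE2]] := @inverse_function1 m (fun z => F z *m B).
- exact: anv_mulmx.
- by rewrite F0 mul0mx.
- by rewrite jac_mulmx // mulmxV.
have Ba : anv (fun y : 'rV[C]_m => y *m B) 0 by apply: anv_mulmx; exact: anv_id.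
exists (fun y => G (y *m B)); split.
- by apply: (anv_comp (F := G) (G := fun y => y *m B)) => //; rewrite mul0mx.
- by rewrite mul0mx.
- exact: GE1.
- have h0 : (0 : 'rV[C]_m) *m B = 0 by rewrite mul0mx.
  rewrite -h0 in GE2; apply: filterS (anv_near_comp Ba GE2) => w h.
  have h' : F (G (w *m B)) *m B = w *m B := h.
  by rewrite -[LHS](mulmxKV JF) -/B h' mulmxKV.
Qed.

End InverseFunction.

(** * Divisibility of germs and the Nullstellensatz *)

Section LocalDivision.
Variable R : realType.
Local Notation C := (Cx R).

Definition wpoly m d (A : nat -> 'rV[C]_m -> C) (z : 'rV[C]_m) : {poly C} := 'X^d - \poly_(j < d) A j z.

Lemma horner_wpoly m d (A : nat -> 'rV[C]_m -> C) z t : (wpoly d A z).[t] = t ^+ d - \sum_(j < d) A j z * t ^+ j.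
Proof. by rewrite /wpoly hornerD hornerN hornerXn horner_poly. Qed.

Lemma size_wpoly m d (A : nat -> 'rV[C]_m -> C) z : size (wpoly d A z) = d.+1.
Proof. by rewrite size_polyDl size_polyXn // size_polyN ltnS size_poly. Qed.

Lemma wpoly_neq0 m d (A : nat -> 'rV[C]_m -> C) z : wpoly d A z != 0.
Proof. by rewrite -size_poly_eq0 size_wpoly. Qed.

(** For [e <= 1], a root with [|x| >= e] would satisfy [|x| ^ j * e ^ d <= |x| ^ d] for all [j < d].
    Once the coefficients are at most [e ^ d / (d + 1)], the root equation then gives
    [|x| ^ d <= d / (d + 1) * |x| ^ d]. *)
Lemma wpoly_small_roots m d (A : nat -> 'rV[C]_m -> C) (e : R) :
  (forall j, (j < d)%N -> an (A j) 0) -> (forall j, (j < d)%N -> A j 0 = 0) -> 0 < e ->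
  \forall z \near (0 : 'rV[C]_m), forall x, root (wpoly d A z) x -> nm x < e.
Proof.
move=> Aa A0; wlog e1 : e / e <= 1 => [hw e0|e0].
  have m0 : 0 < Num.min e 1 by rewrite lt_min e0 ltr01.
  have m1 : Num.min e 1 <= 1 by rewrite ge_min lexx orbT.
  apply: filterS (hw _ m1 m0) => z h x /h; rewrite lt_min => /andP[] //.
have d0 : 0 < e ^+ d / d.+1%:R by rewrite divr_gt0 // exprn_gt0.
have : \forall z \near (0 : 'rV[C]_m), forall j : 'I_d, nm (A j z - A j 0) <= e ^+ d / d.+1%:R.
  by apply: near_all => j; apply: an_cont_nm => //; exact: Aa.
apply: filterS => z Az x; rewrite /root horner_wpoly subr_eq0 => /eqP xE.
rewrite ltNge; apply/negP => ex.
have x0 : 0 < nm x by apply: lt_le_trans ex.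
have ed0 : 0 < e ^+ d by rewrite exprn_gt0.
have xd0 : 0 < nm x ^+ d by rewrite exprn_gt0.
have xj (j : 'I_d) : nm x ^+ j * e ^+ d <= nm x ^+ d.
  have -> : nm x ^+ d = nm x ^+ j * nm x ^+ (d - j) by rewrite -exprD subnKC // ltnW.
  rewrite ler_pM2l ?exprn_gt0 //.
  apply: (@le_trans _ _ (e ^+ (d - j))).
    by apply: ler_wiXn2l; rewrite ?leq_subr // ltW.
  by apply: lerXn2r; rewrite ?nnegrE ?nm_ge0 // ltW.
have : nm x ^+ d * e ^+ d <= (e ^+ d * d%:R / d.+1%:R) * nm x ^+ d.
  have hx : nm x ^+ d <= \sum_(j < d) nm (A j z * x ^+ j) by rewrite -nmX xE ler_nm_sum.
  apply: (@le_trans _ _ ((\sum_(j < d) nm (A j z * x ^+ j)) * e ^+ d)); first by rewrite ler_pM2r.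
  rewrite mulr_suml; apply: (@le_trans _ _ (\sum_(j < d) e ^+ d / d.+1%:R * nm x ^+ d)).
    apply: ler_sum => j _; rewrite nmM nmX -mulrA; apply: ler_pM => //.
    - exact: nm_ge0.
    - by rewrite mulr_ge0 ?exprn_ge0 ?nm_ge0 // ltW.
    - by have := Az j; rewrite A0 // subr0.
  rewrite sumr_const card_ord -[X in X <= _]mulr_natr le_eqVlt; apply/orP; left; apply/eqP; ring.
rewrite [X in X <= _]mulrC ler_pM2r // ler_pdivlMr // ler_pM2l // ler_nat.
by rewrite ltnn.
Qed.

(** For fixed parameters [z], all roots of the Weierstrass polynomial lie in the disc where the
    bound holds, so it divides the polynomial with coefficients [B j z], whose degree is smaller. *)
Lemma weier_uniq m (l : 'I_m.+1) d (A B : nat -> 'rV[C]_m -> C) (M : R) :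
  (forall j, (j < d)%N -> an (A j) 0) -> (forall j, (j < d)%N -> A j 0 = 0) -> 0 <= M ->
  (\forall z \near (0 : 'rV[C]_m.+1), nm (\sum_(j < d) B j (del l z) * z 0 l ^+ j) <=
     M * nm (wpoly d A (del l z)).[z 0 l]) ->
  forall j, (j < d)%N -> zg (B j).
Proof.
move=> Aa A0 M0 /near0_poly [e [e0 h]] j jd.
have N := near_and (wpoly_small_roots Aa A0 e0) (iffRL (near0_poly (polydisc (fun=> e))) (ex_intro _ e (conj e0 (fun u h => h)))).
apply: filterS N => z [zroots ze].
have dv : (wpoly d A z %| \poly_(k < d) B k z)%R.
  apply: (dvdp_bounded (e := e) (M := M)) => //; first exact: wpoly_neq0.
  move=> t te; have := h (ins l z t); rewrite del_ins ins_l horner_poly; apply.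
  by move=> k; case: (unliftP l k) => [i ->|->]; rewrite ?ins_lift ?ins_l // ltW.
have p0 : \poly_(k < d) B k z = 0.
  apply: contraTeq dv => pn0; rewrite gtNdvdp // size_wpoly ltnS; exact: size_poly.
by have := congr1 (fun q : {poly C} => q`_j) p0; rewrite coef_poly jd coef0.
Qed.

Definition dvdan m (f g : 'rV[C]_m -> C) : Prop :=
  exists2 k, an k 0 & \forall z \near (0 : 'rV[C]_m), g z = f z * k z.

Lemma dvd_mulr m (f g k : 'rV[C]_m -> C) : an k 0 -> dvdan f g -> dvdan f (fun z => g z * k z).
Proof.
move=> ka [k1 k1a E]; exists (fun z => k1 z * k z); first exact: an_mul.
by apply: filterS E => z ->; rewrite mulrA.
Qed.

Lemma dvd_add m (f g k : 'rV[C]_m -> C) : dvdan f g -> dvdan f k -> dvdan f (fun z => g z + k z).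
Proof.
move=> [k1 k1a E1] [k2 k2a E2]; exists (fun z => k1 z + k2 z); first exact: an_add.
by apply: filterS2 E1 E2 => z -> ->; rewrite mulrDr.
Qed.

Lemma dvd_trans m (f g k : 'rV[C]_m -> C) : dvdan f g -> dvdan g k -> dvdan f k.
Proof.
move=> [k1 k1a E1] [k2 k2a E2]; exists (fun z => k1 z * k2 z); first exact: an_mul.
by apply: filterS2 E1 E2 => z -> ->; rewrite mulrA.
Qed.

Lemma dvd_refl m (f : 'rV[C]_m -> C) : dvdan f f.
Proof. by exists (fun=> 1); [exact: an_cst|apply: near_true => z; rewrite mulr1]. Qed.

Lemma dvd_ext m (f g k : 'rV[C]_m -> C) : dvdan f g -> (\forall z \near (0 : 'rV[C]_m), g z = k z) -> dvdan f k.
Proof. by move=> [k1 k1a E] E'; exists k1 => //; apply: filterS2 E E' => z -> ->. Qed.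

Lemma dvd_extl m (f g k : 'rV[C]_m -> C) : dvdan f g -> (\forall z \near (0 : 'rV[C]_m), f z = k z) -> dvdan k g.
Proof. by move=> [k1 k1a E] E'; exists k1 => //; apply: filterS2 E E' => z -> ->. Qed.

Lemma unit_dvd m (f g : 'rV[C]_m -> C) : an f 0 -> f 0 != 0 -> an g 0 -> dvdan f g.
Proof.
move=> fa f0 ga; exists (fun z => g z / f z); first by apply: an_mul => //; exact: an_inv.
by apply: filterS (an_neq0 fa f0) => z z0; rewrite mulrCA mulfV // mulr1.
Qed.

Lemma dvd_comp m p (F : 'rV[C]_m -> 'rV[C]_p) (f g : 'rV[C]_p -> C) : anv F 0 -> F 0 = 0 -> dvdan f g ->
  dvdan (f \o F) (g \o F).
Proof.
move=> Fa F0 [k ka E]; exists (k \o F); first by apply: an_comp => //; rewrite F0.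
by rewrite -F0 in E; exact: anv_near_comp Fa E.
Qed.

Lemma zg_comp m p (F : 'rV[C]_m -> 'rV[C]_p) (f : 'rV[C]_p -> C) : anv F 0 -> F 0 = 0 -> zg f -> zg (f \o F).
Proof. by move=> Fa F0; rewrite /zg -{1}F0 => E; exact: anv_near_comp Fa E. Qed.

(* The linear coordinate change that makes [v] the direction of the [l]-th axis. *)
Definition chdir m (l : 'I_m) (v z : 'rV[C]_m) : 'rV[C]_m := z + z 0 l *: (v - delta_mx 0 l).
Definition chdir_inv m (l : 'I_m) (v z : 'rV[C]_m) : 'rV[C]_m := z - (z 0 l / v 0 l) *: (v - delta_mx 0 l).

Lemma chdirK m (l : 'I_m) (v z : 'rV[C]_m) : v 0 l != 0 -> chdir l v (chdir_inv l v z) = z.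
Proof.
move=> v0; rewrite /chdir; have -> : (chdir_inv l v z) 0 l = z 0 l / v 0 l.
  by rewrite !mxE !eqxx /=; field.
by rewrite /chdir_inv subrK.
Qed.

Lemma anv_chdir m (l : 'I_m) (v w : 'rV[C]_m) : anv (chdir l v) w.
Proof.
move=> j; have -> : (fun z => chdir l v z 0 j) = fun z => z 0 j + z 0 l * (v - delta_mx 0 l) 0 j.
  by apply/funext => z; rewrite mxE [X in _ + X]mxE.
by apply: an_add; [exact: an_coord|apply: an_mul; [exact: an_coord|exact: an_cst]].
Qed.

Lemma anv_chdir_inv m (l : 'I_m) (v w : 'rV[C]_m) : anv (chdir_inv l v) w.
Proof.
move=> j; have -> : (fun z => chdir_inv l v z 0 j) = fun z => z 0 j - z 0 l / v 0 l * (v - delta_mx 0 l) 0 j.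
  by apply/funext => z; rewrite mxE [X in _ + X]mxE [X in _ + - X]mxE.
apply: an_sub; first exact: an_coord.
by apply: an_mul; [apply: an_mul; [exact: an_coord|exact: an_cst]|exact: an_cst].
Qed.

Lemma chdir0 m (l : 'I_m) (v : 'rV[C]_m) : chdir l v 0 = 0.
Proof. by rewrite /chdir mxE scale0r addr0. Qed.
Lemma chdir_inv0 m (l : 'I_m) (v : 'rV[C]_m) : chdir_inv l v 0 = 0.
Proof. by rewrite /chdir_inv mxE mul0r scale0r subr0. Qed.

Lemma chdir_evec m (l : 'I_m) (v : 'rV[C]_m) t : chdir l v (evec l t) = t *: v.
Proof. by rewrite /chdir evecE eqxx scalerBr /evec addrC subrK. Qed.

Lemma make_regular m (l : 'I_m.+1) (f : 'rV[C]_m.+1 -> C) : an f 0 -> ~ zg f ->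
  exists v : 'rV[C]_m.+1, v 0 l != 0 /\ exists d, regular l d (f \o chdir l v).
Proof.
move=> fa nf; have [v [v0 [d [u [ua u0 uE]]]]] := direction l fa nf.
exists v; split => //; exists d, u; split => //.
by apply: filterS uE => t /= <-; rewrite chdir_evec.
Qed.

Lemma an_chdir m (l : 'I_m) v (f : 'rV[C]_m -> C) : an f 0 -> an (f \o chdir l v) 0.
Proof. by move=> fa; apply: an_comp; [rewrite chdir0|exact: anv_chdir]. Qed.

Lemma weier_data m (l : 'I_m.+1) d f : an f 0 -> regular l d f ->
  exists (q : 'rV[C]_m.+1 -> C) A, [/\ an q 0, q 0 != 0, forall j, an (A j) 0,
    forall j, (j < d)%N -> A j 0 = 0 &
    \forall z \near (0 : 'rV[C]_m.+1), (wpoly d A (del l z)).[z 0 l] = f z * q z].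
Proof.
move=> fa fr; have [q [A [qa q0 Aa A0 E]]] := weier_prep fa fr; exists q, A; split => //.
by apply: filterS E => z; rewrite horner_wpoly => ->; rewrite addrK.
Qed.

(** A bounded quotient of germs is analytic. After Weierstrass division of [a] by [q], the remainder
    is bounded by a multiple of the Weierstrass polynomial of [q], and [weier_uniq] makes it
    vanish. *)
Lemma bounded_dvd m (q a : 'rV[C]_m -> C) (M : R) : an q 0 -> ~ zg q -> an a 0 -> 0 <= M ->
  (\forall z \near (0 : 'rV[C]_m), nm (a z) <= M * nm (q z)) -> dvdan q a.
Proof.
case: m q a => [|m] q a qa nq aa M0 h.
  apply: unit_dvd => //; apply: contra_not_neq nq => q0; apply: near_true => z.
  by rewrite -q0; congr q; apply/rowP => -[].
have [v [v0 [d fr]]] := make_regular ord0 qa nq.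
set f := q \o chdir ord0 v in fr.
have fa : an f 0 by exact: an_chdir.
have ca : an (a \o chdir ord0 v) 0 by exact: an_chdir.
have [k [A [ka k0 Aa A0 kE]]] := weier_data fa fr.
have [b [B [ba Ba E]]] := weier_div fa fr ca.
have hL : \forall z \near (0 : 'rV[C]_m.+1), nm (a (chdir ord0 v z)) <= M * nm (f z).
  by rewrite -(chdir0 ord0 v) in h; exact: (anv_near_comp (@anv_chdir _ ord0 v 0) h).
(* The remainder [a - f b] is at most [(M + |b|) |f|], and [f] is the Weierstrass polynomial times
   the inverse of the unit [k]. *)
pose N := (M + (nm (b 0) + 1)) * (nm ((k 0)^-1) + 1).
have N0 : 0 <= N by rewrite mulr_ge0 ?addr_ge0 ?nm_ge0.
have Bz : forall j, (j < d)%N -> zg (B j).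
  apply: (weier_uniq (l := ord0) (A := A) (M := N)) => //.
  have c1 := an_cont_nm ba ltr01; have c2 := an_cont_nm (an_inv ka k0) ltr01.
  apply: filterS3 (near_and E kE) (near_and hL c1) (near_and c2 (an_neq0 ka k0)) => z [Ez kz] [hz b1] [k1 kn].
  have -> : \sum_(j < d) B j (del ord0 z) * z 0 ord0 ^+ j = a (chdir ord0 v z) - f z * b z.
    by rewrite -[a _]/((a \o chdir ord0 v) z) Ez addrC addKr.
  rewrite kz /N; have wE : nm (f z) = nm (f z * k z) * nm (k z)^-1 by rewrite -nmM mulfK.
  have e1 : nm (a (chdir ord0 v z) - f z * b z) <= (M + nm (b z)) * nm (f z).
    apply: le_trans (ler_nmD _ _) _; rewrite nmN mulrDl; apply: lerD => //.
    by rewrite nmM mulrC.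
  apply: le_trans e1 _; rewrite wE mulrCA.
  rewrite [leRHS]mulrC; apply: ler_wpM2l; first exact: nm_ge0.
  have b2 : nm (b z) <= nm (b 0) + 1.
    have := ler_nmD (b 0) (b z - b 0); rewrite addrC subrK; lra.
  have k2 : nm (k z)^-1 <= nm (k 0)^-1 + 1.
    have := ler_nmD (k 0)^-1 ((k z)^-1 - (k 0)^-1); rewrite addrC subrK; lra.
  by apply: ler_pM; rewrite ?addr_ge0 ?nm_ge0 // lerD2l.
have dv : dvdan f (a \o chdir ord0 v).
  exists b => //.
  have Bz' : \forall z \near (0 : 'rV[C]_m), forall j : 'I_d, B j z = 0 by apply: near_all => j; exact: Bz.
  rewrite -(del0 R ord0) in Bz'.
  apply: filterS2 E (anv_near_comp (@anv_del _ _ ord0 0) Bz') => z -> Bz0.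
  by rewrite big1 ?addr0 // => j _; rewrite Bz0 mul0r.
have := dvd_comp (@anv_chdir_inv _ ord0 v 0) (chdir_inv0 _ _) dv.
move=> /dvd_ext h1; have /dvd_extl h2 : dvdan (f \o chdir_inv ord0 v) a.
  by apply: h1; apply: near_true => z /=; rewrite chdirK.
by apply: h2; apply: near_true => z /=; rewrite /f /= chdirK.
Qed.

End LocalDivision.

(** * The integral domain of germs *)

Section GermType.
Variables (R : realType) (m : nat).
Local Notation C := (Cx R).

Definition germ_class (f : 'rV[C]_m -> C) : set ('rV[C]_m -> C) :=
  [set g | \forall z \near (0 : 'rV[C]_m), f z = g z].

(** A germ is its class of functions, so that equality is plain equality and the germs form an
    integral domain, over which polynomial gcds and pseudo-division are available. *)
Definition germ := {A : set ('rV[C]_m -> C) | exists f, an f 0 /\ A = germ_class f}.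

HB.instance Definition _ := gen_eqMixin germ.
HB.instance Definition _ := gen_choiceMixin germ.

Definition rep (a : germ) : 'rV[C]_m -> C := sval (cid (svalP a)).

Lemma rep_an a : an (rep a) 0.
Proof. by rewrite /rep; case: cid => f []. Qed.

Lemma rep_class (a : germ) : sval a = germ_class (rep a).
Proof. by rewrite /rep; case: cid => f []. Qed.

Definition mkg f (fa : an f 0) : germ := exist _ (germ_class f) (ex_intro _ f (conj fa erefl)).

Lemma repK f (fa : an f 0) : \forall z \near (0 : 'rV[C]_m), rep (mkg fa) z = f z.
Proof.
have : germ_class (rep (mkg fa)) f by rewrite -rep_class /=; apply: near_true.
by [].
Qed.

Lemma germ_ext (a b : germ) : (\forall z \near (0 : 'rV[C]_m), rep a z = rep b z) -> a = b.
Proof.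
move=> h; have e : sval a = sval b.
  rewrite !rep_class; apply/seteqP; split=> f /= hf; first by apply: filterS2 h hf => z <-.
  by apply: filterS2 h hf => z ->.
case: a b e {h} => [A pA] [B pB] /= e; subst B; congr exist; exact: Prop_irrelevance.
Qed.

Definition g0 : germ := mkg (an_cst 0 0).
Definition g1 : germ := mkg (an_cst 1 0).
Definition gadd (a b : germ) : germ := mkg (an_add (rep_an a) (rep_an b)).
Definition gopp (a : germ) : germ := mkg (an_opp (rep_an a)).
Definition gmul (a b : germ) : germ := mkg (an_mul (rep_an a) (rep_an b)).

Lemma gaddA : associative gadd.
Proof.
move=> a b c; apply: germ_ext.
apply: filterS2 (near_and (repK (an_add (rep_an a) (rep_an (gadd b c)))) (repK (an_add (rep_an b) (rep_an c))))
  (near_and (repK (an_add (rep_an (gadd a b)) (rep_an c))) (repK (an_add (rep_an a) (rep_an b)))) => z [-> ->] [-> ->].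
by rewrite addrA.
Qed.
Lemma gaddC : commutative gadd.
Proof.
move=> a b; apply: germ_ext.
apply: filterS2 (repK (an_add (rep_an a) (rep_an b))) (repK (an_add (rep_an b) (rep_an a))) => z -> ->.
by rewrite addrC.
Qed.
Lemma gadd0 : left_id g0 gadd.
Proof.
move=> a; apply: germ_ext.
apply: filterS2 (repK (an_add (rep_an g0) (rep_an a))) (repK (an_cst 0 0)) => z -> ->.
by rewrite add0r.
Qed.
Lemma gaddN : left_inverse g0 gopp gadd.
Proof.
move=> a; apply: germ_ext.
apply: filterS3 (repK (an_add (rep_an (gopp a)) (rep_an a))) (repK (an_opp (rep_an a))) (repK (an_cst 0 0)) => z -> -> ->.
by rewrite addNr.
Qed.

HB.instance Definition _ := GRing.isZmodule.Build germ gaddA gaddC gadd0 gaddN.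

Lemma gmulA : associative gmul.
Proof.
move=> a b c; apply: germ_ext.
apply: filterS2 (near_and (repK (an_mul (rep_an a) (rep_an (gmul b c)))) (repK (an_mul (rep_an b) (rep_an c))))
  (near_and (repK (an_mul (rep_an (gmul a b)) (rep_an c))) (repK (an_mul (rep_an a) (rep_an b)))) => z [-> ->] [-> ->].
by rewrite mulrA.
Qed.
Lemma gmulC : commutative gmul.
Proof.
move=> a b; apply: germ_ext.
apply: filterS2 (repK (an_mul (rep_an a) (rep_an b))) (repK (an_mul (rep_an b) (rep_an a))) => z -> ->.
by rewrite mulrC.
Qed.
Lemma gmul1 : left_id g1 gmul.
Proof.
move=> a; apply: germ_ext.
apply: filterS2 (repK (an_mul (rep_an g1) (rep_an a))) (repK (an_cst 1 0)) => z -> ->.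
by rewrite mul1r.
Qed.
Lemma gmulD : left_distributive gmul gadd.
Proof.
move=> a b c; apply: germ_ext.
apply: filterS3 (near_and (repK (an_mul (rep_an (gadd a b)) (rep_an c))) (repK (an_add (rep_an a) (rep_an b))))
  (repK (an_add (rep_an (gmul a c)) (rep_an (gmul b c))))
  (near_and (repK (an_mul (rep_an a) (rep_an c))) (repK (an_mul (rep_an b) (rep_an c)))) => z [-> ->] -> [-> ->].
by rewrite mulrDl.
Qed.
Lemma g1_neq0 : g1 != g0 :> germ.
Proof.
apply/eqP => e; have := repK (an_cst 1 0); rewrite -/g1 e => /near_pt.
have /near_pt -> := repK (an_cst (0 : C) (0 : 'rV[C]_m)); move/eqP; by rewrite eq_sym oner_eq0.
Qed.

HB.instance Definition _ := GRing.Zmodule_isComNzRing.Build germ gmulA gmulC gmul1 gmulD g1_neq0.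

Lemma rep0 : \forall z \near (0 : 'rV[C]_m), rep (0 : germ) z = 0.
Proof. exact: repK. Qed.
Lemma rep1 : \forall z \near (0 : 'rV[C]_m), rep (1 : germ) z = 1.
Proof. exact: repK. Qed.
Lemma repD (a b : germ) : \forall z \near (0 : 'rV[C]_m), rep (a + b) z = rep a z + rep b z.
Proof. exact: repK. Qed.
Lemma repM (a b : germ) : \forall z \near (0 : 'rV[C]_m), rep (a * b) z = rep a z * rep b z.
Proof. exact: repK. Qed.
Lemma repN (a : germ) : \forall z \near (0 : 'rV[C]_m), rep (- a) z = - rep a z.
Proof. exact: repK. Qed.

Definition gunit : pred germ := fun a => rep a 0 != 0.
Definition ginv (a : germ) : germ :=
  if pselect (rep a 0 != 0) is left h then mkg (an_inv (rep_an a) h) else a.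

Lemma gmulV : {in gunit, left_inverse 1 ginv *%R}.
Proof.
move=> a a0; rewrite /ginv; case: pselect => [h|//]; apply: germ_ext.
have n0 := an_neq0 (rep_an a) h.
apply: filterS2 (near_and (repM (mkg (an_inv (rep_an a) h)) a) (repK (an_inv (rep_an a) h))) (near_and rep1 n0) => z [-> ->] [-> n].
by rewrite mulVf.
Qed.
Lemma gunitP (a b : germ) : b * a = 1 -> a \in gunit.
Proof.
move=> e; have := near_pt (repM b a); rewrite e (near_pt rep1) => h.
by rewrite unfold_in; apply: contra_eqT h => /negPn/eqP ->; rewrite mulr0 oner_neq0.
Qed.
Lemma ginv_out : {in [predC gunit], ginv =1 id}.
Proof. by move=> a; rewrite inE /ginv; case: pselect => // h /negP; case. Qed.

HB.instance Definition _ := GRing.ComNzRing_hasMulInverse.Build germ gmulV gunitP ginv_out.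

Lemma germ_idom (a b : germ) : a * b = 0 -> (a == 0) || (b == 0).
Proof.
move=> e; have : zg (fun z => rep a z * rep b z).
  by have := repM a b; rewrite e => h; apply: filterS2 h rep0 => z <-.
case/(an_idom (rep_an a) (rep_an b)) => h; apply/orP; [left|right]; apply/eqP/germ_ext;
  by apply: filterS2 h rep0 => z -> ->.
Qed.

HB.instance Definition _ := GRing.ComUnitRing_isIntegral.Build germ germ_idom.

Lemma germ_eq0 (a : germ) : (a = 0) <-> zg (rep a).
Proof.
split=> [->|h]; first exact: rep0.
by apply: germ_ext; apply: filterS2 h rep0 => z -> ->.
Qed.

Lemma rep_sum (I : Type) (s : seq I) (F : I -> germ) :
  \forall z \near (0 : 'rV[C]_m), rep (\sum_(i <- s) F i) z = \sum_(i <- s) rep (F i) z.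
Proof.
elim: s => [|i s IH].
  by rewrite big_nil; apply: filterS rep0 => z ->; rewrite big_nil.
by rewrite big_cons; apply: filterS2 IH (repD (F i) (\sum_(i <- s) F i)) => z e ->; rewrite big_cons e.
Qed.

(** Coefficients are evaluated through chosen representatives, hence identities between polynomials
    over germs hold after evaluation only for [z] near 0. *)
Definition evp (z : 'rV[C]_m) (p : {poly germ}) : {poly C} := \poly_(i < size p) rep p`_i z.

Lemma coef_evp p : \forall z \near (0 : 'rV[C]_m), forall i, (evp z p)`_i = rep p`_i z.
Proof.
apply: filterS rep0 => z h i; rewrite coef_poly; case: ltnP => // ip.
by rewrite nth_default // h.
Qed.

Lemma evp_ext (p : {poly germ}) N (F : 'rV[C]_m -> {poly C}) : (size p <= N)%N -> (forall z, (size (F z) <= N)%N) ->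
  (forall i, (i < N)%N -> \forall z \near (0 : 'rV[C]_m), rep p`_i z = (F z)`_i) ->
  \forall z \near (0 : 'rV[C]_m), evp z p = F z.
Proof.
move=> sp sF h; have : \forall z \near (0 : 'rV[C]_m), forall i : 'I_N, rep p`_i z = (F z)`_i.
  by apply: near_all => i; exact: h.
move=> h2; apply: filterS2 (coef_evp p) h2 => z e1 e2; apply/polyP => i.
have [iN|iN] := ltnP i N; first by rewrite e1 (e2 (Ordinal iN)).
by rewrite [RHS]nth_default ?(leq_trans (sF z)) // nth_default // (leq_trans (size_poly _ _)) // (leq_trans sp).
Qed.

Lemma evpM p q : \forall z \near (0 : 'rV[C]_m), evp z (p * q) = evp z p * evp z q.
Proof.
have sz (z : 'rV[C]_m) r : (size (evp z r) <= size r)%N by exact: size_poly.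
apply: (evp_ext (N := (size p + size q)%N)).
- by apply: leq_trans (size_polyMleq _ _) _; exact: leq_pred.
- by move=> z; apply: leq_trans (size_polyMleq _ _) _; apply: leq_trans (leq_pred _) _; exact: leq_add.
move=> i _; rewrite coefM.
have h : \forall z \near (0 : 'rV[C]_m), forall j : 'I_i.+1, rep (p`_j * q`_(i - j)) z = rep p`_j z * rep q`_(i - j) z.
  by apply: near_all => j; exact: repM.
apply: filterS3 (near_and (coef_evp p) (coef_evp q)) h (rep_sum (index_enum 'I_i.+1) (fun j => p`_j * q`_(i - j))) => z [e1 e2] h' ->.
by rewrite coefM; apply: eq_bigr => j _; rewrite h' e1 e2.
Qed.

Lemma evpD p q : \forall z \near (0 : 'rV[C]_m), evp z (p + q) = evp z p + evp z q.
Proof.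
apply: (evp_ext (N := maxn (size p) (size q))).
- exact: size_polyD.
- move=> z; apply: leq_trans (size_polyD _ _) _.
  by rewrite geq_max !leq_max /evp !size_poly orbT.
move=> i _; rewrite coefD; apply: filterS2 (near_and (coef_evp p) (coef_evp q)) (repD p`_i q`_i) => z [e1 e2] ->.
by rewrite coefD e1 e2.
Qed.

Lemma evpC a : \forall z \near (0 : 'rV[C]_m), evp z a%:P = (rep a z)%:P.
Proof.
apply: (evp_ext (N := 1)) => [|z|]; rewrite ?size_polyC_leq1 //.
by case=> // _; rewrite coefC; apply: near_true => z; rewrite coefC.
Qed.

Lemma evpZ a p : \forall z \near (0 : 'rV[C]_m), evp z (a *: p) = rep a z *: evp z p.
Proof.
have := evpM a%:P p; rewrite mul_polyC => h.
by apply: filterS2 h (evpC a) => z -> ->; rewrite mul_polyC.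
Qed.

Lemma evp_deriv p : \forall z \near (0 : 'rV[C]_m), evp z p^`() = (evp z p)^`().
Proof.
apply: (evp_ext (N := size p)).
- by rewrite (leq_trans (size_poly _ _)) // leq_pred.
- by move=> z; apply: leq_trans (size_poly _ _) _; apply: leq_trans (leq_pred _) _; exact: size_poly.
move=> i _; rewrite coef_deriv; have hn n (a : germ) : \forall z \near (0 : 'rV[C]_m), rep (a *+ n) z = rep a z *+ n.
  elim: n => [|n IH]; first exact: rep0.
  by rewrite mulrS; apply: filterS2 IH (repD a (a *+ n)) => z e ->; rewrite e mulrS.
by apply: filterS2 (hn i.+1 p`_i.+1) (coef_evp p) => z -> e; rewrite coef_deriv e.
Qed.

Lemma evp_monic p : p \is monic -> \forall z \near (0 : 'rV[C]_m), evp z p \is monic /\ size (evp z p) = size p.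
Proof.
move=> pm; have s0 : (0 < size p)%N by rewrite size_poly_gt0 monic_neq0.
apply: filterS2 (coef_evp p) rep1 => z e1 e2.
have lc : (evp z p)`_(size p).-1 = 1 by rewrite e1 -lead_coefE (eqP pm) e2.
have sE : size (evp z p) = size p.
  apply/eqP; rewrite eqn_leq size_poly /= leqNgt; apply/negP => lt; move/eqP: lc.
  by rewrite nth_default ?(eq_sym 0) ?oner_eq0 // -ltnS prednK.
by split => //; apply/monicP; rewrite lead_coefE sE.
Qed.

Lemma evp_poly d (A : nat -> 'rV[C]_m -> C) (Aa : forall j, an (A j) 0) :
  \forall z \near (0 : 'rV[C]_m), evp z (\poly_(j < d) mkg (Aa j)) = \poly_(j < d) A j z.
Proof.
apply: (evp_ext (N := d)) => [|z|i id]; rewrite ?size_poly //.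
by rewrite coef_poly id; apply: filterS (repK (Aa i)) => z ->; rewrite coef_poly id.
Qed.

Lemma evpXn d : \forall z \near (0 : 'rV[C]_m), evp z 'X^d = 'X^d.
Proof.
apply: (evp_ext (N := d.+1)) => [|z|i id]; rewrite ?size_polyXn //.
by rewrite coefXn; case: eqP => e; [apply: filterS rep1|apply: filterS rep0] => z ->; rewrite coefXn; case: eqP.
Qed.

End GermType.

(** * Gcds of Weierstrass polynomials and Euclid's lemma *)

Section Divisibility.
Variable R : realType.
Local Notation C := (Cx R).

Lemma near_del m (l : 'I_m.+1) (P : 'rV[C]_m -> Prop) : (\forall z \near (0 : 'rV[C]_m), P z) ->
  \forall z \near (0 : 'rV[C]_m.+1), P (del l z).
Proof. by rewrite -{1}(del0 R l) => h; exact: (anv_near_comp (@anv_del _ _ l 0) h). Qed.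

Lemma an_bounded m (f : 'rV[C]_m -> C) : an f 0 -> exists2 M, 0 <= M & \forall z \near (0 : 'rV[C]_m), nm (f z) <= M.
Proof.
move=> fa; exists (nm (f 0) + 1); first by rewrite addr_ge0 ?nm_ge0.
apply: filterS (an_cont_nm fa ltr01) => z h.
have := ler_nmD (f 0) (f z - f 0); rewrite addrC subrK; lra.
Qed.

(** Weierstrass polynomials, described by roots that tend to 0 with [z] and not by coefficients
    vanishing at 0: in this form a monic factor inherits the property at once. *)
Definition wei m (P : {poly germ R m}) : Prop := P \is monic /\
  forall e : R, 0 < e -> \forall z \near (0 : 'rV[C]_m), forall x, root (evp z P) x -> nm x < e.

Lemma wei_factor m (P Q A : {poly germ R m}) : wei P -> P = Q * A -> Q \is monic -> wei Q.
Proof.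
move=> [Pm Pr] PE Qm; split => // e e0; have := evpM Q A; rewrite -PE => h.
apply: filterS2 h (Pr e e0) => z h1 h2 x Qx; apply: h2; by rewrite h1 rootM Qx.
Qed.

Lemma wei_root0 m (Q : {poly germ R m}) : wei Q -> (1 < size Q)%N -> rep Q`_0 0 = 0.
Proof.
move=> [Qm Qr] sQ; have [m0 s0] := near_pt (evp_monic Qm).
have /closed_rootP [x Qx] : size (evp 0 Q) != 1%N by rewrite s0 gtn_eqF.
have x0 : x = 0.
  apply/eqP; rewrite -nm_eq0 eq_le nm_ge0 andbT leNgt; apply/negP => xp.
  by have := near_pt (Qr _ xp) x Qx; rewrite ltxx.
by rewrite -(near_pt (coef_evp Q)) -horner_coef0; apply/eqP; move: Qx; rewrite x0.
Qed.

Lemma coef_prod_XsubC_bound (rs : seq C) i : (forall x, x \in rs -> nm x <= 1) ->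
  nm (\prod_(x <- rs) ('X - x%:P))`_i <= 2 ^+ size rs.
Proof.
elim: rs i => [|x rs IH] i xr.
  by rewrite big_nil coef1; case: eqP; rewrite ?nm1 ?nm0 ?expr0.
rewrite big_cons mulrBl coefB mul_polyC coefZ coefXM; set q := \prod_(_ <- _) _.
have IH' j : nm q`_j <= 2 ^+ size rs by apply: IH => y ys; apply: xr; rewrite inE ys orbT.
apply: le_trans (ler_nmD _ _) _; rewrite nmN /= exprS mulrDl mul1r; apply: lerD.
  by case: eqP => _; rewrite ?nm0 ?exprn_ge0.
rewrite nmM; apply: le_trans (_ : 1 * nm q`_i <= _); last by rewrite mul1r.
by rewrite ler_wpM2r ?nm_ge0 // xr // mem_head.
Qed.

Lemma dvd_germ m (a b : germ R m) : dvdan (rep a) (rep b) -> exists c, b = a * c.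
Proof.
move=> [k ka E]; exists (mkg ka); apply: germ_ext.
by apply: filterS3 E (repM a (mkg ka)) (repK ka) => z -> -> ->.
Qed.

(* The monic gcd of [P] and [H] over the field of fractions has analytic
   coefficients: they are bounded, being symmetric functions of roots of [P]. *)
Lemma gcd_dichotomy m (P H : {poly germ R m}) : wei P ->
  (exists r U V, r != 0 /\ r%:P = U * P + V * H) \/
  (exists Q A B, [/\ Q \is monic, (1 < size Q)%N, P = Q * A & H = Q * B]).
Proof.
move=> [Pm Pr]; have P0 := monic_neq0 Pm; pose G := gcdp P H.
have G0 : G != 0 by rewrite Pdiv.Idomain.gcdp_eq0 negb_and P0.
have /Pdiv.Idomain.eqpP [[c1 c2] /= /andP[c10 c20] cE] := Pdiv.Idomain.egcdpE P H.
rewrite -/G in cE; set U := (egcdp P H).1 in cE; set V := (egcdp P H).2 in cE.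
(* If the gcd is a constant, the extended Euclidean algorithm gives the relation for [r],
   denominators being cleared by [c1] and [c2]. *)
have [s1|s1] := boolP (size G == 1%N).
  left; have /size_poly1P [g gn0 gE] := s1.
  exists (c1 * g), (c2 *: U), (c2 *: V); split; first by rewrite mulf_neq0.
  by rewrite -!scalerAl -scalerDr -cE gE -mul_polyC polyCM.
right; have sG : (1 < size G)%N by rewrite ltn_neqAle eq_sym s1 /= size_poly_gt0.
set e := (size G).-1; have se : size G = e.+1 by rewrite prednK // size_poly_gt0.
set lc := lead_coef G; have lc0 : lc != 0 by rewrite lead_coef_eq0.
have GP : (G %| P)%R := Pdiv.Idomain.dvdp_gcdl P H.
have GH : (G %| H)%R := Pdiv.Idomain.dvdp_gcdr P H.
have /Pdiv.Idomain.dvdpP [[c A0] /= cn0 cA] := GP.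
have nlc : ~ zg (rep (lc * c)) by move/germ_eq0/eqP; rewrite mulf_eq0 (negbTE lc0) (negbTE cn0).
(* Where [lc * c] is nonzero, [evp z G] has full degree [e], and its roots are roots of [P], of
   modulus below 1; so its coefficients are at most [2 ^ e |lc|]. Density removes the restriction on
   [z]. *)
have bd i : \forall z \near (0 : 'rV[C]_m), nm (rep G`_i z) <= 2 ^+ e * nm (rep lc z).
  apply: (zg_dense_le (rep_an (lc * c)) nlc (rep_an _) (rep_an _)); first by rewrite exprn_ge0.
  have E1 := evpZ c P; have E2 := evpM A0 G; rewrite cA in E1.
  apply: filterS3 (near_and E1 E2) (near_and (repM lc c) (coef_evp G)) (Pr 1 ltr01) => z [e1 e2] [e3 e4] e5.
  rewrite e3 mulf_eq0 negb_or => /andP[lz cz].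
  have sGz : size (evp z G) = size G.
    apply/eqP; rewrite eqn_leq size_poly /= se; apply: contraR lz; rewrite -leqNgt => h.
    by rewrite /lc lead_coefE -e4 nth_default.
  have lGz : lead_coef (evp z G) = rep lc z by rewrite lead_coefE sGz e4.
  have [rs rsE] := closed_field_poly_normal (evp z G).
  have srs : size rs = e.
    have : size (evp z G) = (size rs).+1.
      by rewrite rsE size_scale ?size_prod_XsubC // lGz.
    by rewrite sGz se => -[].
  have rs1 x : x \in rs -> nm x <= 1.
    move=> xrs; apply/ltW/e5; have : root (evp z G) x.
      by rewrite rsE rootZ ?root_prod_XsubC // lGz.
    move=> Gx; have : root (rep c z *: evp z P) x by rewrite -e1 e2 rootM Gx orbT.
    by rewrite rootZ.
  rewrite -e4 rsE lGz coefZ nmM mulrC -srs ler_wpM2r ?nm_ge0 //.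
  exact: coef_prod_XsubC_bound.
have nl : ~ zg (rep lc) by move/germ_eq0/eqP; rewrite (negbTE lc0).
have /choice [b bE] : forall i, exists b, G`_i = lc * b.
  have p2 : 0 <= (2 : R) ^+ e by rewrite exprn_ge0.
  move=> i; apply: dvd_germ; exact: (bounded_dvd (rep_an lc) nl (rep_an _) p2 (bd i)).
pose Q := \poly_(i < e.+1) b i.
have GQ : G = lc *: Q.
  apply/polyP => i; rewrite coefZ coef_poly; case: ltnP => // ie.
  by rewrite mulr0 nth_default // se.
have be : b e = 1.
  by apply: (mulfI lc0); rewrite -bE mulr1 /lc lead_coefE.
have sQ : size Q = e.+1 by apply: size_poly_eq; rewrite be oner_eq0.
have Qm : Q \is monic by apply/monicP; rewrite lead_coefE sQ coef_poly ltnSn.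
have QP : (Q %| P)%R by rewrite -(Pdiv.Idomain.dvdpZl _ _ lc0) -GQ.
have QH : (Q %| H)%R by rewrite -(Pdiv.Idomain.dvdpZl _ _ lc0) -GQ.
have /(Pdiv.IdomainMonic.dvdpP Qm) [A PA] := QP.
have /(Pdiv.IdomainMonic.dvdpP Qm) [B HB] := QH.
by exists Q, A, B; split => //; rewrite ?sQ -?se // mulrC.
Qed.

Definition evf m (l : 'I_m.+1) (p : {poly germ R m}) (z : 'rV[C]_m.+1) : C := (evp (del l z) p).[z 0 l].

Lemma an_evf m (l : 'I_m.+1) p : an (evf l p) 0.
Proof.
rewrite /evf; under eq_fun do rewrite horner_poly.
apply: an_sum => i _; apply: an_mul; last by apply: an_exp; exact: an_coord.
by apply: an_del; rewrite del0; exact: rep_an.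
Qed.

Lemma evf0 m (l : 'I_m.+1) p : evf l p 0 = rep p`_0 0.
Proof. by rewrite /evf del0 mxE horner_coef0 (near_pt (coef_evp p)). Qed.

Lemma evfM m (l : 'I_m.+1) p q : \forall z \near (0 : 'rV[C]_m.+1), evf l (p * q) z = evf l p z * evf l q z.
Proof. by apply: filterS (near_del l (evpM p q)) => z e; rewrite /evf e hornerM. Qed.

Lemma evfD m (l : 'I_m.+1) p q : \forall z \near (0 : 'rV[C]_m.+1), evf l (p + q) z = evf l p z + evf l q z.
Proof. by apply: filterS (near_del l (evpD p q)) => z e; rewrite /evf e hornerD. Qed.

Lemma evfC m (l : 'I_m.+1) a : \forall z \near (0 : 'rV[C]_m.+1), evf l a%:P z = rep a (del l z).
Proof. by apply: filterS (near_del l (evpC a)) => z e; rewrite /evf e hornerC. Qed.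

Lemma evf_poly m (l : 'I_m.+1) d (A : nat -> 'rV[C]_m -> C) (Aa : forall j, an (A j) 0) :
  \forall z \near (0 : 'rV[C]_m.+1), evf l (\poly_(j < d) mkg (Aa j)) z = \sum_(j < d) A j (del l z) * z 0 l ^+ j.
Proof. by apply: filterS (near_del l (evp_poly d Aa)) => z e; rewrite /evf e horner_poly. Qed.

Definition wgerm m d (A : nat -> 'rV[C]_m -> C) (Aa : forall j, an (A j) 0) : {poly germ R m} :=
  'X^d - \poly_(j < d) mkg (Aa j).

Lemma evp_wgerm m d (A : nat -> 'rV[C]_m -> C) (Aa : forall j, an (A j) 0) :
  \forall z \near (0 : 'rV[C]_m), evp z (wgerm d Aa) = wpoly d A z.
Proof.
apply: filterS3 (evpD 'X^d (- \poly_(j < d) mkg (Aa j))) (evpXn R m d)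
  (near_and (evpZ (-1) (\poly_(j < d) mkg (Aa j))) (near_and (evp_poly d Aa) (near_and (repN (1 : germ R m)) (rep1 R m)))) => z e1 e2 [e3 [e4 [e5 e6]]].
by rewrite /wgerm e1 e2 -scaleN1r e3 e4 e5 e6 scaleN1r.
Qed.

Lemma wei_wgerm m d (A : nat -> 'rV[C]_m -> C) (Aa : forall j, an (A j) 0) :
  (forall j, (j < d)%N -> A j 0 = 0) -> wei (wgerm d Aa).
Proof.
move=> A0; split.
  by rewrite /wgerm monicE lead_coefDl ?lead_coefXn // size_polyN size_polyXn ltnS size_poly.
move=> e e0; apply: filterS2 (evp_wgerm d Aa) (wpoly_small_roots (fun j _ => Aa j) A0 e0) => z ->.
by [].
Qed.

Definition coprime_germs m (g h : 'rV[C]_m -> C) : Prop :=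
  forall a, an a 0 -> dvdan a g -> dvdan a h -> a 0 != 0.
Definition squarefree_germ m (g : 'rV[C]_m -> C) : Prop :=
  forall a, an a 0 -> dvdan (fun z => a z * a z) g -> a 0 != 0.

Lemma dvd_evf m (l : 'I_m.+1) d g k (A : nat -> 'rV[C]_m -> C) (Aa : forall j, an (A j) 0) Q B :
  an k 0 -> k 0 != 0 ->
  (\forall z \near (0 : 'rV[C]_m.+1), (wpoly d A (del l z)).[z 0 l] = g z * k z) ->
  wgerm d Aa = Q * B -> dvdan (evf l Q) g.
Proof.
move=> ka k0 kE PE; exists (fun z => evf l B z * (k z)^-1); first by apply: an_mul; [exact: an_evf|exact: an_inv].
have := evfM l Q B; rewrite -PE => e.
apply: filterS3 (near_and e (near_del l (evp_wgerm d Aa))) kE (an_neq0 ka k0) => z [e1 e2] e3 kz.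
by rewrite mulrA -e1 /evf e2 e3 mulfK.
Qed.

(** Let [P] be the Weierstrass polynomial of [g] and [H] the remainder of [h] modulo [g]. A common
    factor of [P] and [H] would divide [g] and [h] and vanish at 0. Otherwise some [r <> 0], free of
    [z l], lies in [(P, H)], and [g] divides [r * w]. *)
Lemma euclid_regular m (l : 'I_m.+1) d (g h w c : 'rV[C]_m.+1 -> C) : an g 0 -> an h 0 -> an w 0 -> an c 0 ->
  regular l d g -> coprime_germs g h -> (\forall z \near (0 : 'rV[C]_m.+1), h z * w z = g z * c z) -> dvdan g w.
Proof.
move=> ga ha wa ca gr cop hw.
have [k [A [ka k0 Aa A0 kE]]] := weier_data ga gr.
have [b [B [ba Ba hE]]] := weier_div ga gr ha.
have [q [B' [qa B'a wE]]] := weier_div ga gr wa.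
pose P := wgerm d Aa; pose H := \poly_(j < d) mkg (Ba j).
have [[r [U [V [r0 rE]]]]|[Q [X [Y [Qm sQ PQ HQ]]]]] := gcd_dichotomy H (wei_wgerm Aa A0); last first.
  have dg : dvdan (evf l Q) g := dvd_evf ka k0 kE PQ.
  have : dvdan (evf l Q) h.
    apply: (dvd_ext (dvd_add (dvd_mulr ba dg) (dvd_mulr (an_evf l Y) (dvd_refl (evf l Q))))).
    have := evfM l Q Y; rewrite -HQ => e.
    by apply: filterS3 e (evf_poly l d Ba) hE => z <- -> ->.
  move=> dh; have := cop _ (an_evf l Q) dg dh.
  by rewrite evf0 (wei_root0 (wei_factor (wei_wgerm Aa A0) PQ Qm) sQ) eqxx.
pose s z := evf l U z * k z * w z - evf l V z * b z * w z + evf l V z * c z.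
have Ua := an_evf l U; have Va := an_evf l V.
have sa : an s 0 by apply: an_add; [apply: an_sub|]; do ?apply: an_mul.
pose r' z := rep r (del l z).
have ra : an r' 0 by apply: an_del; rewrite del0; exact: rep_an.
have rw : \forall z \near (0 : 'rV[C]_m.+1), r' z * w z = g z * s z.
  have E1 := evfC l r; rewrite rE in E1.
  have E2 := near_and (evfD l (U * P) (V * H)) (near_and (evfM l U P) (evfM l V H)).
  apply: filterS3 (near_and E1 E2) (near_and (near_del l (evp_wgerm d Aa)) (evf_poly l d Ba)) (near_and kE (near_and hE hw)) => z [e1 [e2 [e3 e4]]] [e5 e6] [e7 [e8 e9]].
  have eP : evf l P z = g z * k z by rewrite /evf e5 e7.
  rewrite /r' -e1 e2 e3 e4 e6 eP /s.
  have -> : \sum_(j < d) B j (del l z) * z 0 l ^+ j = h z - g z * b z by rewrite e8 addrC addKr.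
  transitivity (evf l U z * (g z * k z) * w z + evf l V z * (h z * w z) - evf l V z * g z * b z * w z); first by ring.
  by rewrite e9; ring.
have [M M0 Mb] := an_bounded (an_mul (an_sub sa (an_mul ra qa)) (an_inv ka k0)).
(* As [r] does not involve [z l], the products [r * B' j] are the remainder of [r * w], which is a
   multiple of [g]; they vanish, and so do the [B' j]. *)
have B'0 j : (j < d)%N -> zg (B' j).
  move=> jd; have : zg (fun z => rep r z * B' j z).
    apply: (weier_uniq (l := l) (A := A) (B := fun j z => rep r z * B' j z) _ A0 M0 _ jd) => //.
    apply: filterS3 (near_and rw wE) (near_and kE (an_neq0 ka k0)) Mb => z [e1 e2] [e3 kz] e4.
    have -> : \sum_(j0 < d) rep r (del l z) * B' j0 (del l z) * z 0 l ^+ j0 = g z * (s z - r' z * q z).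
      transitivity (r' z * (w z - g z * q z)).
        by rewrite e2 addrC addKr mulr_sumr; apply: eq_bigr => i _; rewrite mulrA.
      by rewrite mulrBr e1; ring.
    rewrite e3; have -> : g z * (s z - r' z * q z) = (s z - r' z * q z) * (k z)^-1 * (g z * k z) by field.
    by rewrite nmM ler_wpM2r ?nm_ge0.
  by case/(an_idom (rep_an r) (B'a j)) => // /germ_eq0/eqP; rewrite (negbTE r0).
exists q => //.
have : \forall z \near (0 : 'rV[C]_m), forall j : 'I_d, B' j z = 0 by apply: near_all => j; exact: B'0.
move/(near_del l) => h0; apply: filterS2 wE h0 => z -> h0.
by rewrite big1 ?addr0 // => j _; rewrite h0 mul0r.
Qed.

Lemma dvd_chdir m (l : 'I_m) (v : 'rV[C]_m) (f g : 'rV[C]_m -> C) : v 0 l != 0 ->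
  dvdan (f \o chdir l v) (g \o chdir l v) -> dvdan f g.
Proof.
move=> v0 dv; have h := dvd_comp (@anv_chdir_inv _ _ l v 0) (chdir_inv0 _ _) dv.
have e (k : 'rV[C]_m -> C) : \forall z \near (0 : 'rV[C]_m), ((k \o chdir l v) \o chdir_inv l v) z = k z.
  by apply: near_true => z /=; rewrite chdirK.
exact: dvd_extl (dvd_ext h (e g)) (e f).
Qed.

Lemma dvd_chdirr m (l : 'I_m) (v : 'rV[C]_m) (a g : 'rV[C]_m -> C) : v 0 l != 0 ->
  dvdan a (g \o chdir l v) -> dvdan (a \o chdir_inv l v) g.
Proof.
move=> v0 dv; have h := dvd_comp (@anv_chdir_inv _ _ l v 0) (chdir_inv0 _ _) dv.
by apply: (dvd_ext h); apply: near_true => z /=; rewrite chdirK.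
Qed.

Lemma near_chdir m (l : 'I_m) (v : 'rV[C]_m) (P : 'rV[C]_m -> Prop) : (\forall z \near (0 : 'rV[C]_m), P z) ->
  \forall z \near (0 : 'rV[C]_m), P (chdir l v z).
Proof. by rewrite -{1}(chdir0 l v) => h; exact: (anv_near_comp (@anv_chdir _ _ l v 0) h). Qed.

Lemma zg0 (g : 'rV[C]_0 -> C) : ~ zg g -> g 0 != 0.
Proof.
apply: contra_not_neq => g0; apply: near_true => z; rewrite -g0; congr g; by apply/rowP => -[].
Qed.

Lemma euclid m (g h w c : 'rV[C]_m -> C) : an g 0 -> an h 0 -> an w 0 -> an c 0 ->
  ~ zg g -> coprime_germs g h -> (\forall z \near (0 : 'rV[C]_m), h z * w z = g z * c z) -> dvdan g w.
Proof.
case: m g h w c => [|m] g h w c ga ha wa ca ng cop hw; first by apply: unit_dvd => //; exact: zg0.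
have [v [v0 [d gr]]] := make_regular ord0 ga ng.
apply: (dvd_chdir v0); apply: (euclid_regular (l := ord0) (d := d) (h := h \o chdir ord0 v) (c := c \o chdir ord0 v)) => //; try exact: an_chdir.
  move=> a aa ag ah; have := cop (a \o chdir_inv ord0 v); rewrite /= chdir_inv0; apply.
  - by apply: an_comp; [rewrite chdir_inv0|exact: anv_chdir_inv].
  - exact: dvd_chdirr.
  - exact: dvd_chdirr.
exact: near_chdir hw.
Qed.

End Divisibility.

(** * The Nullstellensatz for square-free germs *)

Section Nullstellensatz.
Variable R : realType.
Local Notation C := (Cx R).

Lemma germ_natr_neq0 m n : (n.+1%:R : germ R m) != 0.
Proof.
apply/eqP => e; have h k : \forall z \near (0 : 'rV[C]_m), rep (k%:R : germ R m) z = k%:R.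
  elim: k => [|k IH]; first exact: rep0.
  by rewrite mulrS; apply: filterS3 IH (rep1 R m) (repD 1 (k%:R : germ R m)) => z e1 e2 ->; rewrite e1 e2 mulrS.
have := near_pt (h n.+1); rewrite e (near_pt (rep0 R m)) => /eqP.
by rewrite eq_sym pnatr_eq0.
Qed.

Lemma square_factor m (P Q A B : {poly germ R m}) : wei P -> Q \is monic -> (1 < size Q)%N ->
  P = Q * A -> P^`() = Q * B ->
  exists Q1 X, [/\ wei Q1, (1 < size Q1)%N & P = Q1 * Q1 * X].
Proof.
move=> Pw Qm sQ PE dE; have Qw := wei_factor Pw PE Qm.
have [[r [U [V [r0 rE]]]]|[Q1 [X [Y [Q1m sQ1 QE AE]]]]] := gcd_dichotomy A Qw; last first.
  exists Q1, (X * Y); split => //; first exact: wei_factor Qw QE Q1m.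
  by rewrite PE QE AE; ring.
have dQ : r *: Q^`() = Q * (U * Q^`() + V * (B - A^`())).
  rewrite -mul_polyC rE; have : Q^`() * A = Q * (B - A^`()).
    by rewrite mulrBr -dE PE derivM; ring.
  move=> e; transitivity (Q * (U * Q^`()) + V * (Q^`() * A)); first by ring.
  by rewrite e; ring.
have s1 : (size (r *: Q^`()) < size Q)%N.
  rewrite size_scale //; apply: leq_ltn_trans (size_poly _ _) _.
  by rewrite prednK // ltnW.
have z0 : r *: Q^`() = 0.
  apply/eqP; apply: contraTT s1; rewrite dQ mulf_eq0 negb_or => /andP[_ n0].
  by rewrite -leqNgt size_monicM // -subn1 -addnBA ?leq_addr // size_poly_gt0.
move/eqP: z0; rewrite -mul_polyC mulf_eq0 polyC_eq0 (negbTE r0) /= => /eqP dz.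
have := congr1 (fun p : {poly germ R m} => p`_(size Q).-2) dz.
rewrite coef0 coef_deriv; have -> : (size Q).-2.+1 = (size Q).-1 by case: (size Q) sQ => [|[|]].
rewrite -lead_coefE (eqP Qm) => /eqP.
case: (size Q) sQ => [|[|n]] // _; by rewrite (negbTE (germ_natr_neq0 m n)).
Qed.

(** Square-freeness puts a discriminant [r <> 0] into [(P, P')]. Where [r] is nonzero, [P] has [d]
    distinct roots, all zeros of [g] and hence of [f]. The remainder of [f] modulo [g], of degree
    below [d], vanishes at all of them, so it is zero there and by density everywhere. *)
Lemma nullstellensatz_regular m (l : 'I_m.+1) d (g f : 'rV[C]_m.+1 -> C) : an g 0 -> an f 0 ->
  regular l d g -> squarefree_germ g -> (\forall z \near (0 : 'rV[C]_m.+1), g z = 0 -> f z = 0) -> dvdan g f.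
Proof.
move=> ga fa gr sqf gf.
have [k [A [ka k0 Aa A0 kE]]] := weier_data ga gr.
have [b [B [ba Ba fE]]] := weier_div ga gr fa.
pose P := wgerm d Aa; have Pw : wei P := wei_wgerm Aa A0.
have [[r [U [V [r0 rE]]]]|[Q [X [Y [Qm sQ PQ HQ]]]]] := gcd_dichotomy P^`() Pw; last first.
  have [Q1 [Z [Q1w sQ1 PE]]] := square_factor Pw Qm sQ PQ HQ.
  have := sqf (evf l Q1) (an_evf l Q1).
  rewrite evf0 (wei_root0 Q1w sQ1) eqxx => h; suff : false by []; apply: h.
  exact: dvd_extl (dvd_evf ka k0 kE PE) (evfM l Q1 Q1).
have Bz : \forall z \near (0 : 'rV[C]_m), rep r z != 0 -> forall j : 'I_d, B j z = 0.
  have /near0_poly [e [e0 eP]] := near_and (near_and gf kE) (near_and fE (an_neq0 ka k0)).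
  have N1 : \forall z \near (0 : 'rV[C]_m), polydisc (fun=> e) z by apply/near0_poly; exists e.
  have E1 := evpD (U * P) (V * P^`()); rewrite -rE in E1.
  apply: filterS3 (near_and N1 (near_and (wpoly_small_roots (fun j _ => Aa j) A0 e0) (evpC r)))
     (near_and E1 (near_and (evpM U P) (evpM V P^`()))) (near_and (evp_deriv P) (evp_wgerm d Aa)) =>
     z [ze [zr er]] [e1 [e2 e3]] [e4 e5] rz j.
  rewrite er e2 e3 e4 -/P in e1; rewrite -/P in e5; rewrite e5 in e1.
  have cop : coprimep (wpoly d A z) (wpoly d A z)^`().
    apply/Bezout_coprimepP; exists (evp z U, evp z V) => /=.
    by rewrite -e1 -[(_)%:P]mulr1 mul_polyC; apply: eqp_scale.
  have [rs rsE] := closed_field_poly_normal (wpoly d A z).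
  have lc1 : lead_coef (wpoly d A z) = 1.
    by rewrite lead_coefDl ?lead_coefXn // size_polyN size_polyXn ltnS size_poly.
  rewrite lc1 scale1r in rsE.
  have srs : size rs = d.
    by have := size_wpoly d A z; rewrite rsE size_prod_XsubC => -[].
  have urs : uniq rs by rewrite -separable_prod_XsubC -rsE unlock.
  have p0 : \poly_(i < d) B i z = 0.
    apply: contraTeq (leqnn d) => pn0; rewrite -ltnNge -{1}srs.
    apply: leq_trans (size_poly d (fun i => B i z)); apply: max_poly_roots => //.
    apply/allP => t trs; rewrite /root horner_poly.
    have wt : root (wpoly d A z) t by rewrite rsE root_prod_XsubC.
    have [|[g1 g2] [g3 g4]] := eP (ins l z t).
      move=> i; case: (unliftP l i) => [i' ->|->]; rewrite ?ins_lift ?ins_l //.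
      by apply/ltW/zr.
    rewrite del_ins ins_l in g2 g3.
    have gz : g (ins l z t) = 0.
      by move/eqP: wt; rewrite g2 => /eqP; rewrite mulf_eq0 (negbTE g4) orbF => /eqP.
    by move: g3; rewrite g1 // gz mul0r add0r => <-.
  by have := congr1 (fun q : {poly C} => q`_j) p0; rewrite coef_poly ltn_ord coef0.
have nr : ~ zg (rep r) by move/germ_eq0/eqP; rewrite (negbTE r0).
have B0 : \forall z \near (0 : 'rV[C]_m), forall j : 'I_d, B j z = 0.
  apply: near_all => j; apply: (zg_dense (rep_an r) nr (Ba j)).
  by apply: filterS Bz => z h rz; exact: h.
exists b => //; apply: filterS2 fE (near_del l B0) => z -> h.
by rewrite big1 ?addr0 // => j _; rewrite h mul0r.
Qed.

Lemma squarefree_nz m (g : 'rV[C]_m -> C) : squarefree_germ g -> ~ zg g.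
Proof.
move=> sqf gz; have := sqf (fun=> 0) (an_cst 0 0); rewrite eqxx => h; suff : false by []; apply: h.
exists (fun=> 0); first exact: an_cst.
by apply: filterS gz => z ->; rewrite mulr0.
Qed.

Lemma nullstellensatz m (g f : 'rV[C]_m -> C) : an g 0 -> an f 0 -> squarefree_germ g ->
  (\forall z \near (0 : 'rV[C]_m), g z = 0 -> f z = 0) -> dvdan g f.
Proof.
case: m g f => [|m] g f ga fa sqf gf; have ng := squarefree_nz sqf.
  by apply: unit_dvd => //; exact: zg0.
have [v [v0 [d gr]]] := make_regular ord0 ga ng.
apply: (dvd_chdir v0); apply: (nullstellensatz_regular (l := ord0) (d := d)) => //; try exact: an_chdir.
  move=> a aa ag; have := sqf (a \o chdir_inv ord0 v); rewrite /= chdir_inv0; apply.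
    by apply: an_comp; [rewrite chdir_inv0|exact: anv_chdir_inv].
  exact: dvd_chdirr v0 ag.
exact: (near_chdir ord0 v gf).
Qed.

Lemma dvd_antisym m (f g : 'rV[C]_m -> C) : an f 0 -> ~ zg f -> dvdan f g -> dvdan g f ->
  exists u, [/\ an u 0, u 0 != 0 & \forall z \near (0 : 'rV[C]_m), g z = f z * u z].
Proof.
move=> fa nf [u ua uE] [v va vE]; exists u; split => //.
have : zg (fun z => f z * (1 - u z * v z)).
  by apply: filterS2 uE vE => z e1 e2; rewrite mulrBr mulr1 mulrA -e1 -e2 subrr.
have ha : an (fun z => 1 - u z * v z) 0 by apply: an_sub; [exact: an_cst|exact: an_mul].
case/(an_idom fa ha) => // /near_pt h; apply: contra_eq_neq h => ->.
by rewrite mul0r subr0 oner_neq0.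
Qed.

(* By the Nullstellensatz [g], [h] and hence their product divide [f]. *)
Lemma squarefree_mul m (g h f : 'rV[C]_m -> C) : an g 0 -> an h 0 -> an f 0 ->
  squarefree_germ g -> squarefree_germ h -> coprime_germs g h -> squarefree_germ f ->
  (\forall z \near (0 : 'rV[C]_m), f z = 0 <-> g z * h z = 0) -> squarefree_germ (fun z => g z * h z).
Proof.
move=> ga ha fa gs hs cop fs E.
have dg : dvdan g f by apply: nullstellensatz => //; apply: filterS E => z [_ e] gz; apply: e; rewrite gz mul0r.
have dh : dvdan h f by apply: nullstellensatz => //; apply: filterS E => z [_ e] hz; apply: e; rewrite hz mulr0.
have [k ka kE] := dg; have [c ca cE] := dh.
have cop' : coprime_germs h g by move=> a aa h1 h2; exact: cop.
have [q qa qE] : dvdan h k.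
  apply: (euclid (g := h) (h := g) (c := c)) => //; first exact: squarefree_nz.
  by apply: filterS2 kE cE => z <- <-.
move=> a aa adv; apply: fs => //; apply: dvd_ext (dvd_mulr qa adv) _.
by apply: filterS2 kE qE => z -> ->; rewrite mulrA.
Qed.

Lemma anv_scale_vec m (v : 'rV[C]_m) w : anv (fun t : 'rV[C]_1 => t 0 0 *: v) w.
Proof.
move=> j; have -> : (fun t : 'rV[C]_1 => (t 0 0 *: v) 0 j) = fun t => t 0 0 * v 0 j.
  by apply/funext => t; rewrite mxE.
by apply: an_mul; [exact: an_coord|exact: an_cst].
Qed.

Lemma regular_of_line m (l : 'I_m.+1) (v : 'rV[C]_m.+1) (h : 'rV[C]_m.+1 -> C) : an h 0 ->
  ~ zg (fun t : 'rV[C]_1 => h (t 0 0 *: v)) -> exists d, regular l d (h \o chdir l v).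
Proof.
move=> ha nz; have la : an (fun t : 'rV[C]_1 => h (t 0 0 *: v)) 0.
  by apply: (an_comp (f := h) (F := fun t : 'rV[C]_1 => t 0 0 *: v)); [rewrite mxE scale0r|exact: anv_scale_vec].
have [r [M [r0 ls]]] := an_ser0 la.
have [h0|[d [u [us u0 uE]]]] := one_var_order r0 ls.
  case: nz; apply/near0_poly; exists (r / 2); split; first by rewrite divr_gt0.
  move=> t tr; apply: h0; apply: le_lt_trans (tr 0) _; rewrite ltr_pdivrMr // ltr_pMr // ltr1n //.
exists d, u; split => //.
  by exists r, (M / r ^+ d); split => //; apply: (ser_eq us) => z _; rewrite add0r.
apply/near0_poly; exists r; split => // t tr; by rewrite /= chdir_evec uE.
Qed.

Lemma regular_nz m (l : 'I_m.+1) d (f : 'rV[C]_m.+1 -> C) : regular l d f -> ~ zg f.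
Proof.
move=> [u [ua u0 uE]] fz; have : zg (fun t : 'rV[C]_1 => t 0 0 ^+ d * u t).
  by apply: filterS2 uE (near_evec l fz) => t <-.
by move/(an_idom_exp ua) => /near_pt uz; rewrite uz eqxx in u0.
Qed.

(* The [F i] do not vary along the direction [v], along which [h] is not
   identically zero: the remainders of the [c i] modulo [h] combine to zero. *)
Lemma cancel_transverse m N (l : 'I_m) (v : 'rV[C]_m) (F c : 'I_N -> 'rV[C]_m -> C) (h b : 'rV[C]_m -> C) :
  v 0 l != 0 -> (forall i, an (F i) 0) -> (forall i, an (c i) 0) -> an h 0 -> an b 0 ->
  (forall i z t, F i (z + t *: v) = F i z) -> ~ zg (fun t : 'rV[C]_1 => h (t 0 0 *: v)) ->
  (\forall z \near (0 : 'rV[C]_m), b z * h z = \sum_i F i z * c i z) ->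
  exists q : 'I_N -> 'rV[C]_m -> C, (forall i, an (q i) 0) /\
    \forall z \near (0 : 'rV[C]_m), b z = \sum_i F i z * q i z.
Proof.
case: m l v F c h b => [[]//|m] l v F c h b v0 Fa ca ha ba Fv nz E.
have [d fr] := regular_of_line l ha nz; set f := h \o chdir l v in fr.
have fa : an f 0 by exact: an_chdir.
have [k [A [ka k0 Aa A0 kE]]] := weier_data fa fr.
have La (g : 'rV[C]_m.+1 -> C) : an g 0 -> an (g \o chdir l v) 0 by exact: an_chdir.
have /choice [qB qBP] : forall i, exists qB : ('rV[C]_m.+1 -> C) * (nat -> 'rV[C]_m -> C),
   [/\ an qB.1 0, forall j, an (qB.2 j) 0 &
    \forall z \near (0 : 'rV[C]_m.+1), c i (chdir l v z) = f z * qB.1 z + \sum_(j < d) qB.2 j (del l z) * z 0 l ^+ j].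
  by move=> i; have [q [B [qa Ba qE]]] := weier_div fa fr (La _ (ca i)); exists (q, B).
pose q i := (qB i).1; pose B i := (qB i).2.
have qa i : an (q i) 0 by case: (qBP i).
have Ba i j : an (B i j) 0 by case: (qBP i) => _ h' _; exact: h'.
have cE : \forall z \near (0 : 'rV[C]_m.+1), forall i, c i (chdir l v z) = f z * q i z + \sum_(j < d) B i j (del l z) * z 0 l ^+ j.
  by apply: near_all => i; case: (qBP i).
(* The change [chdir] turns [v] into the [l]-th axis, so in the new coordinates [F i] depends on the
   other variables only. *)
pose F0 i z := F i (ins l z 0).
have FE i z : F i (chdir l v z) = F0 i (del l z).
  rewrite /F0 -setc_ins -(Fv i (setc l z 0) (z 0 l)); congr (F i _); apply/rowP => j.
  have l1 : (chdir l v z) 0 j = z 0 j + z 0 l * (v 0 j - (j == l)%:R) by rewrite !mxE.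
  have l2 : (setc l z 0 + z 0 l *: v) 0 j = (if j == l then 0 else z 0 j) + z 0 l * v 0 j by rewrite !mxE.
  by rewrite l1 l2; case: eqP => [->|_] /=; ring.
have F0a i : an (F0 i) 0.
  apply: (an_comp (f := F i) (F := fun z => ins l z 0)); first by rewrite ins00.
  by apply: anv_ins; [exact: anv_id|exact: an_cst].
pose s z := b (chdir l v z) - \sum_i F i (chdir l v z) * q i z.
have sa : an s 0.
  apply: an_sub; first exact: La.
  by apply: an_sum => i _; apply: an_mul => //; exact: (La (F i)).
pose B' j z := \sum_i F0 i z * B i j z.
have B'a j : an (B' j) 0 by apply: an_sum => i _; apply: an_mul.
(* Once the quotients of the [c i] are moved to the left, [f * s] equals a polynomial in [z l] of
   degree below [d]: a multiple of [f] that is its own remainder, hence zero. *)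
have sE : \forall z \near (0 : 'rV[C]_m.+1), f z * s z = \sum_(j < d) B' j (del l z) * z 0 l ^+ j.
  apply: filterS2 (near_chdir l v E) cE => z e1 e2.
  rewrite /s mulrBr [f z * b _]mulrC [X in X - _]e1.
  have -> : f z * (\sum_i F i (chdir l v z) * q i z) = \sum_i F i (chdir l v z) * (f z * q i z).
    by rewrite mulr_sumr; apply: eq_bigr => i _; ring.
  rewrite -sumrB /B'.
  transitivity (\sum_i \sum_(j < d) F0 i (del l z) * B i j (del l z) * z 0 l ^+ j).
    apply: eq_bigr => i _; rewrite e2 -mulrBr addrC addKr FE mulr_sumr.
    by apply: eq_bigr => j _; rewrite mulrA.
  by rewrite exchange_big; apply: eq_bigr => j _; rewrite mulr_suml.
have [M M0 Mb] := an_bounded (an_mul sa (an_inv ka k0)).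
have B'0 j : (j < d)%N -> zg (B' j).
  apply: (weier_uniq (l := l) (A := A) (B := B') _ A0 M0) => [i _|]; first exact: Aa.
  apply: filterS3 sE (near_and kE (an_neq0 ka k0)) Mb => z <- [-> kz] h1.
  have -> : f z * s z = s z * (k z)^-1 * (f z * k z) by field.
  by rewrite nmM ler_wpM2r ?nm_ge0.
have fs0 : zg (fun z => f z * s z).
  have : \forall z \near (0 : 'rV[C]_m), forall j : 'I_d, B' j z = 0 by apply: near_all => j; exact: B'0.
  move/(near_del l) => h0; apply: filterS2 sE h0 => z -> h1.
  by rewrite big1 // => j _; rewrite h1 mul0r.
have s0 : zg s by case: (an_idom fa sa fs0) => // /(regular_nz fr).
exists (fun i => q i \o chdir_inv l v); split.
  by move=> i; apply: an_comp; [rewrite chdir_inv0|exact: anv_chdir_inv].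
have := zg_comp (@anv_chdir_inv _ _ l v 0) (chdir_inv0 _ _) s0.
apply: filterS => z; rewrite /= /s chdirK // => /eqP; rewrite subr_eq0 => /eqP ->.
by [].
Qed.

End Nullstellensatz.

(** The falling factorial of [2k] of length [k] is at least [k ^ k]; it equals [k!] times the
    central binomial coefficient, a term of [(1 + 1) ^ (2k) = 4 ^ k]. *)
Lemma expn_le_fact k : (k ^ k <= 4 ^ k * k`!)%N.
Proof.
have h1 : (k ^ k <= (2 * k) ^_ k)%N.
  rewrite ffact_prod -[X in (_ ^ X <= _)%N]card_ord -prod_nat_const; apply: leq_prod => i _.
  by rewrite mul2n -addnn -addnBA ?leq_addr // ltnW.
apply: leq_trans h1 _; rewrite -bin_ffact leq_mul2r; apply/orP; right.
have -> : (4 ^ k = (1 + 1) ^ (2 * k))%N by rewrite expnM.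
rewrite expnDn (bigD1 (inord k)) //= !exp1n !muln1 inordK ?leq_addr //.
Qed.

(** * Logarithmic vector fields *)

Section LinearCauchyKovalevskaya.
Variable R : realType.
Local Notation C := (Cx R).
Variable m : nat.

Definition vfield (c : 'I_m -> 'rV[C]_m -> C) (f : 'rV[C]_m -> C) (z : 'rV[C]_m) : C :=
  \sum_i c i z * pderiv i f z.

Definition dop (c : 'I_m -> 'rV[C]_m -> C) (a f : 'rV[C]_m -> C) (z : 'rV[C]_m) : C :=
  vfield c f z + a z * f z.

Lemma ser_an (r r' M : R) (f : 'rV[C]_m -> C) z : ser (fun=> r) M f -> r' < r -> polydisc (fun=> r') z -> an f z.
Proof.
move=> fs rr zr; exists (r - r'), M; split; first by rewrite subr_gt0.
apply: ser_translate fs _; first by rewrite subr_ge0 ltW.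
by move=> j; have := zr j; lra.
Qed.

Lemma vfieldD c f g z : an f z -> an g z -> vfield c (fun y => f y + g y) z = vfield c f z + vfield c g z.
Proof.
move=> fa ga; rewrite /vfield -big_split; apply: eq_bigr => i _.
by rewrite pderiv_add // mulrDr.
Qed.

Lemma vfieldM c f g z : an f z -> an g z -> vfield c (fun y => f y * g y) z = vfield c f z * g z + f z * vfield c g z.
Proof.
move=> fa ga; rewrite /vfield mulr_suml mulr_sumr -big_split; apply: eq_bigr => i _.
by rewrite pderiv_mul //=; ring.
Qed.

Lemma vfield_coord c l z : vfield c (fun y => y 0 l) z = c l z.
Proof.
rewrite /vfield (bigD1 l) //= pderiv_coord eqxx mulr1 big1 ?addr0 // => i /negbTE il.
by rewrite pderiv_coord il mulr0.
Qed.

Lemma vfield_cst c k z : vfield c (fun=> k) z = 0.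
Proof. by rewrite /vfield big1 // => i _; rewrite pderiv_cst mulr0. Qed.

Lemma an_vfield c f z : (forall i, an (c i) z) -> an f z -> an (vfield c f) z.
Proof. by move=> ca fa; apply: an_sum => i _; apply: an_mul => //; exact: an_pderiv. Qed.

Section Estimates.
Variables (c : 'I_m -> 'rV[C]_m -> C) (a : 'rV[C]_m -> C) (r0 : R) (Kc : 'I_m -> R) (Ka : R).
Hypotheses (r00 : 0 < r0) (cs : forall i, ser (fun=> r0) (Kc i) (c i)) (as_ : ser (fun=> r0) Ka a).

(** The factor [r0] brings the zero-order term [a * f] to the form [K / (r - r')] of the derivative
    terms, since [r - r' <= r0]. *)
Let K := \sum_(i <- enum 'I_m) Kc i + Ka * r0.

Lemma K_ge0 : 0 <= K.
Proof.
rewrite addr_ge0 ?mulr_ge0 ?(ser_M0 as_) ?(ltW r00) //.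
by apply: sumr_ge0 => i _; exact: ser_M0 (cs i).
Qed.

Lemma ser_dop (r r' N : R) g : ser (fun=> r) N g -> 0 < r' -> r' < r -> r <= r0 ->
  ser (fun=> r') (N * (K / (r - r'))) (dop c a g).
Proof.
move=> gs r'0 r'r rr0; have d0 : 0 < r - r' by rewrite subr_gt0.
have N0 := ser_M0 gs; have Ka0 := ser_M0 as_.
have w (f : 'rV[C]_m -> C) s P : ser (fun=> s) P f -> r' <= s -> ser (fun=> r') P f.
  by move=> fs rs; apply: ser_weak fs _ _ => // j; rewrite rs ltW.
have h : ser (fun=> r') (\sum_(i <- enum 'I_m) Kc i * (N / (r - r')) + Ka * N)
   (fun z => \sum_(i <- enum 'I_m) c i z * pderiv i g z + a z * g z).
  apply: ser_add.
    apply: ser_sum => [_|i]; first exact: ltW.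
    apply: ser_mul; last exact: ser_pderiv.
    by apply: w (cs i) _; rewrite (le_trans (ltW r'r)).
  apply: ser_mul; last by apply: w gs _; exact: ltW.
  by apply: w as_ _; rewrite (le_trans (ltW r'r)).
apply: (ser_eq (f := fun z => \sum_(i <- enum 'I_m) c i z * pderiv i g z + a z * g z)).
  apply: ser_weak h _ _ => [j|]; first by rewrite lexx ltW.
  rewrite -mulr_suml /K; have -> : N * ((\sum_(i <- enum 'I_m) Kc i + Ka * r0) / (r - r')) =
    (\sum_(i <- enum 'I_m) Kc i) * (N / (r - r')) + Ka * N * (r0 / (r - r')) by ring.
  rewrite lerD2l -[leLHS]mulr1 ler_wpM2l ?mulr_ge0 // ler_pdivlMr // mul1r; lra.
by move=> z _; rewrite /dop /vfield big_enum.
Qed.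

Lemma ser_iter_dop k M f : ser (fun=> r0) M f ->
  ser (fun=> r0 / 2) (M * (2 * k%:R * K / r0) ^+ k) (iter k (dop c a) f).
Proof.
move=> fs; case: k => [|k].
  rewrite expr0 mulr1; apply: ser_weak fs _ _ => // j; rewrite divr_ge0 ?(ltW r00) //=.
  by rewrite ler_pdivrMr // ler_pMr // ler1n.
(* The allowed loss of radius [r0 / 2] is shared equally among the [k + 1] applications of the
   operator, each costing the factor [K / e]. *)
pose e := r0 / (2 * k.+1%:R); have k0 : 0 < (k.+1%:R : R) by rewrite ltr0n.
have e0 : 0 < e by rewrite divr_gt0 // mulr_gt0.
have H j : (j <= k.+1)%N -> ser (fun=> r0 - j%:R * e) (M * (2 * k.+1%:R * K / r0) ^+ j) (iter j (dop c a) f).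
  elim: j => [_|j IH jk]; first by rewrite mul0r subr0 expr0 mulr1.
  have := ser_dop (IH (ltnW jk)) (r' := r0 - j.+1%:R * e).
  have e1 : (r0 - j%:R * e) - (r0 - j.+1%:R * e) = e by rewrite -natr1; ring.
  have eq : M * (2 * k.+1%:R * K / r0) ^+ j * (K / e) = M * (2 * k.+1%:R * K / r0) ^+ j.+1.
    by rewrite exprSr /e; field; rewrite ?gt_eqF.
  rewrite e1 eq; apply.
  - rewrite subr_gt0; apply: (@le_lt_trans _ _ (k.+1%:R * e)).
      by rewrite ler_wpM2r ?(ltW e0) // ler_nat.
    have -> : k.+1%:R * e = r0 / 2 by rewrite /e; field; rewrite gt_eqF.
    by rewrite ltr_pdivrMr // ltr_pMr // ltr1n.
  - by rewrite -subr_gt0 e1.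
  - by rewrite gerBl mulr_ge0 // ltW.
have := H k.+1 (leqnn _).
have -> : r0 - k.+1%:R * e = r0 / 2 by rewrite /e; field; rewrite gt_eqF.
by [].
Qed.

End Estimates.

(* [F] is the sum of the [(- z l) ^ k / k! * D^k f] with [D = dop c a]; it
   converges because [D^k f] grows at most like [k ^ k]. *)
Lemma linear_ck (l : 'I_m) (c : 'I_m -> 'rV[C]_m -> C) (a f : 'rV[C]_m -> C) :
  (forall i, an (c i) 0) -> (forall z, c l z = 1) -> an a 0 -> an f 0 ->
  exists F, [/\ an F 0, \forall z \near (0 : 'rV[C]_m), dop c a F z = 0 &
    \forall z \near (0 : 'rV[C]_m), (z : 'rV[C]_m) 0 l = 0 -> F z = f z].
Proof.
move=> ca cl aa fa.
have [r1 [r10 r1P]] : exists s, 0 < s /\ forall s', 0 < s' <= s -> forall i, exists N, ser (fun _ : 'I_m => s') N (c i).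
  apply: (common_radius (P := fun i s => exists N, ser (fun _ : 'I_m => s) N (c i))) => i.
  have [s [N [s0 ss]]] := an_ser0 (ca i); exists s; split => // s' /andP[s'0 s's]; exists N.
  by apply: ser_weak ss _ _ => // j; rewrite s's ltW.
have [r2 [Ka [M [r20 as2 fs2]]]] := an2 aa fa.
pose r0 := Num.min r1 r2; have r00 : 0 < r0 by rewrite lt_min r10.
have r01 : 0 < r0 <= r1 by rewrite r00 ge_min lexx.
have /choice [Kc cs] := r1P r0 r01.
have w2 g N : ser (fun=> r2) N (fun u => g (0 + u)) -> ser (fun _ : 'I_m => r0) N g.
  move=> gs; apply: (ser_eq (f := fun u => g (0 + u))); last by move=> z _; rewrite add0r.
  by apply: ser_weak gs _ _ => // j; rewrite (ltW r00) ge_min lexx orbT.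
have as0 := w2 _ _ as2; have fs := w2 _ _ fs2.
pose K := \sum_(i <- enum 'I_m) Kc i + Ka * r0.
have K0 : 0 <= K := K_ge0 r00 cs as0.
have M0 := ser_M0 fs.
(* The weights are at most [M (8 K t / r0) ^ k]: a factor 2 from [ser_iter_dop] and 4 from
   [expn_le_fact]. With 32 the ratio is at most 1/4, which leaves room below 1/2 to absorb a factor
   [n + 1] later. *)
pose t := r0 / (32 * (K + 1)).
have K1 : 0 < K + 1 by rewrite ltr_wpDl.
have t0 : 0 < t by rewrite divr_gt0 // mulr_gt0.
have tr : t < r0 / 2.
  rewrite /t ltr_pdivrMr ?mulr_gt0 // -mulrA ltr_pMr //; lra.
have tK : 8 * K * t / r0 <= 4^-1.
  have -> : 8 * K * t / r0 = 4^-1 * (K / (K + 1)) by rewrite /t; field; rewrite !gt_eqF.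
  rewrite ler_piMr ?invr_ge0 // ler_pdivrMr // mul1r; lra.
pose D := dop c a; pose g k := iter k D f.
have gs k : ser (fun=> r0 / 2) (M * (2 * k%:R * K / r0) ^+ k) (g k) := ser_iter_dop r00 cs as0 k fs.
have factp k : 0 < (k`!%:R : R) by rewrite ltr0n fact_gt0.
have bd k : t ^+ k / k`!%:R * (M * (2 * k%:R * K / r0) ^+ k) <= M * 4^-1 ^+ k.
  have e1 : t ^+ k / k`!%:R * (M * (2 * k%:R * K / r0) ^+ k) =
     M * (2 * K * t / r0) ^+ k * (k%:R ^+ k / k`!%:R) by rewrite !exprMn; ring.
  have e2 : k%:R ^+ k / k`!%:R <= (4 : R) ^+ k.
    by rewrite ler_pdivrMr // -!natrX -natrM ler_nat expn_le_fact.
  have p0 : 0 <= 2 * K * t / r0 by apply: divr_ge0; [apply: mulr_ge0; [exact: mulr_ge0|exact: ltW]|exact: ltW].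
  rewrite e1; apply: (@le_trans _ _ (M * (2 * K * t / r0) ^+ k * 4 ^+ k)).
    by rewrite ler_wpM2l // mulr_ge0 // exprn_ge0.
  rewrite -mulrA -exprMn ler_wpM2l //; apply: lerXn2r; rewrite ?nnegrE ?invr_ge0 //; first exact: mulr_ge0.
  by apply: le_trans tK; rewrite le_eqVlt; apply/orP; left; apply/eqP; ring.
pose T k (z : 'rV[C]_m) := (- z 0 l) ^+ k / k`!%:R * g k z.
have cofs k : ser (fun _ : 'I_m => t) (t ^+ k / k`!%:R) (fun z : 'rV[C]_m => (- z 0 l) ^+ k / k`!%:R).
  have -> : t ^+ k / k`!%:R = t ^+ k * nm ((k`!%:R : C)^-1) by rewrite nmV nm_nat.
  apply: ser_mul; last by apply: ser_cst => _; exact: ltW.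
  by apply: ser_exp; apply: ser_opp; apply: (ser_coord l (r := fun=> t)) => _; exact: ltW.
have gt_ k : ser (fun=> t) (M * (2 * k%:R * K / r0) ^+ k) (g k).
  by apply: ser_weak (gs k) _ _ => // j; rewrite !ltW.
have Ts k : ser (fun=> t) (M * 4^-1 ^+ k) (T k).
  by apply: ser_weak (ser_mul (cofs k) (gt_ k)) _ (bd k) => j; rewrite lexx ltW.
have q42 k : (4^-1 : R) ^+ k <= 2^-1 ^+ k.
  by apply: lerXn2r; rewrite ?nnegrE ?invr_ge0 // lef_pV2 ?posrE // ler_nat.
pose F z := csum (fun k => T k z).
have geoN n : psle (fun k => M * 4^-1 ^+ (n + k)%N) (2 * (M * 2^-1 ^+ n)).
  have h := psum_geo (x := M * 2^-1 ^+ n); apply: le_trans (h _); last by rewrite mulr_ge0 // exprn_ge0.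
  apply: le_psum => k; rewrite mulr_ge0 ?exprn_ge0 //= -mulrA -exprD.
  by rewrite ler_wpM2l.
have Fs : ser (fun=> t) (2 * (M * 2^-1 ^+ 0)) F.
  by apply: (ser_csum (fun=> ltW t0) Ts); exact: (geoN 0%N).
have Tsm z : polydisc (fun=> t) z -> csummable (fun k => T k z).
  move=> zt; apply: (csummable_dom (u := fun k => M * 4^-1 ^+ k) _ (geoN 0%N)) => k.
  exact: ser_bound (Ts k) zt.
pose S n z := \sum_(k < n) T k z.
have tails n : ser (fun=> t) (2 * (M * 2^-1 ^+ n)) (fun z => F z - S n z).
  have h := ser_csum (fun=> ltW t0) (fun k => Ts (n + k)%N) (geoN n).
  apply: (ser_eq h) => z zt; have [_ e] := csum_nat_split n (Tsm z zt).
  by rewrite /F e /S addrAC subrr add0r.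
have t2 : 0 < t / 2 by rewrite divr_gt0.
have t2t : t / 2 < t by rewrite ltr_pdivrMr // ltr_pMr // ltr1n.
have anF z : polydisc (fun=> t / 2) z -> an F z by move=> zt; exact: (ser_an Fs t2t zt).
have anT k z : polydisc (fun=> t / 2) z -> an (T k) z by move=> zt; exact: (ser_an (Ts k) t2t zt).
have ang k z : polydisc (fun=> t / 2) z -> an (g k) z by move=> zt; exact: (ser_an (gt_ k) t2t zt).
have anS n z : polydisc (fun=> t / 2) z -> an (S n) z by move=> zt; apply: an_sum => k _; exact: anT.
have an_mono k z : an (fun y : 'rV[C]_m => (- y 0 l) ^+ k / k`!%:R) z.
  by apply: an_mul; [apply: an_exp; apply: an_opp; exact: an_coord|exact: an_cst].
have vmono k z : vfield c (fun y : 'rV[C]_m => (- y 0 l) ^+ k.+1 / k.+1`!%:R) z = - ((- z 0 l) ^+ k / k`!%:R).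
  have vN z' : vfield c (fun y : 'rV[C]_m => - y 0 l) z' = -1.
    have -> : (fun y : 'rV[C]_m => - y 0 l) = fun y => (-1) * y 0 l by apply/funext => y; rewrite mulN1r.
    rewrite vfieldM; [|exact: an_cst|exact: an_coord].
    by rewrite vfield_cst mul0r add0r vfield_coord cl mulr1.
  have vX n : vfield c (fun y : 'rV[C]_m => (- y 0 l) ^+ n.+1) z = - (n.+1%:R * (- z 0 l) ^+ n).
    elim: n => [|n IH]; first by rewrite expr0 mulr1 -(vN z).
    under [X in vfield c X]eq_fun do rewrite exprS.
    rewrite vfieldM; [|by apply: an_opp; exact: an_coord|by apply: an_exp; apply: an_opp; exact: an_coord].
    by rewrite vN IH exprS -(natr1 n.+1); ring.
  rewrite vfieldM; [|by apply: an_exp; apply: an_opp; exact: an_coord|exact: an_cst].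
  rewrite vfield_cst mulr0 addr0 vX factS natrM.
  have e (x y u : C) : x != 0 -> y != 0 -> - (x * u) / (x * y) = - (u / y).
    by move=> x0 y0; field; rewrite ?x0 ?y0.
  by apply: e; rewrite pnatr_eq0 // -lt0n fact_gt0.
(* Telescoping: since [c l = 1], differentiating the power of [- z l] in each new term cancels what
   the previous terms left. *)
have DS n z : polydisc (fun=> t / 2) z -> D (S n.+1) z = (- z 0 l) ^+ n / n`!%:R * g n.+1 z.
  move=> zt; elim: n => [|n IH].
    have -> : S 1%N = f by apply/funext => y; rewrite /S big_ord1 /T expr0 fact0 divr1 mul1r.
    by rewrite expr0 fact0 divr1 mul1r.
  have -> : S n.+2 = fun y => S n.+1 y + T n.+1 y by apply/funext => y; rewrite /S big_ord_recr.
  rewrite /D /dop vfieldD; [|exact: anS|exact: anT].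
  rewrite vfieldM; [|exact: an_mono|exact: ang].
  have gE : g n.+2 z = vfield c (g n.+1) z + a z * g n.+1 z by [].
  rewrite vmono gE; move: IH; rewrite /D /dop => /(canRL (addrK _)) ->.
  by rewrite /T; ring.
have cs' : forall i, ser (fun=> t) (Kc i) (c i).
  move=> i; apply: ser_weak (cs i) _ _ => // j; rewrite (ltW t0) /=; lra.
have as' : ser (fun=> t) Ka a by apply: ser_weak as0 _ _ => // j; rewrite (ltW t0) /=; lra.
have DF z : polydisc (fun=> t / 2) z -> D F z = 0.
  move=> zt; apply/eqP; rewrite -nm_eq0 eq_le nm_ge0 andbT.
  pose K' := \sum_(i <- enum 'I_m) Kc i + Ka * t.
  have K'0 : 0 <= K' := K_ge0 t0 cs' as'.
  have zt' : polydisc (fun=> t) z by move=> j; apply: le_trans (zt j) (ltW t2t).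
  (* The first constant bounds [D] on the tail [F - S], with loss of radius [t / 2]; the second
     bounds the single term left of [D (S n.+1)]. *)
  apply: (le0_geometric (x := 2^-1) (M := 2 * M * (K' / (t - t / 2)) + M / t)).
  - by rewrite invr_ge0 ler0n /= invf_lt1 ?ltr0n // ltr1n.
  - apply: addr_ge0; last by apply: divr_ge0 => //; exact: ltW.
    by apply: mulr_ge0; [exact: mulr_ge0|apply: divr_ge0 => //; rewrite subr_ge0 ltW].
  - move=> n.
    have e1 : D F z = D (fun y => F y - S n.+1 y) z + D (S n.+1) z.
      rewrite /D /dop -[X in vfield c X z](_ : (fun y => (F y - S n.+1 y) + S n.+1 y) = F); last first.
        by apply/funext => y; rewrite subrK.
      rewrite vfieldD; [by ring|exact: (an_sub (anF z zt) (anS n.+1 z zt))|exact: anS].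
    have b1 := ser_bound (ser_dop cs' as' (tails n.+1) t2 t2t (lexx t)) zt.
    rewrite -/K' in b1.
    have b2 : nm (D (S n.+1) z) <= M / t * 2^-1 ^+ n.
      rewrite DS //; apply: le_trans (ser_bound (ser_mul (cofs n) (gt_ n.+1)) zt') _.
      have -> : t ^+ n / n`!%:R * (M * (2 * n.+1%:R * K / r0) ^+ n.+1) =
         n.+1%:R / t * (t ^+ n.+1 / n.+1`!%:R * (M * (2 * n.+1%:R * K / r0) ^+ n.+1)).
        have e (t1 N1 f1 tn X : R) : t1 != 0 -> N1 != 0 -> f1 != 0 ->
            tn / f1 * X = N1 / t1 * (t1 * tn / (N1 * f1) * X).
          by move=> h1 h2 h3; field; rewrite ?h1 ?h2 ?h3.
        by rewrite factS natrM (exprS t n); apply: e; rewrite ?pnatr_eq0 -?lt0n ?fact_gt0 ?gt_eqF.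
      apply: (@le_trans _ _ (n.+1%:R / t * (M * 4^-1 ^+ n.+1))).
        by rewrite ler_wpM2l // divr_ge0 // ltW.
      have n4 : (n.+1%:R : R) * 4^-1 ^+ n.+1 <= 2^-1 ^+ n.
        apply: (@le_trans _ _ (2 ^+ n.+1 * 4^-1 ^+ n.+1)).
          by rewrite ler_wpM2r ?exprn_ge0 // -natrX ler_nat ltnW // ltn_expl.
        rewrite -exprMn exprS; have -> : (2 * 4^-1 : R) = 2^-1 by field.
        by rewrite ler_piMl ?exprn_ge0 // invf_le1 // ler1n.
      have -> : n.+1%:R / t * (M * 4^-1 ^+ n.+1) = M / t * (n.+1%:R * 4^-1 ^+ n.+1) by ring.
      by rewrite ler_wpM2l // divr_ge0 // ltW.
    rewrite e1; apply: le_trans (ler_nmD _ _) _; rewrite mulrDl; apply: lerD b2.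
    apply: le_trans b1 _; have -> : 2 * M * (K' / (t - t / 2)) * 2^-1 ^+ n = 2 * (M * 2^-1 ^+ n) * (K' / (t - t / 2)) by ring.
    rewrite ler_wpM2r ?divr_ge0 ?subr_ge0 ?(ltW t2t) // ler_wpM2l // ler_wpM2l //.
    by rewrite exprS ler_piMl ?exprn_ge0 // invf_le1 // ler1n.
exists F; split.
- by apply: anF; apply: polydisc0 => _; exact: ltW.
- by apply/near0_poly; exists (t / 2).
- apply/near0_poly; exists (t / 2); split => // z zt zl.
  rewrite /F (@csum_single _ _ _ 0%N); first by rewrite /T expr0 fact0 divr1 mul1r.
  by move=> k k0; rewrite /T zl oppr0 expr0n (negbTE k0) mul0r mul0r.
Qed.

End LinearCauchyKovalevskaya.

(** * Straightening of fields and reduction of the number of variables *)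

Section Straightening.
Variable R : realType.
Local Notation C := (Cx R).

Lemma unitmx_inj n (A : 'M[C]_n) : (forall x : 'rV_n, x *m A = 0 -> x = 0) -> A \in unitmx.
Proof.
move=> h; rewrite -row_free_unit -kermx_eq0; apply/rowV0P => v /sub_kermxP; exact: h.
Qed.

Lemma vfield_comp m p (c : 'I_m -> 'rV[C]_m -> C) (f : 'rV[C]_p -> C) (F : 'rV[C]_m -> 'rV[C]_p) z :
  an f (F z) -> anv F z ->
  vfield c (f \o F) z = \sum_j pderiv j f (F z) * vfield c (fun y => F y 0 j) z.
Proof.
move=> fa Fa; rewrite /vfield.
under eq_bigr => i _ do rewrite pderiv_comp // mulr_sumr.
rewrite exchange_big; apply: eq_bigr => j _; rewrite mulr_sumr; apply: eq_bigr => i _; ring.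
Qed.

Lemma vfield_ext m (c : 'I_m -> 'rV[C]_m -> C) (f g : 'rV[C]_m -> C) : an f 0 ->
  (\forall z \near (0 : 'rV[C]_m), f z = g z) -> \forall z \near (0 : 'rV[C]_m), vfield c f z = vfield c g z.
Proof.
move=> fa fg; apply: filterS (pderiv_near_ext fa fg) => z h; apply: eq_bigr => i _; by rewrite h.
Qed.

Lemma vfield0E m p (c : 'I_m -> 'rV[C]_m -> C) (F : 'rV[C]_m -> 'rV[C]_p) j :
  vfield c (fun y => F y 0 j) 0 = ((\row_i c i 0) *m jac F 0) 0 j.
Proof. by rewrite mxE; apply: eq_bigr => i _; rewrite jacE mxE. Qed.

(** Let [ph] be the variation of [G] along the [l]-th direction. If it is not zero,
    [ph = t ^ (d+1) * u] with [u 0 <> 0]. Its derivative [t ^ d * ((d+1) u + t u')] is zero, and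
    cancelling [t ^ d] forces [(d+1) u 0 = 0]. *)
Lemma pderiv0_const m (l : 'I_m.+1) (G : 'rV[C]_m.+1 -> C) : an G 0 ->
  (\forall z \near (0 : 'rV[C]_m.+1), pderiv l G z = 0) ->
  \forall z \near (0 : 'rV[C]_m.+1), G z = G (setc l z 0).
Proof.
move=> Ga dG.
have /near0_poly [e [e0 eP]] := near_and dG (an_near Ga).
have [r [M [r0 Gs]]] := an_ser0 Ga.
pose s := Num.min e (r / 2); have s0 : 0 < s by rewrite lt_min e0 divr_gt0.
have sr : s <= r by rewrite /s; apply: le_trans (_ : r / 2 <= r); [rewrite ge_min lexx orbT|rewrite ler_pdivrMr // ler_pMr // ler1n].
have se : s <= e by rewrite ge_min lexx.
apply/near0_poly; exists (s / 2); split; first by rewrite divr_gt0.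
move=> z zs.
have s2 : s / 2 < s by rewrite ltr_pdivrMr // ltr_pMr // ltr1n.
pose L (t : 'rV[C]_1) := setc l z (t 0 0).
have Lpd t : polydisc (fun=> s) t -> polydisc (fun=> s) (L t).
  move=> ts j; rewrite setcE; case: eqP => _; [exact: ts|exact: le_trans (zs j) (ltW s2)].
have La t : anv L t by apply: anv_setc; [exact: anv_cst|exact: an_coord].
pose ph t := G (L t) - G (setc l z 0).
have phs : ser (fun=> s) (M + nm (G (setc l z 0))) ph.
  apply: ser_sub; last by apply: ser_cst => _; exact: ltW.
  apply: (@ser_comp _ 1 m.+1 (fun=> s) (fun=> r) M G L) => // [_|j]; first exact: ltW.
  have [->|jl] := eqVneq j l.
    apply: (ser_eq (f := fun t => t 0 0)); last by move=> t _; rewrite setcE eqxx.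
    apply: ser_weak (ser_coord 0 (r := fun=> s) _) _ _ => [_|_|]; [exact: ltW|by rewrite lexx ltW|exact: sr].
  apply: (ser_eq (f := fun=> z 0 j)); last by move=> t _; rewrite setcE (negbTE jl).
  apply: ser_weak (ser_cst (r := fun=> s) (z 0 j) _) _ _ => [_|_|]; [exact: ltW|by rewrite lexx ltW|].
  exact: le_trans (zs j) (le_trans (ltW s2) sr).
have [h|[d [u [us u0 uE]]]] := one_var_order s0 phs.
  have := h (const_mx (z 0 l)); rewrite mxE /ph /L mxE setc_id => h1.
  by apply/eqP; rewrite -subr_eq0 h1 // (le_lt_trans (zs l)).
have ua : an u 0 by exists s, ((M + nm (G (setc l z 0))) / s ^+ d); split => //; apply: (ser_eq us) => t _; rewrite add0r.
have ph0 : ph 0 = 0 by rewrite /ph /L mxE subrr.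
case: d us uE => [|d] us uE.
  have := uE 0; rewrite ph0 expr0 mul1r => h1; case/eqP: u0; rewrite -h1 //.
  by apply: polydisc0 => _; exact: ltW.
have GL t : polydisc (fun=> s) t -> an G (L t) /\ pderiv l G (L t) = 0.
  move=> ts; have := Lpd t ts => h1; have [] := eP (L t); last by [].
  by move=> j; exact: le_trans (h1 j) se.
have dph t : polydisc (fun=> s) t -> pderiv 0 ph t = 0.
  move=> ts; have [G1 G2] := GL t ts.
  have Gla : an (G \o L) t := an_comp G1 (La t).
  rewrite (pderiv_sub 0 (f := G \o L)) ?pderiv_cst ?subr0 //; last exact: an_cst.
  rewrite (pderiv_comp _ G1 (La t)).
  rewrite (bigD1 l) //= G2 mul0r add0r big1 // => j jl.
  have -> : (fun y => L y 0 j) = fun=> z 0 j by apply/funext => y; rewrite setcE (negbTE jl).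
  by rewrite pderiv_cst mulr0.
have an0 : an (fun t : 'rV[C]_1 => t 0 0 ^+ d.+1) 0 by apply: an_exp; exact: an_coord.
pose k (t : 'rV[C]_1) := d.+1%:R * u t + t 0 0 * pderiv 0 u t.
have ka : an k 0.
  apply: an_add; first by apply: an_mul; [exact: an_cst|].
  by apply: an_mul; [exact: an_coord|exact: an_pderiv].
have dX t n : pderiv 0 (fun y : 'rV[C]_1 => y 0 0 ^+ n.+1) t = n.+1%:R * t 0 0 ^+ n.
  elim: n => [|n IH].
    rewrite expr0 mulr1 (_ : (fun y => _) = fun y : 'rV[C]_1 => y 0 0) ?pderiv_coord //.
  under [X in pderiv 0 X]eq_fun do rewrite exprS.
  rewrite pderiv_mul ?pderiv_coord ?IH; [|exact: an_coord|by apply: an_exp; exact: an_coord].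
  by rewrite eqxx mulr1n mul1r exprS -[n.+2%:R]natr1; ring.
have kz : zg (fun t : 'rV[C]_1 => t 0 0 ^+ d * k t).
  have phE : \forall t \near (0 : 'rV[C]_1), ph t = t 0 0 ^+ d.+1 * u t.
    by apply/near0_poly; exists s.
  have pha : an ph 0.
    by exists s, (M + nm (G (setc l z 0))); split => //; apply: (ser_eq phs) => t _; rewrite add0r.
  have N1 : \forall t \near (0 : 'rV[C]_1), polydisc (fun=> s) t by apply/near0_poly; exists s.
  apply: filterS3 (pderiv_near_ext pha phE) N1 (an_near ua) => t h1 ts ut.
  have := h1 0; rewrite dph // pderiv_mul // ?dX; last by apply: an_exp; exact: an_coord.
  by rewrite exprS => h2; apply: etrans (esym h2); rewrite /k; ring.
have /near_pt := an_idom_exp ka kz; rewrite /k mxE mul0r addr0 => /eqP.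
by rewrite mulf_eq0 pnatr_eq0 (negbTE u0).
Qed.

(* Linear Cauchy-Kovalevskaya provides the unit [v] and the first integrals
   of the field, which are the components of [p]. *)
Lemma straighten m (l : 'I_m.+1) (c : 'I_m.+1 -> 'rV[C]_m.+1 -> C) (a G : 'rV[C]_m.+1 -> C) :
  (forall i, an (c i) 0) -> an a 0 -> an G 0 -> c l 0 != 0 ->
  (\forall z \near (0 : 'rV[C]_m.+1), vfield c G z = a z * G z) ->
  exists (p : 'rV[C]_m.+1 -> 'rV[C]_m) (v : 'rV[C]_m.+1 -> C) (H : 'rV[C]_m -> C),
    [/\ anv p 0 /\ p 0 = 0, row_full (jac p 0), an v 0 /\ v 0 != 0, an H 0 &
      \forall z \near (0 : 'rV[C]_m.+1), v z * G z = H (p z)].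
Proof.
move=> ca aa Ga cl0 E.
(* Division by [c l] normalises the [l]-th coefficient to 1, as [linear_ck] requires; the zero-order
   factor becomes [a']. *)
pose c' i z := if i == l then 1 else c i z / c l z.
pose a' z := a z / c l z.
have cVa : an (fun z => (c l z)^-1) 0 by exact: an_inv.
have c'a i : an (c' i) 0 by rewrite /c'; case: eqP => _; [exact: an_cst|exact: an_mul].
have a'a : an a' 0 by exact: an_mul.
have c'l z : c' l z = 1 by rewrite /c' eqxx.
have E' : \forall z \near (0 : 'rV[C]_m.+1), vfield c' G z = a' z * G z.
  apply: filterS2 E (an_neq0 (ca l) cl0) => z h cz; rewrite /a' mulrAC -h mulrC.
  rewrite /vfield mulr_sumr; apply: eq_bigr => i _; rewrite /c'; case: eqP => [->|_]; last by ring.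
  by rewrite mul1r mulrA mulVf // mul1r.
(* The unit solves [c'(v) = - a' v] with value 1 on the hyperplane [z l = 0], so that [c']
   annihilates [v * G]. *)
have [v [va vE v0E]] := linear_ck c'a c'l a'a (an_cst 1 0).
have v0 : v 0 = 1 by rewrite (near_pt v0E) // mxE.
have /choice [P PP] : forall i : 'I_m, exists F, [/\ an F 0, \forall z \near (0 : 'rV[C]_m.+1), dop c' (fun=> 0) F z = 0 &
    \forall z \near (0 : 'rV[C]_m.+1), (z : 'rV[C]_m.+1) 0 l = 0 -> F z = z 0 (lift l i)].
  move=> i; apply: linear_ck => //; [exact: an_cst|exact: an_coord].
pose p z := \row_i P i z.
have pE i : (fun z => p z 0 i) = P i by apply/funext => z; rewrite mxE.
have pa : anv p 0 by move=> i; rewrite pE; case: (PP i).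
have p0 : p 0 = 0.
  by apply/rowP => i; rewrite !mxE; case: (PP i) => _ _ /near_pt ->; rewrite ?mxE.
have dP i k : pderiv (lift l k) (P i) 0 = (k == i)%:R.
  have [Pa _ Pl] := PP i.
  (* On the hyperplane [z l = 0] the first integral [P i] is the coordinate [lift l i]; composing
     with the projection [E0] reads off its tangential derivatives at 0. *)
  pose E0 (z : 'rV[C]_m.+1) := setc l z 0.
  have E0a : anv E0 0 by apply: anv_setc; [exact: anv_id|exact: an_cst].
  have E00 : E0 0 = 0 by apply/rowP => j; rewrite setcE mxE if_same.
  have cmp (f : 'rV[C]_m.+1 -> C) : an f 0 -> pderiv (lift l k) (f \o E0) 0 = pderiv (lift l k) f 0.
    move=> fa; rewrite pderiv_comp ?E00 //.
    have dE j : pderiv (lift l k) (fun z => E0 z 0 j) 0 = if j == l then 0 else (lift l k == j)%:R.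
      case: (eqVneq j l) => [->|jl].
        have -> : (fun z => E0 z 0 l) = fun=> 0 by apply/funext => z; rewrite setcE eqxx.
        exact: pderiv_cst.
      have -> : (fun z => E0 z 0 j) = fun z => z 0 j by apply/funext => z; rewrite setcE (negbTE jl).
      exact: pderiv_coord.
    rewrite (bigD1 (lift l k)) //= dE eqxx eq_sym (negbTE (neq_lift _ _)) mulr1 big1 ?addr0 //.
    move=> j jk; rewrite dE [lift l k == j]eq_sym (negbTE jk) if_same mulr0 //.
  rewrite -cmp // -[(k == i)%:R](_ : (lift l k == lift l i)%:R = _); last by rewrite (inj_eq lift_inj).
  rewrite -(pderiv_coord (lift l k) (lift l i) 0) -(cmp (fun z => z 0 (lift l i))); last exact: an_coord.
  apply: pderiv_ext; first by apply: an_comp => //; rewrite E00.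
  rewrite -E00 in Pl; apply: filterS (anv_near_comp E0a Pl) => z h /=.
  by rewrite h // setcE eqxx.
have pfull : row_full (jac p 0).
  apply/row_fullP; exists (\matrix_(k, j) (j == lift l k)%:R); apply/matrixP => k i.
  rewrite mxE (bigD1 (lift l k)) //= mxE eqxx mul1r jacE pE dP big1 ?addr0 ?mxE //.
  by move=> j /negbTE jk; rewrite mxE jk mul0r.
(* The first integrals and [z l] form a coordinate system in which [c'] is the derivative along the
   [l]-th axis. *)
pose Y z := ins l (p z) (z 0 l).
have Ya : anv Y 0 by apply: anv_ins => //; exact: an_coord.
have Y0 : Y 0 = 0 by rewrite /Y p0 mxE ins00.
have YE i : (fun z => Y z 0 (lift l i)) = P i by apply/funext => z; rewrite ins_lift mxE.
have YEl : (fun z => Y z 0 l) = fun z => z 0 l by apply/funext => z; rewrite ins_l.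
have JY : jac Y 0 \in unitmx.
  apply: unitmx_inj => x xJ.
  have xl : x 0 l = 0.
    have := congr1 (fun M : 'rV[C]_m.+1 => M 0 l) xJ; rewrite !mxE (bigD1 l) //= jacE YEl pderiv_coord eqxx mulr1.
    by rewrite big1 ?addr0 // => j /negbTE jl; rewrite jacE YEl pderiv_coord jl mulr0.
  apply/rowP => j; rewrite [RHS]mxE; case: (unliftP l j) => [i ->|->] //.
  have := congr1 (fun M : 'rV[C]_m.+1 => M 0 (lift l i)) xJ; rewrite !mxE (bigD1 (lift l i)) //= jacE YE dP eqxx mulr1.
  rewrite big1 ?addr0 // => k ki; case: (unliftP l k) ki => [k' ->|->] ki; last by rewrite xl mul0r.
  rewrite jacE YE dP; case: eqP => [kk|]; last by rewrite mulr0.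
  by rewrite kk eqxx in ki.
have [Z [Za Z0 ZY YZ]] := inverse_function Ya Y0 JY.
pose f z := v z * G z; have fa : an f 0 by exact: an_mul.
pose K := f \o Z; have Ka : an K 0 by apply: an_comp => //; rewrite Z0.
have fK : \forall z \near (0 : 'rV[C]_m.+1), f z = (K \o Y) z by apply: filterS ZY => z h; rewrite /K /= h.
have df : \forall z \near (0 : 'rV[C]_m.+1), vfield c' f z = 0.
  apply: filterS3 E' vE (near_and (an_near va) (an_near Ga)) => z h1; rewrite /dop => h2 [vz Gz].
  rewrite /f vfieldM // h1; have -> : vfield c' v z = - (a' z * v z) by apply/eqP; rewrite -addr_eq0 h2.
  by ring.
(* Applied to [K \o Y], the field annihilates every first integral and sends [z l] to 1, so only the
   [l]-th partial derivative of [K] remains. *)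
have dK : \forall y \near (0 : 'rV[C]_m.+1), pderiv l K y = 0.
  have : \forall z \near (0 : 'rV[C]_m.+1), pderiv l K (Y z) = 0.
    have KY := Ka; rewrite -Y0 in KY.
    have dPz : \forall z \near (0 : 'rV[C]_m.+1), forall i, vfield c' (P i) z = 0.
      apply: near_all => i; case: (PP i) => _ h _; apply: filterS h => z.
      by rewrite /dop mul0r addr0.
    have N1 := anv_near_comp Ya (an_near KY).
    apply: filterS3 (near_and df (vfield_ext c' fa fK)) (near_and dPz N1) (anv_near Ya) => z [h1 h2] [h3 h4] h5.
    move: h2; rewrite h1 vfield_comp // (bigD1 l) //= YEl vfield_coord c'l mulr1 big1 ?addr0 // => j jl.
    by case: (unliftP l j) jl => [i -> _|->]; rewrite ?eqxx // YE h3 mulr0.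
  rewrite -{1}Z0 => h; have ZYn := anv_near_comp Za h.
  by apply: filterS2 ZYn YZ => y /= h1 h2; rewrite h2 in h1.
exists p, v, (fun w => K (ins l w 0)); split => //.
- by rewrite v0 oner_neq0.
- apply: (an_comp (f := K) (F := fun w => ins l w 0)); first by rewrite ins00.
  by apply: anv_ins; [exact: anv_id|exact: an_cst].
- have := pderiv0_const Ka dK; rewrite -{1}Y0 => h.
  apply: filterS2 fK (anv_near_comp Ya h) => z e1 e2.
  by rewrite -[LHS]/(f z) e1 /= e2 setc_ins del_ins.
Qed.

(** Restricting [w] to the image of a right factor [B] with [B *m jac w 0 = 1] gives a map between
    spaces of the same dimension, which is locally invertible. *)
Lemma submersion_section n k (w : 'rV[C]_n -> 'rV[C]_k) : anv w 0 -> w 0 = 0 -> row_full (jac w 0) ->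
  exists s : 'rV[C]_k -> 'rV[C]_n, [/\ anv s 0, s 0 = 0 & \forall y \near (0 : 'rV[C]_k), w (s y) = y].
Proof.
move=> wa w0 /row_fullP [B BJ].
have Ba (z : 'rV[C]_k) : anv (fun y : 'rV[C]_k => y *m B) z by apply: anv_mulmx; exact: anv_id.
have [|||S [Sa S0 _ SE]] := @inverse_function _ _ (w \o (fun y : 'rV[C]_k => y *m B)).
- by apply: anv_comp => //; rewrite mul0mx.
- by rewrite /= mul0mx.
- rewrite jac_comp ?mul0mx // jac_mulmx; last exact: anv_id.
  by rewrite jac_id mul1mx BJ unitmx1.
exists (fun y => S y *m B); split => //.
- exact: anv_mulmx.
- by rewrite S0 mul0mx.
Qed.

(* Up to the unit [v], the germ of [g] depends on [k] variables only. *)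
Record through n (g : 'rV[C]_n -> C) k (w : 'rV[C]_n -> 'rV[C]_k) (v : 'rV[C]_n -> C) (G : 'rV[C]_k -> C) : Prop := Through {
  through_w : anv w 0; through_w0 : w 0 = 0; through_full : row_full (jac w 0);
  through_v : an v 0; through_v0 : v 0 != 0; through_G : an G 0;
  throughE : \forall z \near (0 : 'rV[C]_n), v z * g z = G (w z) }.

Definition log_field n (g : 'rV[C]_n -> C) (c : 'I_n -> 'rV[C]_n -> C) : Prop :=
  (forall i, an (c i) 0) /\ exists2 a, an a 0 & \forall z \near (0 : 'rV[C]_n), vfield c g z = a z * g z.

(** The field multiplies [v * g = G \o w] by [c(v) / v + a]. Evaluating its components along [w] on
    a section [s] gives a field [c1] on the base that is logarithmic along [G] and nonzero at 0.
    Straightening [c1] makes a unit times [G] depend on one variable fewer. *)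
Lemma through_reduce n (g : 'rV[C]_n -> C) k w v G c : an g 0 -> through g (k := k) w v G -> log_field g c ->
  (\row_i c i 0) *m jac w 0 != 0 -> exists k', (k' < k)%N /\ exists w' v' G', through g (k := k') w' v' G'.
Proof.
move=> ga [wa w0 wf va v0 Ga E] [ca [a aa aE]] nz.
case: k w G wa w0 wf Ga E nz => [|k] w G wa w0 wf Ga E nz.
  by case/eqP: nz; apply/rowP => -[].
have [l cl] : exists l, ((\row_i c i 0) *m jac w 0) 0 l != 0.
  apply: contrapT => h; case/eqP: nz; apply/rowP => j; rewrite [RHS]mxE; apply: contrapT => /eqP h2.
  by apply: h; exists j.
have [s [sa s0 sE]] := submersion_section wa w0 wf.
pose c1 j (y : 'rV[C]_k.+1) := vfield c (fun z => w z 0 j) (s y).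
pose a1 z := vfield c v z / v z + a z.
have a1a : an a1 0.
  apply: an_add => //; apply: an_mul; last exact: an_inv.
  exact: an_vfield.
have c1a j : an (c1 j) 0.
  by apply: (an_comp (F := s) (f := vfield c (fun z => w z 0 j))) => //; rewrite s0; exact: an_vfield.
have Gw : an (G \o w) 0 by apply: an_comp => //; rewrite w0.
have vg : an (fun z => v z * g z) 0 by exact: an_mul.
have E1 : \forall z \near (0 : 'rV[C]_n), vfield c (G \o w) z = a1 z * G (w z).
  apply: filterS3 (near_and E (vfield_ext c vg E)) (near_and (an_near va) (an_near ga)) (near_and aE (an_neq0 va v0)) => z [h1 h2] [vz gz] [h3 h4].
  rewrite -[LHS]h2 vfieldM // h3 -h1 /a1; by field.
have E2 : \forall y \near (0 : 'rV[C]_k.+1), vfield c1 G y = a1 (s y) * G y.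
  have N := near_and E1 (near_and (anv_near wa) (anv_near_comp wa (_ : \forall y \near w 0, an G y))).
  have {}N := N (an_near (eq_ind_r (fun y => an G y) Ga w0)).
  rewrite -{1}s0 in N; apply: filterS2 (anv_near_comp sa N) sE => y [h1 [h2 h3]] h4.
  move: h1; rewrite vfield_comp // h4 => <-; apply: eq_bigr => j _; exact: mulrC.
have c10 : c1 l 0 != 0 by rewrite /c1 s0 vfield0E.
have a1s : an (a1 \o s) 0 by apply: an_comp => //; rewrite s0.
have [p [v' [H [[pa p0] pf [v'a v'0] Ha E3]]]] := straighten c1a a1s Ga c10 E2.
exists k; split => //; exists (p \o w), (fun z => v' (w z) * v z), H; split => //.
- by apply: anv_comp => //; rewrite w0.
- by rewrite /= w0.
- rewrite jac_comp // w0 //; move/row_fullP: pf => [B1 e1]; move/row_fullP: wf => [B2 e2].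
  by apply/row_fullP; exists (B1 *m B2); rewrite mulmxA -(mulmxA B1) e2 mulmx1.
- by apply: an_mul => //; apply: (an_comp (f := v') (F := w)) => //; rewrite w0.
- by rewrite w0 mulf_neq0.
- rewrite -w0 in E3; apply: filterS2 (anv_near_comp wa E3) E => z h1 h2.
  by rewrite -mulrA h2 h1.
Qed.

(* [k] is the least possible number of variables: straightening a logarithmic
   field that is transverse to the fibres of [w] would remove one more. *)
Lemma through_minimal n (g : 'rV[C]_n -> C) : an g 0 -> exists k w v G,
  through g (k := k) w v G /\ forall c, log_field g c -> (\row_i c i 0) *m jac w 0 = 0.
Proof.
move=> ga; pose P k := `[< exists w v G, through g (k := k) w v G >].
have ex : exists k, P k.
  exists n; apply/asboolP; exists id, (fun=> 1), g; constructor.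
  - exact: anv_id.
  - by [].
  - by rewrite jac_id row_full_unit unitmx1.
  - exact: an_cst.
  - exact: oner_neq0.
  - exact: ga.
  - by apply: near_true => z; rewrite mul1r.
case: (ex_minnP ex) => k /asboolP [w [v [G T]]] kmin.
exists k, w, v, G; split => // c cl; apply: contrapT => /eqP nz.
have [k' [kk T']] := through_reduce ga T cl nz.
by have := kmin k'; rewrite leqNgt kk => h; suff : false by []; apply: h; apply/asboolP.
Qed.

Lemma through_pos n (g : 'rV[C]_n -> C) k w v G : an g 0 -> through g (k := k) w v G -> g 0 = 0 -> ~ zg g -> (0 < k)%N.
Proof.
move=> ga [wa w0 wf va v0 Ga E] g0 ng; case: k w G wa w0 wf Ga E => // w G wa w0 wf Ga E.
case: ng; have e0 : G 0 = 0 by rewrite -w0 -(near_pt E) g0 mulr0.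
have : zg (fun z => v z * g z).
  by apply: filterS E => z ->; rewrite -e0; congr G; apply/rowP => -[].
by case/(an_idom va ga) => // /near_pt h; rewrite h eqxx in v0.
Qed.

(** All columns of [A] and [B] together are linearly independent: for Jacobian matrices, the
    differentials of the two maps are. *)
Definition indep n k q (A : 'M[C]_(n, k)) (B : 'M[C]_(n, q)) : Prop :=
  forall (x : 'rV_k) (y : 'rV_q), x *m A^T + y *m B^T = 0 -> x = 0 /\ y = 0.

Lemma indep_unit n k q (e : (k + q = n)%N) (A : 'M[C]_(n, k)) (B : 'M[C]_(n, q)) : indep A B ->
  castmx (erefl n, e) (row_mx A B) \in unitmx.
Proof.
case: n / e A B => A B AB; rewrite castmx_id -unitmx_tr; apply: unitmx_inj => x.
rewrite tr_row_mx -[x]hsubmxK mul_row_col => /AB [-> ->]; exact: row_mx0.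
Qed.

Lemma indep_le n k q (A : 'M[C]_(n, k)) (B : 'M[C]_(n, q)) : indep A B -> (k + q <= n)%N.
Proof.
move=> AB; have : row_free (col_mx A^T B^T).
  rewrite -kermx_eq0; apply/rowV0P => x /sub_kermxP.
  rewrite -[x]hsubmxK mul_row_col => /AB [-> ->]; exact: row_mx0.
by move/eqP <-; exact: rank_leq_col.
Qed.

Lemma indep_extend n k q (A : 'M[C]_(n, k)) (B : 'M[C]_(n, q)) : indep A B -> (k + q < n)%N ->
  exists c : 'M[C]_(n, 1), indep A (row_mx B c).
Proof.
move=> AB lt; have : ~~ row_full (col_mx A^T B^T).
  by rewrite /row_full neq_ltn (leq_ltn_trans (rank_leq_row _) lt).
rewrite -sub1mx => /row_subPn [i ni].
exists (row i 1%:M)^T => x y; rewrite tr_row_mx trmxK -[y]hsubmxK mul_row_col addrA => e.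
set t := rsubmx y in e *.
have t0 : t 0 0 = 0.
  apply: contrapT => /eqP tn; case/negP: ni.
  have tE : t *m row i 1%:M = t 0 0 *: row i (1%:M : 'M[C]_n).
    by rewrite {1}[t]mx11_scalar mul_scalar_mx.
  apply/submxP; exists (- (t 0 0)^-1 *: row_mx x (lsubmx y)).
  rewrite -scalemxAl mul_row_col; move/eqP: e; rewrite addr_eq0 => /eqP ->.
  by rewrite tE scalerN scaleNr opprK scalerA mulVf // scale1r.
have tz : t = 0 by apply/matrixP => a b; rewrite !ord1 t0 mxE.
rewrite tz mul0mx addr0 in e; have [-> ->] := AB _ _ e.
by rewrite tz row_mx0.
Qed.

(** Missing variables are supplied by linear forms independent of the differentials at hand; the
    function [G] of the old variables ignores them. The induction is on the number [n - (k + q)] of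
    forms to add. *)
Lemma through_extend n (h : 'rV[C]_n -> C) k (A : 'M[C]_(n, k)) q w v G : an h 0 -> through h (k := q) w v G ->
  indep A (jac w 0) -> exists w' v' G', through h (k := (n - k)%N) w' v' G' /\ indep A (jac w' 0).
Proof.
move=> ha; have [d] := ubnP (n - (k + q))%N; elim: d => // d IH in q w G *; rewrite ltnS => dn T AB.
have le := indep_le AB; move: le; rewrite leq_eqVlt => /orP[/eqP e|lt].
  have e' : q = (n - k)%N by rewrite -e addKn.
  by subst q; exists w, v, G.
have [c ABc] := indep_extend AB lt; case: T => [wa w0 wf va v0 Ga E].
pose w' (z : 'rV[C]_n) : 'rV[C]_(q + 1) := row_mx (w z) (z *m c).
have w'l j : (fun z => w' z 0 (lshift 1 j)) = fun z => w z 0 j by apply/funext => z; rewrite row_mxEl.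
have w'r j : (fun z => w' z 0 (rshift q j)) = fun z => (z *m c) 0 j by apply/funext => z; rewrite row_mxEr.
have ca (z : 'rV[C]_n) : anv (fun z : 'rV[C]_n => z *m c) z by apply: anv_mulmx; exact: anv_id.
have w'a : anv w' 0.
  by move=> j; case: (split_ordP j) => i ->; rewrite ?w'l ?w'r; [exact: wa|exact: ca].
have Jw' : jac w' 0 = row_mx (jac w 0) c.
  apply/matrixP => i j; rewrite jacE; case: (split_ordP j) => a ->; rewrite ?w'l ?w'r ?row_mxEl ?row_mxEr.
    by rewrite jacE.
  by rewrite -jacE jac_mulmx ?jac_id ?mul1mx //; exact: anv_id.
apply: (IH (q + 1)%N w' (G \o lsubmx)).
- by rewrite addnA addn1 subnS -ltnS prednK ?subn_gt0.
- split => //.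
  + by rewrite /w' w0 mul0mx row_mx0.
  + rewrite Jw'; apply/row_fullP.
    have : row_free (row_mx (jac w 0) c)^T.
      rewrite -kermx_eq0; apply/rowV0P => x /sub_kermxP xk.
      by have [] := ABc 0 x; rewrite ?mul0mx ?add0r.
    by move/row_freeP => [B BE]; exists B^T; apply: trmx_inj; rewrite trmx_mul trmxK BE trmx1.
  + apply: an_comp; first by rewrite /= linear0.
    by move=> j; under eq_fun do rewrite mxE; exact: an_coord.
  + by apply: filterS E => z -> /=; rewrite row_mxKl.
- by rewrite Jw'.
Qed.

End Straightening.

(** * The theorem in coordinates *)

Section LocalCore.
Variable R : realType.
Local Notation C := (Cx R).

Lemma coprime_sym m (g h : 'rV[C]_m -> C) : coprime_germs g h -> coprime_germs h g.
Proof. by move=> cop a aa h1 h2; exact: cop. Qed.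

(** Membership of [w] in [(f) + J_f], the Jacobian part being written as a vector field applied to
    [f], so that the Leibniz and chain rules apply to it directly. *)
Definition jideal n (f w : 'rV[C]_n -> C) : Prop :=
  exists (a : 'rV[C]_n -> C) (b : 'I_n -> 'rV[C]_n -> C), [/\ an a 0, forall i, an (b i) 0 &
    \forall z \near (0 : 'rV[C]_n), w z = a z * f z + vfield b f z].

Definition ideal2 n (f g w : 'rV[C]_n -> C) : Prop :=
  exists a b : 'rV[C]_n -> C, [/\ an a 0, an b 0 &
    \forall z \near (0 : 'rV[C]_n), w z = a z * f z + b z * g z].

Lemma jideal_ext n (f f' w w' : 'rV[C]_n -> C) : an f 0 -> (\forall z \near (0 : 'rV[C]_n), f z = f' z) ->
  (\forall z \near (0 : 'rV[C]_n), w z = w' z) -> jideal f w -> jideal f' w'.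
Proof.
move=> fa ff' ww' [a [b [aa ba E]]]; exists a, b; split => //.
apply: filterS3 E (near_and ff' (vfield_ext b fa ff')) ww' => z e1 [e2 e3] e4.
by rewrite -e4 e1 e2 e3.
Qed.

Lemma ideal2_ext n (f f' g g' w w' : 'rV[C]_n -> C) : (\forall z \near (0 : 'rV[C]_n), f z = f' z) ->
  (\forall z \near (0 : 'rV[C]_n), g z = g' z) ->
  (\forall z \near (0 : 'rV[C]_n), w z = w' z) -> ideal2 f g w -> ideal2 f' g' w'.
Proof.
move=> ff' gg' ww' [a [b [aa ba E]]]; exists a, b; split => //.
apply: filterS3 E (near_and ff' gg') ww' => z e1 [e2 e3] e4.
by rewrite -e4 e1 e2 e3.
Qed.

Lemma vfield_scale n (b : 'I_n -> 'rV[C]_n -> C) (u f : 'rV[C]_n -> C) z :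
  vfield (fun i z => b i z * u z) f z = u z * vfield b f z.
Proof. by rewrite /vfield mulr_sumr; apply: eq_bigr => i _; ring. Qed.

Lemma jideal_mulr n (f u w : 'rV[C]_n -> C) : an f 0 -> an u 0 ->
  jideal (fun z => f z * u z) w -> jideal f w.
Proof.
move=> fa ua [a [b [aa ba E]]].
exists (fun z => a z * u z + vfield b u z), (fun i z => b i z * u z); split.
- by apply: an_add; [exact: an_mul|exact: an_vfield].
- by move=> i; exact: an_mul.
- apply: filterS3 E (an_near fa) (an_near ua) => z -> fz uz.
  by rewrite vfieldM // vfield_scale; ring.
Qed.

(** Independence of coordinates: the field is carried along [F], its new components being [b(G_j)]
    at [F z]. *)
Lemma jideal_comp n (f w : 'rV[C]_n -> C) (F G : 'rV[C]_n -> 'rV[C]_n) : an f 0 -> anv F 0 -> F 0 = 0 ->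
  local_inverse F G -> jideal f w -> jideal (f \o F) (w \o F).
Proof.
move=> fa Fa F0 [Ga G0 GF FG] [a [b [aa ba E]]].
have fFa : an (f \o F) 0 by apply: an_comp => //; rewrite F0.
exists (a \o F), (fun j z => vfield b (fun y => G y 0 j) (F z)); split.
- by apply: an_comp => //; rewrite F0.
- move=> j; apply: (an_comp (f := vfield b (fun y => G y 0 j)) (F := F)) => //; rewrite F0.
  exact: an_vfield.
- have fE : \forall y \near (0 : 'rV[C]_n), f y = ((f \o F) \o G) y by apply: filterS FG => y /= ->.
  have N := near_and E (near_and (vfield_ext b fa fE) (near_and (anv_near Ga) (anv_near_comp Ga (_ : \forall y \near G 0, an (f \o F) y)))).
  have {}N := N (an_near (eq_ind_r (fun y => an (f \o F) y) fFa G0)).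
  rewrite -{1}F0 in N; apply: filterS2 (anv_near_comp Fa N) GF => z [e1 [e2 [e3 e4]]] e5.
  rewrite /= e1; congr (_ + _); rewrite e2 vfield_comp // e5 /vfield.
  by apply: eq_bigr => j _; exact: mulrC.
Qed.

Lemma jideal_prod n (g h w : 'rV[C]_n -> C) : an g 0 -> an h 0 -> jideal (fun z => g z * h z) w ->
  [/\ ideal2 g h w, jideal g w & jideal h w].
Proof.
move=> ga ha jw; split.
- have [a [b [aa ba E]]] := jw.
  exists (fun z => a z * h z + vfield b h z), (vfield b g); split.
  + by apply: an_add; [exact: an_mul|exact: an_vfield].
  + exact: an_vfield.
  + apply: filterS3 E (an_near ga) (an_near ha) => z -> gz hz.
    by rewrite vfieldM //; ring.
- exact: jideal_mulr jw.
- have {}jw : jideal (fun z => h z * g z) w.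
    by apply: jideal_ext jw; [exact: an_mul|apply: near_true => z; rewrite mulrC|exact: near_true].
  exact: jideal_mulr jw.
Qed.

(** The nontrivial inclusion of the equality of ideals, for germs at the origin. *)
Definition splitting_ideals n (g h : 'rV[C]_n -> C) : Prop :=
  forall w, an w 0 -> ideal2 g h w -> jideal g w -> jideal h w -> jideal (fun z => g z * h z) w.

(** Write [g * d_i h = a g h + b(g h)]. Then [h b(g) = g k] with [k = d_i h - a h - b(h)], and by
    coprimality [g] divides [b(g)] while [h] divides [k]. Thus [b] is logarithmic along [g] and
    [d_i - b] along [h]. *)
Lemma log_decomposition n (g h : 'rV[C]_n -> C) : an g 0 -> an h 0 -> ~ zg g -> ~ zg h ->
  coprime_germs g h -> splitting_ideals g h ->
  forall i, exists c d, [/\ log_field g c, log_field h d & forall j, c j 0 + d j 0 = (i == j)%:R].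
Proof.
move=> ga ha ng nh cop sp i.
have dha : an (pderiv i h) 0 by exact: an_pderiv.
have dE (f : 'rV[C]_n -> C) z u : vfield (fun j _ => (i == j)%:R * u) f z = u * pderiv i f z.
  rewrite /vfield (bigD1 i) //= eqxx mul1r big1 ?addr0 // => j ji.
  by rewrite eq_sym (negbTE ji) !mul0r.
have [|||| a [b [aa ba E]]] := sp (fun z => g z * pderiv i h z).
- exact: an_mul.
- exists (pderiv i h), (fun=> 0); split => //; first exact: an_cst.
  by apply: near_true => z; rewrite mul0r addr0 mulrC.
- exists (pderiv i h), (fun _ _ => 0); split => //; first by move=> j; exact: an_cst.
  apply: near_true => z; rewrite /vfield big1 ?addr0 1?mulrC // => j _; exact: mul0r.
- exists (fun=> 0), (fun j z => (i == j)%:R * g z); split; first exact: an_cst.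
    by move=> j; apply: an_mul => //; exact: an_cst.
  by apply: near_true => z; rewrite mul0r add0r -dE.
pose k z := pderiv i h z - a z * h z - vfield b h z.
have vg : an (vfield b g) 0 by exact: an_vfield.
have ka : an k 0 by apply: an_sub; [apply: an_sub => //; exact: an_mul|exact: an_vfield].
have hg : \forall z \near (0 : 'rV[C]_n), h z * vfield b g z = g z * k z.
  apply: filterS3 E (an_near ga) (an_near ha) => z e1 gz hz; rewrite /k !mulrBr e1 vfieldM //; ring.
have [q qa qE] := euclid ga ha vg ka ng cop hg.
have [q' q'a q'E] : dvdan h k.
  by apply: (euclid ha ga ka vg nh (coprime_sym cop)); apply: filterS hg => z ->.
exists b, (fun j z => (i == j)%:R * 1 - b j z); split.
- by split => //; exists q => //; apply: filterS qE => z ->; rewrite mulrC.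
- split; first by move=> j; apply: an_sub => //; exact: an_cst.
  exists (fun z => q' z + a z); first exact: an_add.
  apply: filterS q'E => z e.
  have -> : vfield (fun j z0 => (i == j)%:R * 1 - b j z0) h z = pderiv i h z - vfield b h z.
    rewrite -[pderiv i h z]mul1r -dE /vfield -sumrB; apply: eq_bigr => j _; by rewrite mulrBl.
  by move: e; rewrite /k => /(canRL (subrK _)) /(canRL (subrK _)) ->; ring.
- by move=> j; rewrite mulr1; ring.
Qed.

(** A covector [x *m A^T = - (y *m B^T)] in the span of both sets of differentials kills the fields
    logarithmic along [g], by its first form, and those along [h], by its second. They sum to every
    basis vector at 0, so the covector is zero. *)
Lemma split_coordinates n (g h : 'rV[C]_n -> C) : an g 0 -> an h 0 -> g 0 = 0 -> h 0 = 0 ->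
  ~ zg g -> ~ zg h -> coprime_germs g h -> splitting_ideals g h ->
  exists k : nat, (0 < k < n)%N /\ exists w v G w' v' H,
    [/\ through g (k := k) w v G, through h (k := (n - k)%N) w' v' H & indep (jac w 0) (jac w' 0)].
Proof.
move=> ga ha g0 h0 ng nh cop sp.
have dec := log_decomposition ga ha ng nh cop sp.
have [k [w [v [G [T tan]]]]] := through_minimal ga.
have [q [w' [v' [H [T' tan']]]]] := through_minimal ha.
have k0 := through_pos ga T g0 ng; have q0 := through_pos ha T' h0 nh.
have ind : indep (jac w 0) (jac w' 0).
  set A := jac w 0; set B := jac w' 0; move=> x y e.
  have xA : x *m A^T = 0.
    apply/rowP => i; rewrite [RHS]mxE; have [c [d [lc ld cd]]] := dec i.
    have hc := tan c lc; have hd := tan' d ld; rewrite -/A in hc; rewrite -/B in hd.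
    have e1 : x *m A^T *m (\row_i c i 0)^T = 0 by rewrite -mulmxA -trmx_mul hc trmx0 mulmx0.
    have e2 : y *m B^T *m (\row_i d i 0)^T = 0 by rewrite -mulmxA -trmx_mul hd trmx0 mulmx0.
    have e3 : x *m A^T = - (y *m B^T) by apply/eqP; rewrite -addr_eq0 e.
    have e4 : x *m A^T *m (\row_i c i 0 + \row_i d i 0)^T = 0.
      by rewrite linearD /= mulmxDr e1 e3 mulNmx e2 oppr0 addr0.
    have := congr1 (fun M : 'M[C]_1 => M 0 0) e4; rewrite mxE [X in _ = X -> _]mxE => <-.
    rewrite (bigD1 i) //= [X in _ = _ * X + _]mxE [X in _ = _ * X + _]mxE [X in _ = _ * (X + _) + _]mxE [X in _ = _ * (_ + X) + _]mxE cd eqxx mulr1.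
    rewrite big1 ?addr0 // => j ji; rewrite [X in _ * X]mxE [X in _ * X]mxE [X in _ * (X + _)]mxE [X in _ * (_ + X)]mxE cd eq_sym (negbTE ji).
    exact: mulr0.
  have yB : y *m B^T = 0 by rewrite xA add0r in e.
  have inj p (D : 'M[C]_(n, p)) (t : 'rV_p) : row_full D -> t *m D^T = 0 -> t = 0.
    move=> /row_fullP [D' DD] tD; rewrite -[t]mulmx1 -trmx1 -DD trmx_mul mulmxA tD.
    exact: mul0mx.
  by split; [apply: inj (through_full T) xA|apply: inj (through_full T') yB].
have kq := indep_le ind.
(* The two minimal numbers of variables may add up to less than [n]; the leftover variables are
   given to [h]. *)
have [w1 [v1 [H1 [T1 ind1]]]] := through_extend ha T' ind.
exists k; split; first by rewrite k0 /= (leq_trans _ kq) // -addn1 leq_add2l.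
by exists w, v, G, w1, v1, H1.
Qed.

Lemma pderiv_invariant n (l : 'I_n) (f : 'rV[C]_n -> C) z : (forall t, f (z + evec l t) = f z) -> pderiv l f z = 0.
Proof.
move=> h; rewrite (@pderiv_lim _ _ l f z (fun=> 0) 1) //; first exact: an_cst.
by move=> t _; rewrite h mulr0 addr0.
Qed.

Lemma pderiv_translate n (l : 'I_n) (f : 'rV[C]_n -> C) z v : (forall z, f (z + v) = f z) ->
  pderiv l f (z + v) = pderiv l f z.
Proof.
move=> h; rewrite addrC -pderiv_shift; congr (pderiv l _ z); apply/funext => y.
by rewrite addrC h.
Qed.

(** The germ [f1] and its partial derivatives, all constant along [v], form one family indexed by
    ['I_n.+1], with [f1] in position 0. Subtracting [a * f1] leaves [b * f2] as a combination of it,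
    from which [cancel_transverse] removes [f2]. *)
Lemma jideal_cancel n (l : 'I_n) (v : 'rV[C]_n) (f1 f2 a b w : 'rV[C]_n -> C) : v 0 l != 0 ->
  an f1 0 -> an f2 0 -> an a 0 -> an b 0 ->
  (forall z t, f1 (z + t *: v) = f1 z) -> ~ zg (fun t : 'rV[C]_1 => f2 (t 0 0 *: v)) ->
  (\forall z \near (0 : 'rV[C]_n), w z = a z * f1 z + b z * f2 z) -> jideal f1 w -> jideal f1 b.
Proof.
move=> vl f1a f2a aa ba inv nz wE [al [be [ala bea jE]]].
pose F (i : 'I_n.+1) := if unlift ord0 i is Some j then pderiv j f1 else f1.
pose c (i : 'I_n.+1) := if unlift ord0 i is Some j then be j else fun z => al z - a z.
have FE (d : 'I_n.+1 -> 'rV[C]_n -> C) z : \sum_i F i z * d i z = d ord0 z * f1 z + vfield (fun i => d (lift ord0 i)) f1 z.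
  rewrite big_ord_recl /F unlift_none mulrC; congr (_ + _); apply: eq_bigr => i _.
  by rewrite liftK mulrC.
have Fa i : an (F i) 0 by rewrite /F; case: unlift => [j|//]; exact: an_pderiv.
have ca i : an (c i) 0 by rewrite /c; case: unlift => [j|]; [exact: bea|exact: an_sub].
have Finv i z t : F i (z + t *: v) = F i z.
  by rewrite /F; case: unlift => [j|]; [apply: pderiv_translate => y; exact: inv|exact: inv].
have E : \forall z \near (0 : 'rV[C]_n), b z * f2 z = \sum_i F i z * c i z.
  apply: filterS2 wE jE => z e1 e2; rewrite FE /c unlift_none.
  have -> : vfield (fun i => if unlift ord0 (lift ord0 i) is Some j then be j else fun z0 => al z0 - a z0) f1 z = vfield be f1 z.
    by apply: eq_bigr => i _; rewrite liftK.
  by rewrite mulrBl addrAC -e2 e1 addrAC subrr add0r.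
have [q [qa qE]] := cancel_transverse vl Fa ca f2a ba Finv nz E.
exists (q ord0), (fun i => q (lift ord0 i)); split => //.
by apply: filterS qE => z ->; rewrite FE.
Qed.

(** From [b = a1 f1 + b1(f1)] and [a = a2 f2 + b2(f2)] one gets [w = (a1 + a2) f1 f2 + b1(f1) f2 +
    f1 b2(f2)]. Taking the components of [b1] in the directions [s] and those of [b2] in the others
    gives one field that acts as [b1] on [f1] and as [b2] on [f2]. *)
Lemma splitting_of_split n (s : pred 'I_n) (f1 f2 : 'rV[C]_n -> C) (l1 l2 : 'I_n) (v1 v2 : 'rV[C]_n) :
  an f1 0 -> an f2 0 ->
  (forall i, s i -> forall z t, f2 (z + evec i t) = f2 z) ->
  (forall i, ~~ s i -> forall z t, f1 (z + evec i t) = f1 z) ->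
  v2 0 l2 != 0 -> (forall z t, f1 (z + t *: v2) = f1 z) -> ~ zg (fun t : 'rV[C]_1 => f2 (t 0 0 *: v2)) ->
  v1 0 l1 != 0 -> (forall z t, f2 (z + t *: v1) = f2 z) -> ~ zg (fun t : 'rV[C]_1 => f1 (t 0 0 *: v1)) ->
  splitting_ideals f1 f2.
Proof.
move=> f1a f2a i2 i1 vl2 inv1 nz2 vl1 inv2 nz1 w wa [a [b [aa ba wE]]] j1 j2.
have [a1 [b1 [a1a b1a E1]]] := jideal_cancel vl2 f1a f2a aa ba inv1 nz2 wE j1.
have wE' : \forall z \near (0 : 'rV[C]_n), w z = b z * f2 z + a z * f1 z by apply: filterS wE => z ->; exact: addrC.
have [a2 [b2 [a2a b2a E2]]] := jideal_cancel vl1 f2a f1a ba aa inv2 nz1 wE' j2.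
exists (fun z => a1 z + a2 z), (fun i => if s i then b1 i else b2 i); split.
- exact: an_add.
- by move=> i; case: ifP.
- apply: filterS3 wE (near_and E1 E2) (near_and (an_near f1a) (an_near f2a)) => z -> [-> ->] [fz1 fz2].
  rewrite vfieldM //.
  have -> : vfield (fun i => if s i then b1 i else b2 i) f1 z = vfield b1 f1 z.
    apply: eq_bigr => i _; case: (boolP (s i)) => // si.
    by rewrite pderiv_invariant ?mulr0 //; exact: i1.
  have -> : vfield (fun i => if s i then b1 i else b2 i) f2 z = vfield b2 f2 z.
    apply: eq_bigr => i _; case: (boolP (s i)) => // si.
    by rewrite pderiv_invariant ?mulr0 //; exact: i2.
  by ring.
Qed.

End LocalCore.

(** * Transfer to the manifold *)

Section Charts.
Variables (R : realType) (n : nat) (S : topologicalType) (c : chart R n S).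
Local Notation C := (Cx R).
Hypothesis cC : is_chart c.

Lemma chart_cont q : chart_dom c q -> c @ q --> c q.
Proof.
have [[oD _] _ cc _] := cC; rewrite continuous_open_subspace // in cc.
by move=> qD; apply: cc; rewrite inE.
Qed.

Lemma chart_invK z : (c @` chart_dom c) z -> chart_dom c (chart_inv c z) /\ c (chart_inv c z) = z.
Proof. by have [_ cK _ _] := cC; move=> [q qD <-]; rewrite cK. Qed.

Lemma chart_inv_cont z : (c @` chart_dom c) z -> chart_inv c @ z --> chart_inv c z.
Proof.
have [[_ oI] _ _ cc] := cC; rewrite continuous_open_subspace // in cc.
by move=> zI; apply: cc; rewrite inE.
Qed.

Lemma chart_near q (P : S -> Prop) : chart_dom c q ->
  (\forall q' \near q, P q') <-> (\forall z \near c q, P (chart_inv c z)).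
Proof.
have [[oD oI] cK _ _] := cC; move=> qD.
have zI : (c @` chart_dom c) (c q) by exists q.
split=> h; first by apply: (chart_inv_cont zI); rewrite /= cK.
have qN : \forall q' \near q, chart_dom c q' := open_nbhs_nbhs (conj oD qD).
have h' : \forall q' \near q, P (chart_inv c (c q')) by exact: (chart_cont qD h).
by apply: filterS2 qN h' => q' /cK ->.
Qed.

Lemma chart_near_image q : chart_dom c q ->
  \forall z \near c q, chart_dom c (chart_inv c z) /\ c (chart_inv c z) = z.
Proof.
have [[_ oI] _ _ _] := cC; move=> qD.
have zI : (c @` chart_dom c) (c q) by exists q.
have zN : \forall z \near c q, (c @` chart_dom c) z := open_nbhs_nbhs (conj oI zI).
by apply: filterS zN => z /chart_invK.
Qed.

End Charts.

(** * Germs at a point read in coordinates *)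

Section Coordinates.
Variables (R : realType) (n : nat) (S : complexManifold R n) (p : S).
Local Notation C := (Cx R).

Section Pull.
Variable x : chart R n S.
Hypothesis xC : coordinates_at p x.

Lemma coord_inv0 : chart_inv x 0 = p.
Proof. by have [[_ xK _ _] xp <- _] := xC; exact: xK. Qed.

Lemma coord_near (P : S -> Prop) :
  (\forall q \near p, P q) <-> (\forall z \near (0 : 'rV[C]_n), P (chart_inv x z)).
Proof. by have [ic xp x0 _] := xC; rewrite -[0]x0; exact: chart_near. Qed.

Lemma coordK : \forall z \near (0 : 'rV[C]_n), x (chart_inv x z) = z.
Proof.
have [ic xp x0 _] := xC; have := chart_near_image ic xp; rewrite x0 => N.
by apply: filterS N => z [].
Qed.

Lemma coord_to_atlas c : atlas c -> chart_dom c p -> anv (c \o chart_inv x) 0.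
Proof.
move=> ca cp j; have [ic xp x0 xt] := xC; have [_ h] := xt c ca.
by have := h p xp cp j; rewrite x0 => /an_of_analytic.
Qed.

Lemma atlas_to_coord c : atlas c -> chart_dom c p -> anv (x \o chart_inv c) (c p).
Proof.
move=> ca cp j; have [ic xp x0 xt] := xC; have [h _] := xt c ca.
exact: an_of_analytic (h p cp xp j).
Qed.

Lemma holomorphic_pull f : holomorphic_at p f -> an (f \o chart_inv x) 0.
Proof.
have [c ca cp] := atlas_cover p; move=> /(_ c ca cp) /an_of_analytic fa.
have Fa := coord_to_atlas ca cp.
have F0 : (c \o chart_inv x) 0 = c p by rewrite /= coord_inv0.
rewrite -F0 in fa; apply: an_ext (an_comp fa Fa) _.
have [_ cK _ _] := atlas_chart ca.
have /coord_near N : \forall q \near p, chart_dom c q.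
  by have [[oD _] _ _ _] := atlas_chart ca; exact: (open_nbhs_nbhs (conj oD cp)).
by apply: filterS N => z /= /cK ->.
Qed.

Lemma holomorphic_pushed f : an (f \o chart_inv x) 0 -> holomorphic_at p f.
Proof.
move=> fa c ca cp; apply: analytic_of_an.
have [[[oD _] xK _ _] xp x0 _] := xC.
have Fa := atlas_to_coord ca cp.
have F0 : (x \o chart_inv c) (c p) = 0 by have [_ cK _ _] := atlas_chart ca; rewrite /= cK.
rewrite -F0 in fa; apply: an_ext (an_comp fa Fa) _.
have /(chart_near (atlas_chart ca) _ cp) N : \forall q \near p, chart_dom x q := open_nbhs_nbhs (conj oD xp).
by apply: filterS N => z /= /xK ->.
Qed.

Lemma holomorphicE f : holomorphic_at p f <-> an (f \o chart_inv x) 0.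
Proof. by split; [exact: holomorphic_pull|exact: holomorphic_pushed]. Qed.

Lemma pushK (k : 'rV[C]_n -> C) : \forall z \near (0 : 'rV[C]_n), ((k \o x) \o chart_inv x) z = k z.
Proof. by apply: filterS coordK => z /= ->. Qed.

Lemma holomorphic_push (k : 'rV[C]_n -> C) : an k 0 -> holomorphic_at p (k \o x).
Proof.
move=> ka; apply/holomorphicE; apply: an_ext ka _.
by apply: filterS (pushK k) => z ->.
Qed.

Lemma germ_dvdE a f : germ_dvd p a f <-> dvdan (a \o chart_inv x) (f \o chart_inv x).
Proof.
split=> [[b /holomorphicE ba /coord_near E]|[k ka E]]; first by exists (b \o chart_inv x).
exists (k \o x); first exact: holomorphic_push.
by apply/coord_near; apply: filterS2 E (pushK k) => z /= -> ->.
Qed.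

Lemma germ_unitE f : germ_unit p f <-> an (f \o chart_inv x) 0 /\ f p != 0.
Proof.
split=> [[/holomorphicE fa /germ_dvdE [k ka E]]|[fa fp]].
  split => //; apply/eqP => fp; have := near_pt E; rewrite /= coord_inv0 fp mul0r => /eqP.
  by rewrite oner_eq0.
split; first exact/holomorphicE.
by apply/germ_dvdE/unit_dvd => //=; [rewrite coord_inv0|exact: an_cst].
Qed.

Lemma germ_reducedE f : germ_reduced p f <-> an (f \o chart_inv x) 0 /\ squarefree_germ (f \o chart_inv x).
Proof.
split=> [[/holomorphicE fa sq]|[fa sq]]; split=> //; last 2 first.
- exact/holomorphicE.
- move=> a /holomorphicE aa /germ_dvdE ad; apply/germ_unitE; split => //.
  by have := sq _ aa ad; rewrite /= coord_inv0.
move=> a aa ad; have [|_] := (germ_unitE (a \o x)).1 (sq (a \o x) (holomorphic_push aa) _).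
  by apply/germ_dvdE; apply: dvd_extl ad _; apply: filterS (pushK a) => z /= ->.
by have [_ _ x0 _] := xC; rewrite /= x0.
Qed.

Lemma germ_no_common_factorE f g :
  germ_no_common_factor p f g -> coprime_germs (f \o chart_inv x) (g \o chart_inv x).
Proof.
move=> cop a aa af ag.
have N : \forall z \near (0 : 'rV[C]_n), a z = ((a \o x) \o chart_inv x) z by apply: filterS (pushK a) => z ->.
have /germ_unitE [_] : germ_unit p (a \o x).
  by apply: cop; [exact: holomorphic_push|apply/germ_dvdE; exact: dvd_extl af N|apply/germ_dvdE; exact: dvd_extl ag N].
by have [_ _ x0 _] := xC; rewrite /= x0.
Qed.

End Pull.

End Coordinates.

(** * The ideals read in coordinates *)

Section Ideals.
Variables (R : realType) (n : nat) (S : complexManifold R n) (p : S) (x : chart R n S).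
Local Notation C := (Cx R).
Hypothesis xC : coordinates_at p x.
Local Notation pull f := (f \o chart_inv x).

Lemma germ_idealE (s : seq (S -> C)) (w : S -> C) : germ_ideal p s w <-> an (pull w) 0 /\
  exists2 c : nat -> 'rV[C]_n -> C, (forall i, an (c i) 0) &
    \forall z \near (0 : 'rV[C]_n), pull w z = \sum_(i < size s) c i z * nth (fun=> 0) s i (chart_inv x z).
Proof.
split=> [[/(holomorphicE xC) wa [c ca /(coord_near xC) E]]|[wa [c ca E]]]; split=> //.
- by exists (fun i => pull (c i)) => // i; apply/(holomorphicE xC).
- exact/(holomorphicE xC).
- exists (fun i => c i \o x) => [i|]; first exact: (holomorphic_push xC).
  apply/(coord_near xC); apply: filterS2 E (coordK xC) => z /= -> xz.
  by apply: eq_bigr => i _; rewrite xz.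
Qed.

Lemma germ_ideal2E (g h w : S -> C) : germ_ideal p [:: g; h] w <->
  an (pull w) 0 /\ ideal2 (pull g) (pull h) (pull w).
Proof.
rewrite germ_idealE; split=> [[wa [c ca E]]|[wa [a [b [aa ba E]]]]]; split=> //.
  exists (c 0%N), (c 1%N); split=> //.
  by apply: filterS E => z ->; rewrite /= !big_ord_recl big_ord0 addr0.
exists (fun i => if i is 0%N then a else b) => [[]//|].
by apply: filterS E => z ->; rewrite /= !big_ord_recl big_ord0 addr0.
Qed.

Lemma germ_ideal1E (g w : S -> C) : germ_ideal p [:: g] w <->
  an (pull w) 0 /\ exists2 a, an a 0 & \forall z \near (0 : 'rV[C]_n), pull w z = a z * pull g z.
Proof.
rewrite germ_idealE; split=> [[wa [c ca E]]|[wa [a aa E]]]; split=> //.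
  by exists (c 0%N) => //; apply: filterS E => z ->; rewrite big_ord_recl big_ord0 addr0.
exists (fun=> a) => //.
by apply: filterS E => z ->; rewrite /= big_ord_recl big_ord0 addr0.
Qed.

Lemma jacobian_idealE (f w : S -> C) : jacobian_ideal p x f w <->
  an (pull w) 0 /\ exists2 b : 'I_n -> 'rV[C]_n -> C, (forall i, an (b i) 0) &
    \forall z \near (0 : 'rV[C]_n), pull w z = vfield b (pull f) z.
Proof.
rewrite /jacobian_ideal germ_idealE size_map size_enum_ord.
have nthE z : x (chart_inv x z) = z -> forall i : 'I_n,
    nth (fun=> 0) [seq partial x i f | i <- enum 'I_n] i (chart_inv x z) = pderiv i (pull f) z.
  by move=> xz i; rewrite (nth_map i) ?size_enum_ord // nth_ord_enum /partial xz pderiv_def.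
split=> [[wa [c ca E]]|[wa [b ba E]]]; split=> //.
  exists (fun i => c i) => //; apply: filterS2 E (coordK xC) => z -> /nthE e.
  by apply: eq_bigr => i _; rewrite e.
exists (fun i => if insub i is Some j then b j else fun=> 0) => [i|].
  by case: insub => [j|]; [exact: ba|exact: an_cst].
apply: filterS2 E (coordK xC) => z -> /nthE e; apply: eq_bigr => i _.
by rewrite e valK.
Qed.

Lemma jidealE (f w : S -> C) : an (pull f) 0 ->
  ideal_add p (germ_ideal p [:: f]) (jacobian_ideal p x f) w <-> an (pull w) 0 /\ jideal (pull f) (pull w).
Proof.
move=> fa; split.
  move=> [/(holomorphicE xC) wa [a [b [/germ_ideal1E [_ [a' a'a aE]] /jacobian_idealE [_ [b' b'a bE]]]]]].
  move=> /(coord_near xC) E; split=> //; exists a', b'; split=> //.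
  by apply: filterS3 E aE bE => z /= -> -> ->.
move=> [wa [a [b [aa ba E]]]]; split; first exact/(holomorphicE xC).
have va : an (vfield b (pull f)) 0 by exact: an_vfield.
exists (fun q => a (x q) * f q), (vfield b (pull f) \o x).
have pE := pushK xC a; have vE := pushK xC (vfield b (pull f)).
split.
- apply/germ_ideal1E; split; last by exists a => //; apply: filterS pE => z /= ->.
  apply: (an_ext (an_mul aa fa)); by apply: filterS pE => z /= ->.
- apply/jacobian_idealE; split; last by exists b.
  by apply: an_ext va _; apply: filterS vE => z ->.
- by apply/(coord_near xC); apply: filterS3 E pE vE => z /= -> -> ->.
Qed.

Lemma splitting_idealsE (g h : S -> C) : an (pull g) 0 -> an (pull h) 0 ->
  ideal_add p (germ_ideal p [:: g \* h]) (jacobian_ideal p x (g \* h)) =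
  germ_ideal p [:: g; h]
    `&` ideal_add p (germ_ideal p [:: g]) (jacobian_ideal p x g)
    `&` ideal_add p (germ_ideal p [:: h]) (jacobian_ideal p x h)
  <-> splitting_ideals (pull g) (pull h).
Proof.
move=> ga ha; have gha : an (pull (g \* h)) 0 by exact: an_mul.
split=> [E w wa w2 wg wh|sp].
  have kE := pushK xC w.
  have e f : an f 0 -> jideal f w -> jideal f (pull (w \o x)).
    by move=> fa; apply: (jideal_ext fa (near_true _ (fun=> erefl))); apply: filterS kE => z ->.
  have wxa : an (pull (w \o x)) 0 by apply: an_ext wa _; apply: filterS kE => z ->.
  have : (germ_ideal p [:: g; h]
    `&` ideal_add p (germ_ideal p [:: g]) (jacobian_ideal p x g)
    `&` ideal_add p (germ_ideal p [:: h]) (jacobian_ideal p x h)) (w \o x).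
    split; [split|].
    - apply/germ_ideal2E; split=> //.
      apply: (ideal2_ext (near_true _ (fun=> erefl)) (near_true _ (fun=> erefl)) _ w2).
      by apply: filterS kE => z ->.
    - by apply/jidealE => //; split=> //; exact: e.
    - by apply/jidealE => //; split=> //; exact: e.
  rewrite -E => /(jidealE _ gha) [_].
  exact: (jideal_ext gha (near_true _ (fun=> erefl))).
apply/seteqP; split=> w.
  move=> /(jidealE _ gha) [wa /(jideal_prod ga ha) [w2 wg wh]].
  by split; [split|]; [apply/germ_ideal2E|apply/jidealE|apply/jidealE].
move=> [[/germ_ideal2E [wa w2] /(jidealE _ ga) [_ wg]] /(jidealE _ ha) [_ wh]].
by apply/jidealE => //; split=> //; exact: sp.
Qed.

End Ideals.

(** * Functions of separate variables *)

Section SplitCoordinates.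
Variables (R : realType) (n : nat) (k : 'I_n).
Local Notation C := (Cx R).

Let kn : (k + (n - k) = n)%N := subnKC (ltnW (ltn_ord k)).

Definition join_coords (a : 'rV[C]_k) (b : 'rV[C]_(n - k)) : 'rV[C]_n :=
  castmx (erefl, kn) (row_mx a b).

Lemma first_join a b : first_coords k (join_coords a b) = a.
Proof.
apply/rowP => j; rewrite mxE castmxE.
set i := cast_ord _ (widen_ord _ _); have -> : i = lshift (n - k) j by apply/val_inj.
by rewrite row_mxEl ord1.
Qed.

Lemma last_join a b : last_coords k (join_coords a b) = b.
Proof.
apply/rowP => j; rewrite mxE castmxE.
set i := cast_ord _ (cast_ord _ _); have -> : i = rshift k j by apply/val_inj.
by rewrite row_mxEr ord1.
Qed.

Lemma join_first_last z : join_coords (first_coords k z) (last_coords k z) = z.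
Proof.
apply/rowP => j; rewrite castmxE; set i := cast_ord _ j.
have [j' ij|j' ij] := split_ordP i; rewrite ij ?row_mxEl ?row_mxEr mxE ord1; congr (z _ _); apply/val_inj => /=.
  by rewrite -[LHS]/(val (lshift (n - k) j')) -ij.
by rewrite -[LHS]/(val (rshift k j')) -ij.
Qed.

Lemma first_line (z v : 'rV[C]_n) t : first_coords k (z + t *: v) = first_coords k z + t *: first_coords k v.
Proof. by apply/rowP => j; rewrite !mxE. Qed.

Lemma last_line (z v : 'rV[C]_n) t : last_coords k (z + t *: v) = last_coords k z + t *: last_coords k v.
Proof. by apply/rowP => j; rewrite !mxE. Qed.

Lemma first_scale (v : 'rV[C]_n) t : first_coords k (t *: v) = t *: first_coords k v.
Proof. by apply/rowP => j; rewrite !mxE. Qed.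

Lemma last_scale (v : 'rV[C]_n) t : last_coords k (t *: v) = t *: last_coords k v.
Proof. by apply/rowP => j; rewrite !mxE. Qed.

Lemma first_coords0 : first_coords k (0 : 'rV[C]_n) = 0.
Proof. by apply/rowP => j; rewrite !mxE. Qed.

Lemma last_coords0 : last_coords k (0 : 'rV[C]_n) = 0.
Proof. by apply/rowP => j; rewrite !mxE. Qed.

Lemma anv_first (w : 'rV[C]_n) : anv (first_coords k) w.
Proof.
by move=> j; apply: (an_ext (an_coord (widen_ord (ltnW (ltn_ord k)) j) w)); apply: near_true => z; rewrite mxE.
Qed.

Lemma anv_last (w : 'rV[C]_n) : anv (last_coords k) w.
Proof.
by move=> j; apply: (an_ext (an_coord (cast_ord kn (rshift k j)) w)); apply: near_true => z; rewrite mxE.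
Qed.

Lemma first_delta (i : 'I_n) : ~~ (i < k)%N -> first_coords k (delta_mx 0 i : 'rV[C]_n) = 0.
Proof.
move=> ik; apply/rowP => j; rewrite !mxE eqxx /=; case: eqP => // e.
by move: ik; rewrite -e /= ltn_ord.
Qed.

Lemma last_delta (i : 'I_n) : (i < k)%N -> last_coords k (delta_mx 0 i : 'rV[C]_n) = 0.
Proof.
move=> ik; apply/rowP => j; rewrite !mxE eqxx /=; case: eqP => // e.
by move: ik; rewrite -e /= ltnNge leq_addr.
Qed.

Lemma line_nz m (f : 'rV[C]_m -> C) (v : 'rV[C]_m) d (u : 'rV[C]_1 -> C) : an u 0 -> u 0 != 0 ->
  (\forall t \near (0 : 'rV[C]_1), f ((t : 'rV[C]_1) 0 0 *: v) = t 0 0 ^+ d * u t) ->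
  ~ zg (fun t : 'rV[C]_1 => f (t 0 0 *: v)).
Proof.
move=> ua u0 E z0.
have /(an_idom_exp ua) /near_pt uz : zg (fun t : 'rV[C]_1 => t 0 0 ^+ d * u t) by apply: filterS2 E z0 => t <-.
by rewrite uz eqxx in u0.
Qed.

(** A direction on which one factor is not identically zero, extended by zero in the other block of
    variables, is a direction in which the other factor is constant. *)
Lemma splitting_split (h1 : 'rV[C]_k -> C) (h2 : 'rV[C]_(n - k) -> C) : (0 < k)%N ->
  an h1 0 -> an h2 0 -> ~ zg h1 -> ~ zg h2 ->
  splitting_ideals (h1 \o first_coords k) (h2 \o last_coords k).
Proof.
move=> k0 h1a h2a n1 n2.
have nk0 : (0 < n - k)%N by rewrite subn_gt0 ltn_ord.
have [v1 [v1l [d1 [u1 [u1a u10 E1]]]]] := direction (Ordinal k0) h1a n1.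
have [v2 [v2l [d2 [u2 [u2a u20 E2]]]]] := direction (Ordinal nk0) h2a n2.
apply: (@splitting_of_split R n (fun i => (i < k)%N) _ _
  (widen_ord (ltnW (ltn_ord k)) (Ordinal k0)) (cast_ord kn (rshift k (Ordinal nk0)))
  (join_coords v1 0) (join_coords 0 v2)).
- by apply: an_comp; [rewrite first_coords0|exact: anv_first].
- by apply: an_comp; [rewrite last_coords0|exact: anv_last].
- by move=> i ik z t; rewrite /= /evec last_line last_delta // scaler0 addr0.
- by move=> i ik z t; rewrite /= /evec first_line first_delta // scaler0 addr0.
- by have := congr1 (fun b : 'rV[C]_(n - k) => b 0 (Ordinal nk0)) (last_join 0 v2); rewrite mxE => ->.
- by move=> z t; rewrite /= first_line first_join scaler0 addr0.
- move=> h; apply: (line_nz u2a u20 E2).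
  by apply: filterS h => t /=; rewrite last_scale last_join.
- by have := congr1 (fun b : 'rV[C]_k => b 0 (Ordinal k0)) (first_join v1 0); rewrite mxE => ->.
- by move=> z t; rewrite /= last_line last_join scaler0 addr0.
- move=> h; apply: (line_nz u1a u10 E1).
  by apply: filterS h => t /=; rewrite first_scale first_join.
Qed.

End SplitCoordinates.

(** * Invariance under units and coordinate changes *)

Section SplittingTransfer.
Variable R : realType.
Local Notation C := (Cx R).

(** [jideal_mulr] passes from a product to its factor. It is used for [u1] and [u2] to go down to
    [f1] and [f2], and for the inverse units to come back to [g * h]. *)
Lemma splitting_unit n (f1 f2 u1 u2 g h : 'rV[C]_n -> C) : an f1 0 -> an f2 0 -> an g 0 -> an h 0 ->
  an u1 0 -> an u2 0 -> u1 0 != 0 -> u2 0 != 0 ->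
  (\forall z \near (0 : 'rV[C]_n), g z = f1 z * u1 z) ->
  (\forall z \near (0 : 'rV[C]_n), h z = f2 z * u2 z) ->
  splitting_ideals f1 f2 -> splitting_ideals g h.
Proof.
move=> f1a f2a ga ha u1a u2a u10 u20 gE hE sp w wa [a [b [aa ba wE]]] wg wh.
have j1 : jideal f1 w.
  by apply: (jideal_mulr f1a u1a); exact: (jideal_ext ga gE (near_true _ (fun=> erefl))).
have j2 : jideal f2 w.
  by apply: (jideal_mulr f2a u2a); exact: (jideal_ext ha hE (near_true _ (fun=> erefl))).
have i12 : ideal2 f1 f2 w.
  exists (fun z => a z * u1 z), (fun z => b z * u2 z); split; [exact: an_mul|exact: an_mul|].
  by apply: filterS3 wE gE hE => z -> -> ->; ring.
have ua : an (fun z => (u1 z)^-1 * (u2 z)^-1) 0 by apply: an_mul; exact: an_inv.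
have gha : an (fun z => g z * h z) 0 by exact: an_mul.
apply: (jideal_mulr gha ua).
have f12a : an (fun z => f1 z * f2 z) 0 by exact: an_mul.
apply: (jideal_ext f12a _ (near_true _ (fun=> erefl)) (sp w wa i12 j1 j2)).
apply: filterS3 (near_and gE hE) (an_neq0 u1a u10) (an_neq0 u2a u20) => z [-> ->] n1 n2.
by field; rewrite n1 n2.
Qed.

Lemma splitting_comp n (f1 f2 : 'rV[C]_n -> C) (F G : 'rV[C]_n -> 'rV[C]_n) : an f1 0 -> an f2 0 ->
  anv F 0 -> F 0 = 0 -> local_inverse F G -> splitting_ideals f1 f2 -> splitting_ideals (f1 \o F) (f2 \o F).
Proof.
move=> f1a f2a Fa F0 FGi sp w wa w2 w1' w2'; have [Ga G0 GF FG] := FGi.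
have GFi : local_inverse G F by [].
have Fan (f : 'rV[C]_n -> C) : an f 0 -> an (f \o F) 0 by move=> fa; apply: an_comp; rewrite ?F0.
have FGE (f : 'rV[C]_n -> C) : \forall z \near (0 : 'rV[C]_n), ((f \o F) \o G) z = f z.
  by apply: filterS FG => z /= ->.
have Gan (f : 'rV[C]_n -> C) : an f 0 -> jideal (f \o F) w -> jideal f (w \o G).
  move=> fa j; have j' := jideal_comp (Fan f fa) Ga G0 GFi j.
  apply: (jideal_ext _ (FGE f) (near_true _ (fun=> erefl)) j').
  by apply: an_comp; rewrite ?G0 //; exact: Fan.
have wGa : an (w \o G) 0 by apply: an_comp; rewrite ?G0.
have i12 : ideal2 f1 f2 (w \o G).
  have [a [b [aa ba E]]] := w2; rewrite -{1}G0 in E.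
  exists (a \o G), (b \o G); split; [by apply: an_comp; rewrite ?G0|by apply: an_comp; rewrite ?G0|].
  by apply: filterS2 (anv_near_comp Ga E) FG => z /= -> ->.
have f12a : an (fun z => f1 z * f2 z) 0 by exact: an_mul.
have j := jideal_comp f12a Fa F0 FGi (sp _ wGa i12 (Gan _ f1a w1') (Gan _ f2a w2')).
have fFa := Fan _ f12a.
apply: (jideal_ext fFa (near_true _ (fun=> erefl)) _ j).
by apply: filterS GF => z /= ->.
Qed.

End SplittingTransfer.

(** * Changes of coordinates on the manifold *)

Section CoordinateChange.
Variables (R : realType) (n : nat).
Local Notation C := (Cx R).

Lemma anv_cont m q (F : 'rV[C]_m -> 'rV[C]_q) w : anv F w -> F @ w --> F w.
Proof. by move=> Fa P; exact: anv_near_comp. Qed.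

(** A chart needs an open domain with open image on which both maps are analytic and inverse at
    every point, not just near 0. The set of such points of [A°] with image in [B°] works, its image
    being the part of [B°] that [G] sends into [A°]. *)
Lemma local_inverse_open (P : 'rV[C]_n -> Prop) (F G : 'rV[C]_n -> 'rV[C]_n) : anv F 0 -> F 0 = 0 ->
  local_inverse F G -> (\forall z \near (0 : 'rV[C]_n), P z) ->
  exists W : set 'rV[C]_n, [/\ open W, W 0, W `<=` P, open (F @` W) &
    forall z, W z -> [/\ anv F z, anv G (F z) & G (F z) = z]].
Proof.
move=> Fa F0 [Ga G0 GF FG] N0.
have NA := near_and N0 (near_and (anv_near Fa) GF); have NB := near_and (anv_near Ga) FG.
set A := (fun z => _) in NA; set B := (fun z => _) in NB.
exists (A° `&` F @^-1` B°); split.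
- rewrite openE => z [Az Bz]; have [_ [Fz _]] := interior_subset Az.
  apply: filterI; first by have := open_interior A; rewrite openE; exact.
  by apply: (anv_near_comp (P := B°) Fz); have := open_interior B; rewrite openE; exact.
- by split; [exact: NA|rewrite /preimage /= F0; exact: NB].
- by move=> z [/interior_subset [] ].
- have -> : F @` (A° `&` F @^-1` B°) = B° `&` G @^-1` A°.
    apply/seteqP; split=> [_ [z [Az Bz] <-]|u [Bu Au]].
      by have [_ [_ e]] := interior_subset Az; split; [exact: Bz|rewrite /preimage /= e; exact: Az].
    by have [_ e] := interior_subset Bu; exists (G u); [split; [exact: Au|rewrite /preimage /= e; exact: Bu]|exact: e].
  rewrite openE => u [Bu Au]; have [Gu _] := interior_subset Bu.
  apply: filterI; first by have := open_interior B; rewrite openE; exact.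
  by apply: (anv_near_comp (P := A°) Gu); have := open_interior A; rewrite openE; exact.
- by move=> z [/interior_subset [_ [? ?]] /interior_subset [? _]].
Qed.

Variables (S : complexManifold R n) (p : S).

Section Transition.
Variables (x y : chart R n S).
Hypotheses (xC : coordinates_at p x) (yC : coordinates_at p y).

Lemma anv_transition : anv (y \o chart_inv x) 0.
Proof.
move=> j; apply: (holomorphicE xC (fun q => y q 0 j)).1.
apply/(holomorphicE yC); apply: (an_ext (an_coord j 0)).
by apply: filterS (coordK yC) => z /= ->.
Qed.

Lemma transition0 : (y \o chart_inv x) 0 = 0.
Proof. by have [_ _ y0 _] := yC; rewrite /= (coord_inv0 xC). Qed.

Lemma pull_transition (f : S -> C) :
  \forall z \near (0 : 'rV[C]_n), ((f \o chart_inv y) \o (y \o chart_inv x)) z = (f \o chart_inv x) z.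
Proof.
have [[[oD _] yK _ _] yp _ _] := yC.
have /(coord_near xC) N : \forall q \near p, chart_dom y q := open_nbhs_nbhs (conj oD yp).
by apply: filterS N => z /= /yK ->.
Qed.

Lemma transitionK : \forall z \near (0 : 'rV[C]_n), x (chart_inv y (y (chart_inv x z))) = z.
Proof.
have [[[oD _] yK _ _] yp _ _] := yC.
have /(coord_near xC) N : \forall q \near p, chart_dom y q := open_nbhs_nbhs (conj oD yp).
by apply: filterS2 N (coordK xC) => z /= /yK -> ->.
Qed.

End Transition.

Lemma local_inverse_transition (x y : chart R n S) : coordinates_at p x -> coordinates_at p y ->
  local_inverse (y \o chart_inv x) (x \o chart_inv y).
Proof.
move=> xC yC; split; [exact: anv_transition|exact: transition0| |].
  exact: transitionK xC yC.
exact: transitionK yC xC.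
Qed.

(** The domain of [x] is cut down to the preimage of [W], and [chart_inv x \o G] is the inverse
    chart; compatibility with the atlas is a composition of analytic maps at each point of [W]. *)
Lemma coordinates_comp (x : chart R n S) (F : 'rV[C]_n -> 'rV[C]_n) : coordinates_at p x ->
  anv F 0 -> F 0 = 0 -> jac F 0 \in unitmx ->
  exists y : chart R n S, coordinates_at p y /\ y = F \o x :> (S -> 'rV[C]_n).
Proof.
move=> xC Fa F0 Fj; have [G FG] := inverse_function Fa F0 Fj.
have [ic xp x0 xt] := xC; have [[oD oI] xK _ _] := ic.
have I0 : (x @` chart_dom x) 0 by exists p.
have [W [oW W0 WI oFW WP]] := local_inverse_open Fa F0 FG (open_nbhs_nbhs (conj oI I0)).
pose y := Chart (chart_dom x `&` x @^-1` W) (F \o x) (chart_inv x \o G).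
have yI : y @` chart_dom y = F @` W.
  apply/seteqP; split=> [_ [q [qD Wq] <-]|_ [z Wz <-]]; first by exists (x q).
  by have [q qD qz] := WI z Wz; exists q; rewrite /= ?qz //; split; rewrite /preimage /= ?qz.
have oy : open (chart_dom y).
  rewrite openE => q [qD Wq]; apply: filterI; first by move: oD; rewrite openE; exact.
  by apply: (chart_cont ic qD); move: oW; rewrite openE; exact.
have oyI : open (y @` chart_dom y) by rewrite yI.
exists y; split => //; split => //=.
- split => //.
  + by move=> q [qD Wq] /=; have [_ _ ->] := WP _ Wq; exact: xK.
  + rewrite continuous_open_subspace // => q; rewrite inE => -[qD Wq].
    have [Fq _ _] := WP _ Wq.
    exact: continuous_comp (chart_cont ic qD) (anv_cont Fq).
  + rewrite continuous_open_subspace // yI => u; rewrite inE => -[z Wz <-].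
    have [_ Gz GFz] := WP _ Wz.
    apply: continuous_comp; first exact: anv_cont Gz.
    by rewrite GFz; apply: (chart_inv_cont ic); exact: WI.
- by split => //; rewrite /preimage /= x0.
- by rewrite x0.
- move=> c ca; have [cx xc] := xt c ca; have [_ cK _ _] := atlas_chart ca; split=> q /=.
  + move=> qc [qx Wq] i; apply: analytic_of_an; have [Fq _ _] := WP _ Wq.
    apply: (an_comp (f := fun z => F z 0 i) (F := x \o chart_inv c)).
      by rewrite /= cK //; exact: Fq.
    by move=> j; apply: an_of_analytic; exact: cx.
  + move=> [qx Wq] qc i; apply: analytic_of_an; have [_ Gq GFq] := WP _ Wq.
    apply: (an_comp (f := fun z => c (chart_inv x z) 0 i) (F := G)) => //.
    by rewrite GFq; apply: an_of_analytic; exact: xc.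
Qed.

End CoordinateChange.

(** * Splayed divisors and the equality of ideals *)

Section Splayed.
Variables (R : realType) (n : nat).
Local Notation C := (Cx R).

Lemma squarefree_ext m (f g : 'rV[C]_m -> C) : (\forall z \near (0 : 'rV[C]_m), g z = f z) ->
  squarefree_germ f -> squarefree_germ g.
Proof. by move=> E sq a aa ad; apply: sq aa _; exact: dvd_ext ad E. Qed.

Lemma squarefree_unit m (f u : 'rV[C]_m -> C) : an u 0 -> u 0 != 0 -> squarefree_germ f ->
  squarefree_germ (fun z => u z * f z).
Proof.
move=> ua u0 sq a aa ad; apply: sq aa (dvd_trans ad _).
exists (fun z => (u z)^-1); first exact: an_inv.
by apply: filterS (an_neq0 ua u0) => z z0; rewrite mulrAC mulfV // mul1r.
Qed.

Lemma join_coordsE (k : 'I_n) (a : 'rV[C]_k) (b : 'rV[C]_(n - k)) j :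
  join_coords a b 0 j = row_mx a b 0 (cast_ord (esym (subnKC (ltnW (ltn_ord k)))) j).
Proof. by rewrite castmxE ord1. Qed.

Lemma anv_join m (k : 'I_n) (a : 'rV[C]_m -> 'rV[C]_k) (b : 'rV[C]_m -> 'rV[C]_(n - k)) z :
  anv a z -> anv b z -> anv (fun z => join_coords (a z) (b z)) z.
Proof.
move=> aa ba j; under eq_fun do rewrite join_coordsE.
have [i ij|i ij] := split_ordP (cast_ord (esym (subnKC (ltnW (ltn_ord k)))) j); rewrite ij.
  by under eq_fun do rewrite row_mxEl; exact: aa.
by under eq_fun do rewrite row_mxEr; exact: ba.
Qed.

Lemma jac_join m (k : 'I_n) (a : 'rV[C]_m -> 'rV[C]_k) (b : 'rV[C]_m -> 'rV[C]_(n - k)) z :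
  jac (fun z => join_coords (a z) (b z)) z =
  castmx (erefl, subnKC (ltnW (ltn_ord k))) (row_mx (jac a z) (jac b z)).
Proof.
apply/matrixP => i j; rewrite jacE castmxE cast_ord_id.
under eq_fun do rewrite join_coordsE.
have [l jl|l jl] := split_ordP (cast_ord (esym (subnKC (ltnW (ltn_ord k)))) j); rewrite jl.
  by under eq_fun do rewrite row_mxEl; rewrite row_mxEl jacE.
by under eq_fun do rewrite row_mxEr; rewrite row_mxEr jacE.
Qed.

Variables (S : complexManifold R n) (p : S).
Local Notation pull x f := (f \o chart_inv x).

Lemma defining_unit (x : chart R n S) (D : set S) (f F : S -> C) (u : 'rV[C]_n -> C) : coordinates_at p x ->
  germ_reduced p f -> zero_locus_at p D f -> an u 0 -> u 0 != 0 ->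
  (\forall z \near (0 : 'rV[C]_n), pull x F z = u z * pull x f z) -> defining_equation p D F.
Proof.
move=> xC /(germ_reducedE xC) [fa sq] /(coord_near xC) Z ua u0 E.
split.
  apply/(germ_reducedE xC); split; last exact: squarefree_ext E (squarefree_unit ua u0 sq).
  by apply: an_ext (an_mul ua fa) _; apply: filterS E => z ->.
apply/(coord_near xC); apply: filterS3 Z E (an_neq0 ua u0) => z Dz /= -> nz.
rewrite Dz; split=> [->|/eqP]; first exact: mulr0.
by rewrite mulf_eq0 (negbTE nz) => /eqP.
Qed.

Lemma defining_dvd (y : chart R n S) (D : set S) (f g : S -> C) : coordinates_at p y ->
  germ_reduced p f -> zero_locus_at p D f -> germ_reduced p g -> zero_locus_at p D g ->
  dvdan (pull y f) (pull y g).
Proof.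
move=> yC /(germ_reducedE yC) [fa sf] /(coord_near yC) Zf /(germ_reducedE yC) [ga sg] /(coord_near yC) Zg.
by apply: nullstellensatz => //; apply: filterS2 Zf Zg => z e1 e2 fz; apply/e2/e1.
Qed.

Lemma reduced_zg (y : chart R n S) (f : S -> C) : coordinates_at p y -> germ_reduced p f -> ~ zg (pull y f).
Proof. by move=> yC /(germ_reducedE yC) [_ /squarefree_nz]. Qed.

(** Two reduced equations of the same set divide each other by the Nullstellensatz. This matches the
    equations supplied by splayedness with the given [g] and [h]. *)
Lemma defining_equation_unit (y : chart R n S) (D : set S) (f g : S -> C) : coordinates_at p y ->
  germ_reduced p f -> zero_locus_at p D f -> germ_reduced p g -> zero_locus_at p D g ->
  exists u, [/\ an u 0, u 0 != 0 & \forall z \near (0 : 'rV[C]_n), pull y g z = pull y f z * u z].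
Proof.
move=> yC fr Zf gr Zg; have [fa _] := (germ_reducedE yC f).1 fr.
exact: dvd_antisym fa (reduced_zg yC fr) (defining_dvd yC fr Zf gr Zg) (defining_dvd yC gr Zg fr Zf).
Qed.

Lemma splayed_splitting (x : chart R n S) (D D1 D2 : set S) (g h : S -> C) : coordinates_at p x ->
  zero_locus_at p D1 g -> zero_locus_at p D2 h -> germ_reduced p g -> germ_reduced p h ->
  splayed p D D1 D2 -> splitting_ideals (pull x g) (pull x h).
Proof.
move=> xC Zg Zh gr hr [y [k [h1 [h2 [[yC k0] [/an_of_analytic h1a /an_of_analytic h2a] [[r1 Z1] [r2 Z2]] _]]]]].
have [u1 [u1a u10 E1]] := defining_equation_unit yC r1 Z1 gr Zg.
have [u2 [u2a u20 E2]] := defining_equation_unit yC r2 Z2 hr Zh.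
have e1 := pushK yC (h1 \o first_coords k); have e2 := pushK yC (h2 \o last_coords k).
have n1 : ~ zg h1.
  move=> /(zg_comp (@anv_first R n k 0) (first_coords0 _ _)) z1; apply: (reduced_zg yC r1).
  by apply: filterS2 e1 z1 => z /= ->.
have n2 : ~ zg h2.
  move=> /(zg_comp (@anv_last R n k 0) (last_coords0 _ _)) z2; apply: (reduced_zg yC r2).
  by apply: filterS2 e2 z2 => z /= ->.
have f1a : an (h1 \o first_coords k) 0 by apply: an_comp; [rewrite first_coords0|exact: anv_first].
have f2a : an (h2 \o last_coords k) 0 by apply: an_comp; [rewrite last_coords0|exact: anv_last].
have ga := (germ_reducedE yC g).1 gr; have ha := (germ_reducedE yC h).1 hr.
have sp : splitting_ideals (pull y g) (pull y h).
  apply: (splitting_unit f1a f2a ga.1 ha.1 u1a u2a u10 u20 _ _ (splitting_split k0 h1a h2a n1 n2)).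
    by apply: filterS2 E1 e1 => z -> /= ->.
  by apply: filterS2 E2 e2 => z -> /= ->.
have gx := (germ_reducedE xC g).1 gr; have hx := (germ_reducedE xC h).1 hr.
have Fa := anv_transition xC yC; have F0 := transition0 xC yC.
have sp' := splitting_comp ga.1 ha.1 Fa F0 (local_inverse_transition xC yC) sp.
have Fan f : an (pull y f) 0 -> an (pull y f \o (y \o chart_inv x)) 0 by move=> fa; apply: an_comp; rewrite ?F0.
apply: (splitting_unit (Fan _ ga.1) (Fan _ ha.1) gx.1 hx.1 (an_cst 1 0) (an_cst 1 0) (oner_neq0 _) (oner_neq0 _) _ _ sp').
  by apply: filterS (pull_transition xC yC g) => z ->; rewrite mulr1.
by apply: filterS (pull_transition xC yC h) => z ->; rewrite mulr1.
Qed.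

Lemma splitting_splayed (x : chart R n S) (D D1 D2 : set S) (g h : S -> C) : coordinates_at p x ->
  divisor D -> zero_locus_at p D (g \* h) -> zero_locus_at p D1 g -> zero_locus_at p D2 h ->
  germ_reduced p g -> germ_reduced p h -> ~ germ_unit p g -> ~ germ_unit p h ->
  germ_no_common_factor p g h -> splitting_ideals (pull x g) (pull x h) -> splayed p D D1 D2.
Proof.
move=> xC /(_ p) [f [fr Zf]] Z Zg Zh gr hr gu hu cop sp.
have [ga gs] := (germ_reducedE xC g).1 gr; have [ha hs] := (germ_reducedE xC h).1 hr.
have [fa fs] := (germ_reducedE xC f).1 fr.
have unit0 k : an (pull x k) 0 -> ~ germ_unit p k -> pull x k 0 = 0.
  move=> ka ku; apply/eqP/negPn/negP => k0; apply: ku; apply/(germ_unitE xC); split => //.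
  by rewrite -(coord_inv0 xC).
have cop' := germ_no_common_factorE xC cop.
(* The divisor provides a reduced equation [f] of [D] at [p], with the same zeros as [g * h]. *)
have ghs : squarefree_germ (fun z => pull x g z * pull x h z).
  apply: (squarefree_mul ga ha fa gs hs cop' fs).
  apply: filterS2 ((coord_near xC _).1 Zf) ((coord_near xC _).1 Z) => z e1 e2.
  by split=> [/e1/e2|/e2/e1].
have ghr : germ_reduced p (g \* h) by apply/(germ_reducedE xC); split => //; exact: an_mul.
have [k [/andP [k0 kn] [w [v [G [w' [v' [H [T T' ind]]]]]]]]] :=
  split_coordinates ga ha (unit0 _ ga gu) (unit0 _ ha hu) (squarefree_nz gs) (squarefree_nz hs) cop' sp.
(* The two submersions, with [k] and [n - k] components and independent differentials, are joined
   into one system of coordinates. *)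
pose kI := Ordinal kn; pose F z := @join_coords R n kI (w z) (w' z).
have Fa : anv F 0 := anv_join (k := kI) (through_w T) (through_w T').
have F0 : F 0 = 0.
  by rewrite -[RHS](join_first_last kI) first_coords0 last_coords0 /F (through_w0 T) (through_w0 T').
have Fj : jac F 0 \in unitmx by rewrite /F (jac_join (k := kI)); exact: indep_unit.
have [y [yC yE]] := coordinates_comp xC Fa F0 Fj.
have EG : \forall z \near (0 : 'rV[C]_n), G (first_coords kI (y (chart_inv x z))) = v z * pull x g z.
  apply: filterS2 (throughE T) (coordK xC) => z e1 e2.
  by rewrite yE /= e2 first_join -e1.
have EH : \forall z \near (0 : 'rV[C]_n), H (last_coords kI (y (chart_inv x z))) = v' z * pull x h z.
  apply: filterS2 (throughE T') (coordK xC) => z e1 e2.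
  by rewrite yE /= e2 last_join -e1.
exists y, kI, G, H; split.
- by [].
- by split; apply: analytic_of_an; [exact: through_G T|exact: through_G T'].
- split.
    exact: (defining_unit xC gr Zg (through_v T) (through_v0 T) EG).
  exact: (defining_unit xC hr Zh (through_v T') (through_v0 T') EH).
- apply: (defining_unit (u := fun z => v z * v' z) xC ghr Z).
  + exact: an_mul (through_v T) (through_v T').
  + by apply: mulf_neq0; [exact: through_v0 T|exact: through_v0 T'].
  + by apply: filterS2 EG EH => z /= -> ->; rewrite mulrACA.
Qed.

End Splayed.

Theorem proposition3p5 (R : realType) (n : nat) (S : complexManifold R n) (p : S)
    (x : chart R n S) (D D1 D2 : set S) (g h : S -> Cx R)
    (x_coord : coordinates_at p x)
    (D_divisor : divisor D)
    (D_union : D = D1 `|` D2)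
    (D_eq : zero_locus_at p D (g \* h))
    (D1_eq : zero_locus_at p D1 g)
    (D2_eq : zero_locus_at p D2 h)
    (g_reduced : germ_reduced p g)
    (h_reduced : germ_reduced p h)
    (g_nonunit : ~ germ_unit p g)
    (h_nonunit : ~ germ_unit p h)
    (gh_coprime : germ_no_common_factor p g h) :
  splayed p D D1 D2 <->
  ideal_add p (germ_ideal p [:: g \* h]) (jacobian_ideal p x (g \* h)) =
  germ_ideal p [:: g; h]
    `&` ideal_add p (germ_ideal p [:: g]) (jacobian_ideal p x g)
    `&` ideal_add p (germ_ideal p [:: h]) (jacobian_ideal p x h).
Proof.
have [ga _] := (germ_reducedE x_coord g).1 g_reduced.
have [ha _] := (germ_reducedE x_coord h).1 h_reduced.
apply: iff_trans (iff_sym (splitting_idealsE x_coord ga ha)); split.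
  exact: splayed_splitting.
exact: splitting_splayed.
Qed.
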